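(* For $k\in\mathbb{N}$ let $S_k:=S(p_k)$, $\theta_k:=\theta(p_k)$, $Q_k:=Q(p_k)$ and $\tilde g_k:=\log\tilde G_k$, where $\tilde G_k:=\max\{G(N): N\in\tilde W_k\}$. Then $$\liminf_{k\to\infty}\,(\tilde g_k-\gamma-Q_k)\,\sqrt{p_k}\,\log p_k=-2\sqrt2 .$$ More precisely, the following two statements hold. (I) There is a sequence of integers $M_k\in\tilde W_k$, $k\in\mathbb{N}$, such that for every $\varepsilon>0$ there is $K_\varepsilon$ with $$\tilde g_k\ \ge\ \log G(M_k)\ >\ S_k-\log\log\theta_k-\frac{2\sqrt2+\varepsilon}{\sqrt{p_k}\,\log p_k}\qquad\text{for all }k>K_\varepsilon .$$ (II) There is an infinite set $E\subset\mathbb{N}$ such that for every $\varepsilon>0$ there is $K_\varepsilon$ with the following property: for all $k\in E$ with $k>K_\varepsilon$ and all $N\in\tilde W_k$, $$\log G(N)\ \le\ \tilde g_k\ <\ S_k-\log\log\theta_k-\frac{2\sqrt2-\varepsilon}{\sqrt{p_k}\,\log p_k}.$$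
   Context: $p_1<p_2<\dots$ is the increasing enumeration of all primes. $\theta(x):=\sum_{p\le x}\log p$ (sum over primes). $S(x):=\sum_{p\le x}\log\frac{p}{p-1}$. $\gamma$ is the Euler–Mascheroni constant. For $x\ge 3$, $Q(x):=S(x)-\log\log\theta(x)-\gamma$ (the remainder in the modified Mertens formula). $\sigma(N)$ is the sum of the divisors of $N$, and the Gronwall number is $G(N):=\frac{\sigma(N)}{N\log\log N}$. $W_k$ is the set of integers $N>1$ whose greatest prime factor is $p_k$, and $\tilde W_k$ is the set of those $N\in W_k$ that are divisible by every prime $p_j$ with $j\le k$ (i.e. $N=p_1^{\alpha_1}\cdots p_k^{\alpha_k}$ with all $\alpha_j\ge1$). *)

(* Defs.v *)
From Stdlib Require Import Reals Lra.
From Coquelicot Require Import Coquelicot.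
From mathcomp Require Import ssreflect ssrfun ssrbool eqtype ssrnat seq div fintype bigop prime.

Definition next_prime (m : nat) : nat :=
  ex_minn (P := fun q => ((m < q)%N && prime q))
    (let: exist2 p H1 H2 := prime_above m in ex_intro _ p (introT andP (conj H1 H2))).

Fixpoint pr0 (k : nat) : nat :=
  match k with
  | O => 2
  | S k' => next_prime (pr0 k')
  end.

(* p_k, 1-indexed: p_1 = 2, p_2 = 3, ...  (p_0 is a junk value, = 2) *)
Definition p (k : nat) : nat := pr0 (k.-1).

Open Scope R_scope.

Definition theta (n : nat) : R :=
  sum_f_R0 (fun i => if prime i then ln (INR i) else 0) n.

Definition Ssum (n : nat) : R :=
  sum_f_R0 (fun i => if prime i then ln (INR i / (INR i - 1)) else 0) n.

Definition euler_gamma : R :=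
  real (Lim_seq (fun n => sum_f_R0 (fun i => / INR (i + 1)) n - ln (INR (n + 1)))).

Definition Q (n : nat) : R := Ssum n - ln (ln (theta n)) - euler_gamma.

Definition sigma (N : nat) : nat := (\sum_(d <- divisors N) d)%N.

Definition G (N : nat) : R := INR (sigma N) / (INR N * ln (ln (INR N))).

Definition inWt (k N : nat) : Prop :=
  (1 < N)%nat /\ (forall q : nat, prime q -> (q %| N)%N -> (q <= p k)%nat) /\
  (forall j : nat, (1 <= j)%nat -> (j <= k)%nat -> (p j %| N)%N).

(* G~_k = max { G(N) : N in W~_k } (taken as the supremum, which is attained) *)
Definition Gt (k : nat) : R := real (Lub_Rbar (fun y => exists N, inWt k N /\ y = G N)).

Definition gt (k : nat) : R := ln (Gt k).

Definition S_k (k : nat) : R := Ssum (p k).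
Definition theta_k (k : nat) : R := theta (p k).
Definition Q_k (k : nat) : R := Q (p k).

(* Main.v *)
(* By the prime number theorem the limit itself equals -2 sqrt 2, so the set E of part (II) can be
   all of N.  Write x = p_k and N = prod_(q <= x) q ^ a_q with all a_q >= 1.  Then ln G(N) falls
   short of S(x) - ln ln theta(x) by the sum of
     ln ln (theta(x) + A) - ln ln theta(x) ~ A / (x ln x),   A = sum (a_q - 1) ln q,
   and of -ln (1 - q ^ -(a_q + 1)) over the primes q <= x.  A prime q thus costs either about
   ln q / (x ln x), when a_q >= 2, or about 1 / q ^ 2, when a_q = 1; these prices agree at
   q = y ~ sqrt (2 x), and with this cut both halves of the total are ~ sqrt 2 / (sqrt x ln x).

   The prime number theorem is proved by the Selberg-Erdos method for R(n) = psi(n) - n.  The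
   Tatuzawa-Iseki identity gives R(N) ln N + sum Lambda(k) R(N/k) = O(N), and one iteration bounds
   |R(N)| ln^2 N by 2 N sum_(s <= N) |R(s)| / s^2 ln (N/s) + O(N ln N).  If |R(s)| <= a s for
   large s, then the average of |R(s)| / s over a long logarithmic block is smaller than a by a
   fixed amount, so a can be decreased until it falls below any given positive number. *)

(* The two halves of the total involve theta(y) and the sum of 1 / q ^ 2 over primes q > y, so the
   constant 2 sqrt 2, and not only the order of magnitude, rests on theta(y) ~ y; Chebyshev's bounds
   would not do. The lower bound must hold for all exponents at once, but the cost of A is concave,
   not linear, and so does not split over the primes. It is replaced by a linear one: for A <= 4
   sqrt x the cost is at least A times the slope of ln ln at theta(x) + 4 sqrt x, still ~ 1 / (x ln
   x), while a larger A alone costs about 4 / (sqrt x ln x), which is too much since 4 > 2 sqrt 2.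
   With a linear cost every prime can be treated separately. For the upper bound, exponent 2 on all
   q <= y is not enough: the sum of 1 / q ^ 3 over small q is of constant order. Primes below a
   second cut z, a power of x smaller than sqrt x, therefore get higher exponents, and their total
   price is negligible. *)
Require Import Defs.
From Stdlib Require Import Reals Lra Lia.
From Coquelicot Require Import Coquelicot.
From HB Require Import structures.
From mathcomp Require Import ssreflect ssrfun ssrbool eqtype ssrnat seq div fintype bigop prime.
From mathcomp Require Import zify.
Set Implicit Arguments.
Unset Strict Implicit.
Unset Printing Implicit Defensive.
Open Scope R_scope.

(** * Finite sums of reals *)

HB.instance Definition _ := Monoid.isComLaw.Build R 0 Rplus
  (fun x y z => esym (Rplus_assoc x y z)) Rplus_comm Rplus_0_l.
HB.instance Definition _ := Monoid.isComLaw.Build R 1 Rmult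
  (fun x y z => esym (Rmult_assoc x y z)) Rmult_comm Rmult_1_l.
HB.instance Definition _ := Monoid.isMulLaw.Build R 0 Rmult Rmult_0_l Rmult_0_r.
HB.instance Definition _ := Monoid.isAddLaw.Build R Rmult Rplus
  (fun x y z => Rmult_plus_distr_r x y z) (fun x y z => Rmult_plus_distr_l x y z).

Notation "\rsum_ ( m <= i < n ) F" := (\big[Rplus/0]_(m <= i < n) F)
  (at level 34, F at level 41, i, m, n at level 50).
Notation "\rsum_ ( m <= i < n | P ) F" := (\big[Rplus/0]_(m <= i < n | P) F)
  (at level 34, F at level 41, i, m, n at level 50).

(** Stated for an arbitrary monoid law on [R], because it has to extend both sums and the product
    that defines [moebius]. *)
Lemma Rbig_widen (idx : R) (op : Monoid.law idx) m n k (F : nat -> R) (P : pred nat) :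
  (m <= n <= k)%N -> (forall i, (n <= i < k)%N -> ~~ P i) ->
  \big[op/idx]_(m <= i < k | P i) F i = \big[op/idx]_(m <= i < n | P i) F i.
Proof.
move=> /andP[mn nk] h; rewrite (big_cat_nat mn nk) /=.
rewrite [X in op _ X]big_nat_cond [X in op _ X]big_pred0 ?Monoid.mulm1 // => i.
by case: (boolP (n <= i < k)%N) => //= hi; apply/negbTE/h.
Qed.

Section RSum.
Implicit Types (m n k : nat) (F H : nat -> R).

Lemma rsum_le m n (P : pred nat) F H :
  (forall i, (m <= i < n)%N -> P i -> F i <= H i) ->
  \rsum_(m <= i < n | P i) F i <= \rsum_(m <= i < n | P i) H i.
Proof.
move=> h; rewrite big_nat_cond [X in _ <= X]big_nat_cond.
apply: (big_ind2 (fun x y => x <= y)); first exact: Rle_refl.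
- by move=> *; apply: Rplus_le_compat.
- by move=> i /andP[hi Pi]; apply: h.
Qed.

Lemma rsum_ge0 m n (P : pred nat) F :
  (forall i, (m <= i < n)%N -> P i -> 0 <= F i) -> 0 <= \rsum_(m <= i < n | P i) F i.
Proof.
move=> h; rewrite big_nat_cond; apply: (big_ind (fun x => 0 <= x)); first exact: Rle_refl.
- by move=> *; lra.
- by move=> i /andP[hi Pi]; apply: h.
Qed.

Lemma rsum_abs m n (P : pred nat) F :
  Rabs (\rsum_(m <= i < n | P i) F i) <= \rsum_(m <= i < n | P i) Rabs (F i).
Proof.
apply: (big_ind2 (fun x y => Rabs x <= y)); first by rewrite Rabs_R0; lra.
- by move=> x1 y1 x2 y2 h1 h2; apply: Rle_trans (Rabs_triang _ _) _; lra.
- by move=> i _; lra.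
Qed.

Lemma rsumD m n (P : pred nat) F H :
  \rsum_(m <= i < n | P i) (F i + H i)
  = \rsum_(m <= i < n | P i) F i + \rsum_(m <= i < n | P i) H i.
Proof. exact: big_split. Qed.

Lemma rsum_mull (c : R) m n (P : pred nat) F :
  c * \rsum_(m <= i < n | P i) F i = \rsum_(m <= i < n | P i) (c * F i).
Proof. exact: big_distrr. Qed.

Lemma rsum_mulr (c : R) m n (P : pred nat) F :
  (\rsum_(m <= i < n | P i) F i) * c = \rsum_(m <= i < n | P i) (F i * c).
Proof. exact: big_distrl. Qed.

Lemma rsumB m n (P : pred nat) F H :
  \rsum_(m <= i < n | P i) (F i - H i)
  = \rsum_(m <= i < n | P i) F i - \rsum_(m <= i < n | P i) H i.
Proof.
rewrite (_ : _ - _ = \rsum_(m <= i < n | P i) F i + (-1) * \rsum_(m <= i < n | P i) H i); last ring.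
by rewrite rsum_mull -rsumD; apply: eq_bigr => i _; ring.
Qed.

Lemma rsum_recr m n F : (m <= n)%N ->
  \rsum_(m <= i < n.+1) F i = \rsum_(m <= i < n) F i + F n.
Proof. exact: big_nat_recr. Qed.

Lemma rsum_recr_cond m n (P : pred nat) F : (m <= n)%N ->
  \rsum_(m <= i < n.+1 | P i) F i
  = \rsum_(m <= i < n | P i) F i + (if P n then F n else 0).
Proof. by move=> mn; rewrite big_mkcond rsum_recr // [in RHS]big_mkcond. Qed.

Lemma rsum_cat m n k F : (m <= n)%N -> (n <= k)%N ->
  \rsum_(m <= i < k) F i = \rsum_(m <= i < n) F i + \rsum_(n <= i < k) F i.
Proof. exact: big_cat_nat. Qed.

Lemma rsum_const m n (c : R) : (m <= n)%N -> \rsum_(m <= i < n) c = INR (n - m) * c.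
Proof.
move=> /subnKC <-; rewrite addKn; elim: (n - m)%N => [|d IH].
  by rewrite addn0 big_geq //=; ring.
by rewrite addnS rsum_recr ?leq_addr // IH S_INR; ring.
Qed.

Lemma rsum_swap n (P : rel nat) (F : nat -> nat -> R) a b c :
  \rsum_(a <= i < b) \rsum_(c <= j < n | P i j) F i j
  = \rsum_(c <= j < n) \rsum_(a <= i < b | P i j) F i j.
Proof.
under eq_bigr do rewrite big_mkcond.
rewrite exchange_big_nat /=.
by apply: eq_bigr => j _; rewrite [RHS]big_mkcond.
Qed.

(** Summation by parts with the boundary term at [n.+1]: in [selberg_second] the function [g]
    depends on [N %/ k], so that this term is zero. *)
Lemma abel n (a g : nat -> R) :
  \rsum_(1 <= k < n.+1) (a k * g k)
  = (\rsum_(1 <= i < n.+1) a i) * g n.+1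
    + \rsum_(1 <= k < n.+1) ((\rsum_(1 <= i < k.+1) a i) * (g k - g k.+1)).
Proof.
elim: n => [|n IH]; first by rewrite !big_geq //; ring.
rewrite rsum_recr // IH [X in _ = _ + X]rsum_recr //.
rewrite (@rsum_recr 1 n.+1 a) //; ring.
Qed.

Lemma telescope m n F : (m <= n)%N ->
  \rsum_(m <= k < n) (F k.+1 - F k) = F n - F m.
Proof.
move=> /subnKC <-; elim: (n - m)%N => [|d IH]; first by rewrite addn0 big_geq //; ring.
by rewrite addnS rsum_recr ?leq_addr // IH; ring.
Qed.

Lemma rsum_le_range m n k F : (m <= n <= k)%N ->
  (forall i, (n <= i < k)%N -> 0 <= F i) ->
  \rsum_(m <= i < n) F i <= \rsum_(m <= i < k) F i.
Proof.
move=> /andP[mn nk] h; rewrite (rsum_cat _ mn nk).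
by have := @rsum_ge0 n k xpredT F (fun i hi _ => h i hi); lra.
Qed.

End RSum.

Lemma INR_lt0 n : (0 < n)%N -> 0 < INR n.
Proof. by move=> /ltP; apply: lt_0_INR. Qed.

Lemma INR_le m n : (m <= n)%N -> INR m <= INR n.
Proof. by move=> /leP; apply: le_INR. Qed.

Lemma INR_lt m n : (m < n)%N -> INR m < INR n.
Proof. by move=> /ltP; apply: lt_INR. Qed.

Lemma INR_ge1 n : (0 < n)%N -> 1 <= INR n.
Proof. exact: (@INR_le 1). Qed.

Lemma INR_muln m n : INR (m * n)%N = INR m * INR n.
Proof. by rewrite -mult_INR. Qed.

Lemma INR_addn m n : INR (m + n)%N = INR m + INR n.
Proof. by rewrite -plus_INR. Qed.

Lemma INR_divn_le n d : (0 < d)%N -> INR (n %/ d) <= INR n / INR d.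
Proof.
move=> d0; apply/Rle_div_r; first exact: INR_lt0.
by rewrite -INR_muln; apply: INR_le; apply: leq_trunc_div.
Qed.

Lemma INR_divn_gt n d : (0 < d)%N -> INR n / INR d < INR (n %/ d) + 1.
Proof.
move=> d0; apply/Rlt_div_l; first exact: INR_lt0.
rewrite -S_INR -INR_muln; apply: INR_lt; exact: ltn_ceil.
Qed.

Lemma rsum_multiples N d (f : nat -> R) : (0 < d)%N ->
  \rsum_(1 <= k < N.+1 | d %| k) f (k %/ d)%N = \rsum_(1 <= m < (N %/ d).+1) f m.
Proof.
move=> d0; elim: N => [|N IH]; first by rewrite div0n !big_geq.
rewrite rsum_recr_cond // IH divnS //.
case: (boolP (d %| N.+1)) => hd; last by rewrite add0n Rplus_0_r.
by rewrite add1n [RHS]rsum_recr.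
Qed.

(** Both sides run over the pairs [(d, m)] with [d * m <= N]; on the right they are grouped by the
    product [k]. *)
Lemma divisor_sum_swap N (F : nat -> nat -> R) :
  \rsum_(1 <= d < N.+1) \rsum_(1 <= m < (N %/ d).+1) F d m
  = \rsum_(1 <= k < N.+1) \rsum_(1 <= d < k.+1 | d %| k) F d (k %/ d)%N.
Proof.
have -> : \rsum_(1 <= k < N.+1) \rsum_(1 <= d < k.+1 | d %| k) F d (k %/ d)%N
  = \rsum_(1 <= k < N.+1) \rsum_(1 <= d < N.+1 | d %| k) F d (k %/ d)%N.
  rewrite big_nat [RHS]big_nat; apply: eq_bigr => k /andP[k1 kN].
  symmetry; apply: Rbig_widen; first by lia.
  move=> i /andP[ki _]; apply/negP => /(dvdn_leq k1); lia.
rewrite (@rsum_swap N.+1 (fun k d => d %| k)).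
rewrite big_nat [RHS]big_nat; apply: eq_bigr => d /andP[d0 _].
by rewrite rsum_multiples.
Qed.

Lemma Rbig_D1 (idx : R) (op : Monoid.com_law idx) j m n (F : nat -> R) (P : pred nat) :
  (m <= j < n)%N -> P j ->
  \big[op/idx]_(m <= i < n | P i) F i
  = op (F j) (\big[op/idx]_(m <= i < n | P i && (i != j)) F i).
Proof.
move=> hj Pj; rewrite big_mkcond (bigD1_seq j) ?iota_uniq ?mem_index_iota //= Pj.
by rewrite -big_mkcondl; congr (op _ _); apply: eq_bigl => i; rewrite andbC.
Qed.

Lemma divisor_rsum_widen n N (F : nat -> R) : (0 < n <= N)%N ->
  \rsum_(1 <= d < N.+1 | d %| n) F d = \rsum_(1 <= d < n.+1 | d %| n) F d.
Proof.
move=> /andP[n0 nN]; apply: Rbig_widen; first by lia.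
move=> i /andP[ni _]; apply/negP => /(dvdn_leq n0); lia.
Qed.

(** * Moebius and von Mangoldt functions *)

(** Written as a product over the prime divisors, so that multiplying the argument by one prime
    affects a single factor. *)
Definition moebius (n : nat) : R :=
  \big[Rmult/1]_(1 <= q < n.+1 | prime q && (q %| n)) (if q ^ 2 %| n then 0 else -1).

Lemma moebius_widen n N : (0 < n <= N)%N ->
  moebius n = \big[Rmult/1]_(1 <= q < N.+1 | prime q && (q %| n)) (if q ^ 2 %| n then 0 else -1).
Proof.
move=> /andP[n0 nN]; symmetry; apply: Rbig_widen; first by lia.
move=> i /andP[ni _]; apply/negP => /andP[_ /(dvdn_leq n0)]; lia.
Qed.

Lemma moebius_abs_le1 n : Rabs (moebius n) <= 1.
Proof.
apply: (big_ind (fun x => Rabs x <= 1)).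
- by rewrite Rabs_R1; lra.
- move=> x y hx hy; rewrite Rabs_mult -(Rmult_1_l 1).
  by apply: Rmult_le_compat => //; apply: Rabs_pos.
- by move=> i _; case: ifP => _; rewrite ?Rabs_R0 ?Rabs_Ropp ?Rabs_R1; lra.
Qed.

Lemma moebius_1 : moebius 1 = 1.
Proof. by rewrite /moebius big_mkcond big_nat1. Qed.

Lemma moebius_mul_prime p d : prime p -> (0 < d)%N -> ~~ (p %| d) -> moebius (p * d) = - moebius d.
Proof.
move=> pp d0 pd; have p0 := prime_gt0 pp.
have pd0 : (0 < p * d)%N by rewrite muln_gt0 p0.
rewrite (@moebius_widen d (p * d)) ?d0 ?leq_pmull // /moebius.
rewrite (@Rbig_D1 _ _ p); [|by rewrite p0 ltnS leq_pmulr|by rewrite pp dvdn_mulr].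
rewrite -mulnn dvdn_pmul2l // (negbTE pd) /= (_ : forall x, -1 * x = - x); last by move=> x; ring.
congr (- _).
rewrite big_mkcond [RHS]big_mkcond.
apply: eq_bigr => q _.
case: (eqVneq q p) => [->|qp]; first by rewrite (negbTE pd) !andbF.
rewrite andbT; case: (boolP (prime q)) => //= pq.
rewrite Euclid_dvdM // dvdn_prime2 // (negbTE qp) /=.
rewrite Gauss_dvdr // coprimeXl // prime_coprime // dvdn_prime2 //.
Qed.

Lemma moebius_mul_prime_dvd p d : prime p -> (0 < d)%N -> p %| d -> moebius (p * d) = 0.
Proof.
move=> pp d0 pd; have p0 := prime_gt0 pp.
rewrite /moebius (@Rbig_D1 _ _ p); [|by rewrite p0 ltnS leq_pmulr|by rewrite pp dvdn_mulr].
by rewrite -mulnn dvdn_pmul2l // pd /= Rmult_0_l.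
Qed.

(** A divisor of [p * m] is either prime to [p], and then divides [m], or [p] times a divisor of
    [m]. This lets [moebius] and [sigma] be handled one prime at a time. *)
Lemma divisor_rsum_split p m (f : nat -> R) : prime p -> (0 < m)%N ->
  \rsum_(1 <= d < (p * m).+1 | d %| p * m) f d
  = \rsum_(1 <= e < m.+1 | (e %| m) && ~~ (p %| e)) f e + \rsum_(1 <= e < m.+1 | e %| m) f (p * e)%N.
Proof.
move=> pp m0; have p0 := prime_gt0 pp.
rewrite (bigID (fun d => p %| d)) /= Rplus_comm; congr (_ + _).
  rewrite -(@Rbig_widen 0 Rplus 1 m.+1 (p * m).+1 f (fun e => (e %| m) && ~~ (p %| e))).
  - apply: eq_bigl => d; case: (boolP (p %| d)) => pd; rewrite ?andbF ?andbT //.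
    by rewrite Gauss_dvdr // coprime_sym prime_coprime.
  - by rewrite /= ltnS leq_pmull.
  - move=> i /andP[mi _]; apply/negP => /andP[/(dvdn_leq m0)]; lia.
transitivity (\rsum_(1 <= d < (p * m).+1 | p %| d)
   (fun e => if e %| m then f (p * e)%N else 0) (d %/ p)%N).
  rewrite big_mkcond [RHS]big_mkcond; apply: eq_bigr => d _ /=.
  case: (boolP (p %| d)) => pd; last by rewrite andbF.
  by case/dvdnP: pd => e ->; rewrite mulnK // andbT mulnC dvdn_pmul2l.
by rewrite (rsum_multiples _ (fun e => if e %| m then f (p * e)%N else 0) p0) mulKn // -big_mkcond.
Qed.

(** For [n = p * m], the value at [p * e] is [- moebius e] if [p] does not divide [e] and 0
    otherwise, so the two sums of [divisor_rsum_split] cancel. *)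
Lemma sum_moebius n : (0 < n)%N ->
  \rsum_(1 <= d < n.+1 | d %| n) moebius d = (if n == 1%N then 1 else 0).
Proof.
move=> n0; case: eqP => [->|n1]; first by rewrite big_mkcond big_nat1 moebius_1.
have {}n1 : (1 < n)%N by lia.
have pp := pdiv_prime n1; have /dvdnP[m nE] := pdiv_dvd n.
move: pp nE; set p := pdiv n => pp nE; rewrite mulnC in nE.
have m0 : (0 < m)%N by move: n0; rewrite nE muln_gt0 => /andP[].
rewrite nE divisor_rsum_split // big_mkcondr [X in _ + X]big_nat_cond.
have -> : \rsum_(1 <= e < m.+1 | (1 <= e < m.+1)%N && (e %| m)) moebius (p * e)
   = \rsum_(1 <= e < m.+1 | e %| m) (if ~~ (p %| e) then - moebius e else 0).
  rewrite [RHS]big_nat_cond; apply: eq_bigr => e /andP[/andP[e0 _] _].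
  by case: (boolP (p %| e)) => pe /=; [rewrite moebius_mul_prime_dvd|rewrite moebius_mul_prime].
by rewrite -rsumD big1 // => e _; case: ifP => _; ring.
Qed.

(** A prime power is recognised as a power of its own least prime factor. *)
Definition mangoldt (n : nat) : R :=
  if (1 < n)%N && (n == pdiv n ^ logn (pdiv n) n)%N then ln (INR (pdiv n)) else 0.

Lemma mangoldt_prime_pow q j : prime q -> (0 < j)%N -> mangoldt (q ^ j) = ln (INR q).
Proof.
move=> pq; case: j => // j _; rewrite /mangoldt pdiv_pfactor // pfactorK // eqxx andbT.
by rewrite -{1}(expn0 q) ltn_exp2l // prime_gt1.
Qed.

Lemma mangoldt_prime q : prime q -> mangoldt q = ln (INR q).
Proof. by move=> pq; rewrite -(@mangoldt_prime_pow q 1) ?expn1. Qed.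

Lemma mangoldt_neq0 n : mangoldt n <> 0 -> exists q j, [/\ prime q, (0 < j)%N & n = (q ^ j)%N].
Proof.
rewrite /mangoldt; case: ifP => // /andP[n1 /eqP h] _.
exists (pdiv n), (logn (pdiv n) n); split=> //; first exact: pdiv_prime.
by rewrite logn_gt0 mem_primes pdiv_prime // pdiv_dvd ltnW.
Qed.

Lemma ln_ge0 x : 1 <= x -> 0 <= ln x.
Proof. by move=> h; rewrite -ln_1; apply: ln_le; lra. Qed.

Lemma mangoldt_ge0 n : 0 <= mangoldt n.
Proof.
rewrite /mangoldt; case: ifP => [/andP[n1 _]|_]; last exact: Rle_refl.
apply: ln_ge0; apply: INR_ge1; exact: pdiv_gt0.
Qed.

(** Passing from [n] to [p * n] adds just one prime power divisor, [p ^ v.+1] with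
    [v = logn p n]. *)
Lemma sum_mangoldt_mul_prime p n : prime p -> (0 < n)%N ->
  \rsum_(1 <= d < (p * n).+1 | d %| p * n) mangoldt d
  = ln (INR p) + \rsum_(1 <= d < n.+1 | d %| n) mangoldt d.
Proof.
move=> pp n0; have p0 := prime_gt0 pp; have p1 := prime_gt1 pp.
have pn0 : (0 < p * n)%N by rewrite muln_gt0 p0.
rewrite -(@divisor_rsum_widen n (p * n)) ?n0 ?leq_pmull //.
set v := logn p n.
have lpn : logn p (p * n) = v.+1.
  by rewrite lognM // logn_prime // eqxx.
have dpn : p ^ v.+1 %| p * n by rewrite pfactor_dvdn // lpn.
have ndn : ~~ (p ^ v.+1 %| n) by rewrite pfactor_dvdn // -/v ltnn.
rewrite (@Rbig_D1 _ _ (p ^ v.+1)%N); [|by rewrite expn_gt0 p0 ltnS dvdn_leq|exact: dpn].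
rewrite mangoldt_prime_pow //; congr (_ + _).
rewrite big_mkcond [RHS]big_mkcond; apply: eq_bigr => d _.
case: (eqVneq d (p ^ v.+1)%N) => [->|dne]; first by rewrite andbF (negbTE ndn).
rewrite andbT.
case: (Req_dec (mangoldt d) 0) => [->|/mangoldt_neq0[q [j [pq j0 dE]]]]; first by rewrite !if_same.
congr (if _ then _ else _); rewrite dE.
case: (eqVneq q p) => qp; last first.
  by rewrite Gauss_dvdr // coprimeXl // prime_coprime // dvdn_prime2.
move: dne; rewrite dE qp !pfactor_dvdn // lpn -/v eqn_exp2l // => h.
by rewrite leq_eqVlt ltnS (negbTE h).
Qed.

Lemma sum_mangoldt n : (0 < n)%N -> \rsum_(1 <= d < n.+1 | d %| n) mangoldt d = ln (INR n).
Proof.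
elim: n {-2}n (leqnn n) => [|N IH] n; first by lia.
move=> nN n0; case: (ltnP 1 n) => n1; last first.
  have -> : n = 1%N by lia.
  by rewrite big_mkcond big_nat1 /= /mangoldt /= ln_1.
have pp := pdiv_prime n1; have /dvdnP[m nE] := pdiv_dvd n.
move: pp nE; set p := pdiv n => pp nE; rewrite mulnC in nE.
have p1 := prime_gt1 pp; have m0 : (0 < m)%N by move: n0; rewrite nE muln_gt0 => /andP[].
rewrite nE sum_mangoldt_mul_prime // IH //; last by move: nN; rewrite nE; nia.
by rewrite INR_muln ln_mult //; apply: INR_lt0 => //; exact: prime_gt0.
Qed.

(** Moebius inversion of [sum_mangoldt] gives the sum of [moebius d * ln (n / d)]. Then
    [ln d = ln n - ln (n / d)], and the part with [ln n] vanishes by [sum_moebius] and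
    [ln 1 = 0]. *)
Lemma sum_moebius_ln n : (0 < n)%N ->
  \rsum_(1 <= d < n.+1 | d %| n) (moebius d * ln (INR d)) = - mangoldt n.
Proof.
move=> n0.
have h : \rsum_(1 <= d < n.+1 | d %| n) (moebius d * ln (INR (n %/ d))) = mangoldt n.
  (* Expand [ln (n / d)] by [sum_mangoldt], then sum over [d] first. *)
  transitivity (\rsum_(1 <= d < n.+1) \rsum_(1 <= e < n.+1 | d * e %| n) (moebius d * mangoldt e)).
    rewrite big_mkcond big_nat [RHS]big_nat; apply: eq_bigr => d /andP[d0 _].
    case: (boolP (d %| n)) => dn; last first.
      by rewrite big_pred0 // => e; apply/negbTE/negP => /(dvdn_trans (dvdn_mulr _ (dvdnn d))); apply/negP.
    have nd0 : (0 < n %/ d)%N by rewrite divn_gt0 // dvdn_leq.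
    rewrite -sum_mangoldt // -(@divisor_rsum_widen _ n) ?nd0 ?leq_div // rsum_mull.
    by apply: eq_bigl => e; rewrite dvdn_divRL // mulnC.
  rewrite (@rsum_swap n.+1 (fun d e => d * e %| n)).
  rewrite big_nat.
  transitivity (\rsum_(1 <= e < n.+1) (if e == n then mangoldt e else 0)); last first.
    rewrite -big_mkcond /= (@Rbig_D1 _ _ n) ?n0 ?leqnn //=.
    by rewrite big_pred0 ?Rplus_0_r // => e; rewrite andbN.
  rewrite [RHS]big_nat; apply: eq_bigr => e /andP[e0 _].
  case: (boolP (e %| n)) => en; last first.
    rewrite big_pred0; last by move=> d; apply/negbTE/negP => /(dvdn_trans (dvdn_mull _ (dvdnn e))); apply/negP.
    by case: eqP => // E; move: en; rewrite E dvdnn.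
  have ne0 : (0 < n %/ e)%N by rewrite divn_gt0 // dvdn_leq.
  rewrite -rsum_mulr.
  have -> : \rsum_(1 <= d < n.+1 | d * e %| n) moebius d = (if e == n then 1 else 0).
    transitivity (\rsum_(1 <= d < n.+1 | d %| n %/ e) moebius d).
      by apply: eq_bigl => d; rewrite dvdn_divRL.
    rewrite divisor_rsum_widen ?ne0 ?leq_div // sum_moebius //.
    congr (if _ then _ else _); apply/eqP/eqP => [h|->]; last by rewrite divnn n0.
    by rewrite -(divnK en) h mul1n.
  by case: eqP => _; ring.
rewrite -h.
transitivity (\rsum_(1 <= d < n.+1 | d %| n) (moebius d * ln (INR n) - moebius d * ln (INR (n %/ d)))).
  rewrite big_nat_cond [RHS]big_nat_cond; apply: eq_bigr => d /andP[/andP[d0 _] dn].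
  have nd0 : (0 < n %/ d)%N by rewrite divn_gt0 // dvdn_leq.
  have -> : ln (INR n) = ln (INR (n %/ d)) + ln (INR d).
    by rewrite -ln_mult; [rewrite -INR_muln divnK|exact: INR_lt0|exact: INR_lt0].
  ring.
rewrite rsumB -rsum_mulr sum_moebius //.
by case: eqP => [->|_]; rewrite /= ?ln_1; ring.
Qed.

(** * Logarithmic sums and Chebyshev's bound *)

Lemma ln_le_sub1 x : 0 < x -> ln x <= x - 1.
Proof. by move=> x0; have := exp_ineq1_le (ln x); rewrite exp_ln //; lra. Qed.

Lemma ln_diff_le a b : 0 < a -> 0 < b -> ln b - ln a <= (b - a) / a.
Proof.
move=> a0 b0; rewrite -ln_div //.
have -> : (b - a) / a = b / a - 1 by field; lra.
by apply: ln_le_sub1; apply: Rdiv_lt_0_compat.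
Qed.

Lemma ln_succ_le n : (0 < n)%N -> ln (INR n.+1) - ln (INR n) <= / INR n.
Proof.
move=> n0; have h := INR_lt0 n0.
have := @ln_diff_le (INR n) (INR n.+1) h (INR_lt0 (ltn0Sn _)).
by rewrite S_INR (_ : (_ + 1 - _) / _ = / INR n) //; field; lra.
Qed.

Lemma ln_succ_ge n : (0 < n)%N -> / INR n.+1 <= ln (INR n.+1) - ln (INR n).
Proof.
move=> n0; have h := INR_lt0 n0.
have := @ln_diff_le (INR n.+1) (INR n) (INR_lt0 (ltn0Sn _)) h.
by rewrite S_INR (_ : (_ - (_ + 1)) / _ = - / (INR n + 1)); [lra|field; lra].
Qed.

Lemma ln_INR_ge0 n : (0 < n)%N -> 0 <= ln (INR n).
Proof. by move=> n0; apply: ln_ge0; apply: INR_ge1. Qed.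

Lemma ln_INR_le m n : (0 < m <= n)%N -> ln (INR m) <= ln (INR n).
Proof. by move=> /andP[m0 mn]; apply: ln_le; [apply: INR_lt0|apply: INR_le]. Qed.

Lemma sum_ln_ge n : (0 < n)%N ->
  INR n * ln (INR n) - INR n <= \rsum_(1 <= k < n.+1) ln (INR k).
Proof.
elim: n => // -[_ _|n IH _].
  by rewrite big_nat1 /= ln_1; lra.
rewrite rsum_recr //; have {IH} := IH isT.
have n0 : (0 < n.+1)%N by [].
have := ln_succ_le n0; have := INR_lt0 n0.
rewrite !(S_INR n.+1); move: (INR n.+1) => x; move: (ln _) (ln _) => v u x0 h1 H.
have : x * (u - v) <= 1.
  by rewrite -(Rinv_r x); [apply: Rmult_le_compat_l; lra|lra].
lra.
Qed.

Lemma sum_ln_le n : (0 < n)%N ->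
  \rsum_(1 <= k < n.+1) ln (INR k) <= INR n * ln (INR n) - INR n + ln (INR n) + 1.
Proof.
elim: n => // -[_ _|n IH _].
  by rewrite big_nat1 /= ln_1; lra.
rewrite rsum_recr //; have {IH} := IH isT.
have n0 : (0 < n.+1)%N by [].
have := ln_succ_ge n0; have := INR_lt0 n0.
rewrite !(S_INR n.+1); move: (INR n.+1) => x; move: (ln _) (ln _) => v u x0 h1 H.
have : 1 <= (x + 1) * (u - v).
  by rewrite -{1}(Rinv_r (x + 1)); [apply: Rmult_le_compat_l; lra|lra].
lra.
Qed.

Definition harm n := \rsum_(1 <= k < n.+1) / INR k.

Lemma harmS n : harm n.+1 = harm n + / INR n.+1.
Proof. exact: rsum_recr. Qed.

Lemma harm_le n : (0 < n)%N -> harm n <= ln (INR n) + 1.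
Proof.
rewrite /harm; elim: n => // -[_ _|n IH _]; first by rewrite big_nat1 /= ln_1; lra.
rewrite rsum_recr //; have := IH isT; have := @ln_succ_ge n.+1 isT; lra.
Qed.

Lemma harm_ge n : ln (INR n.+1) <= harm n.
Proof.
rewrite /harm; elim: n => [|n IH]; first by rewrite big_geq //= ln_1; lra.
rewrite rsum_recr //; have := @ln_succ_le n.+1 isT; lra.
Qed.

(** [harm n - ln (n + 1)] increases, [harm n - ln n] decreases, and they differ by at most [1 / n];
    the constant is the supremum of the former. *)
Lemma harm_gamma : exists g : R, 0 <= g <= 1 /\
  forall n, (0 < n)%N -> 0 <= harm n - ln (INR n) - g <= / INR n.
Proof.
pose u n := harm n - ln (INR n.+1); pose v n := harm n - ln (INR n).
have uS n : u n <= u n.+1.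
  by rewrite /u harmS; have := @ln_succ_le n.+1 isT; lra.
have vS n : (0 < n)%N -> v n.+1 <= v n.
  by move=> n0; rewrite /v harmS; have := ln_succ_ge n0; lra.
have umono m n : (m <= n)%N -> u m <= u n.
  by move=> /subnKC <-; elim: (n - m)%N => [|d IH]; rewrite ?addn0 ?addnS; [lra|have := uS (m + d)%N; lra].
have vmono m n : (0 < m <= n)%N -> v n <= v m.
  move=> /andP[m0 /subnKC <-]; elim: (n - m)%N => [|d IH]; rewrite ?addn0 ?addnS; first lra.
  by have := @vS (m + d)%N; rewrite addn_gt0 m0 => /(_ isT); lra.
have uv n : (0 < n)%N -> u n <= v n.
  by move=> n0; rewrite /u /v; have := @ln_INR_le n n.+1; rewrite n0 leqnSn => /(_ isT); lra.
have huv m n : (0 < n)%N -> u m <= v n.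
  move=> n0; apply: Rle_trans (umono m (maxn m n) (leq_maxl _ _)) _.
  apply: Rle_trans (uv _ _) (vmono _ _ _); rewrite ?n0 /= ?leq_maxr //.
  by rewrite leq_max n0 orbT.
have [g [g1 g2]] : { g | is_lub (fun x => exists m, x = u m) g }.
  apply: completeness; last by exists (u 0%N), 0%N.
  by exists (v 1%N) => _ [m ->]; apply: huv.
exists g; have gv n : (0 < n)%N -> g <= v n.
  by move=> n0; apply: g2 => _ [m ->]; apply: huv.
have ug n : u n <= g by apply: g1; exists n.
split.
  split; first by apply: Rle_trans (ug 0%N); rewrite /u /harm big_geq //= ln_1; lra.
  by apply: Rle_trans (gv 1%N isT) _; rewrite /v /harm big_nat1 /= ln_1; lra.
move=> n n0; have := gv n n0; have := ug n; have := ln_succ_le n0.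
by rewrite /u /v; lra.
Qed.

Lemma hyperbola_comm N (F : nat -> nat -> R) :
  \rsum_(1 <= d < N.+1) \rsum_(1 <= m < (N %/ d).+1) F d m
  = \rsum_(1 <= m < N.+1) \rsum_(1 <= d < (N %/ m).+1) F d m.
Proof.
have E (H : nat -> nat -> R) : \rsum_(1 <= d < N.+1) \rsum_(1 <= m < (N %/ d).+1) H d m
    = \rsum_(1 <= d < N.+1) \rsum_(1 <= m < N.+1 | (d * m <= N)%N) H d m.
  rewrite big_nat [RHS]big_nat; apply: eq_bigr => d /andP[d0 _].
  rewrite [RHS](@Rbig_widen 0 Rplus 1 (N %/ d).+1 N.+1).
  - rewrite big_nat [RHS]big_nat_cond; apply: eq_bigl => m; rewrite ltnS leq_divRL // mulnC.
    by case: (boolP (d * m <= N)%N); rewrite ?andbT ?andbF.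
  - by rewrite /= ltnS leq_div.
  - by move=> m; rewrite ltn_divLR // => /andP[h _]; rewrite -ltnNge mulnC.
rewrite E (E (fun m d => F d m)) (@rsum_swap N.+1 (fun d m => d * m <= N)%N).
by apply: eq_bigr => m _; apply: eq_bigl => d; rewrite mulnC.
Qed.

(** The right side pairs [H] with the Dirichlet convolution of [a] and [b]. *)
Lemma conv_sum N (a b H : nat -> R) :
  \rsum_(1 <= d < N.+1) (a d * \rsum_(1 <= m < (N %/ d).+1) (b m * H (d * m)%N))
  = \rsum_(1 <= k < N.+1) ((\rsum_(1 <= d < k.+1 | d %| k) (a d * b (k %/ d)%N)) * H k).
Proof.
under eq_bigr do rewrite rsum_mull.
rewrite divisor_sum_swap; apply: eq_bigr => k _.
rewrite rsum_mulr; apply: eq_bigr => d dk.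
by rewrite mulnC divnK //; ring.
Qed.

(** * The estimates of Chebyshev and Mertens *)

Definition psi n := \rsum_(1 <= k < n.+1) mangoldt k.

Lemma psi_ge0 n : 0 <= psi n.
Proof. by apply: rsum_ge0 => *; apply: mangoldt_ge0. Qed.

Lemma psiS n : psi n.+1 = psi n + mangoldt n.+1.
Proof. exact: rsum_recr. Qed.

Lemma psi0 : psi 0 = 0.
Proof. exact: big_geq. Qed.

Lemma psi_le m n : (m <= n)%N -> psi m <= psi n.
Proof. by move=> mn; apply: rsum_le_range => // *; apply: mangoldt_ge0. Qed.

Lemma sum_mangoldt_div N :
  \rsum_(1 <= k < N.+1) (mangoldt k * INR (N %/ k)) = \rsum_(1 <= k < N.+1) ln (INR k).
Proof.
transitivity (\rsum_(1 <= d < N.+1) (mangoldt d * \rsum_(1 <= m < (N %/ d).+1) (1 * 1))).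
  by apply: eq_bigr => k _; rewrite rsum_const // subSS subn0; ring.
rewrite (conv_sum N mangoldt (fun _ => 1) (fun _ => 1)).
apply: eq_big_nat => k /andP[k0 _]; rewrite Rmult_1_r -sum_mangoldt //.
by apply: eq_bigr => d _; rewrite Rmult_1_r.
Qed.

Lemma sum_psi_div N :
  \rsum_(1 <= k < N.+1) psi (N %/ k) = \rsum_(1 <= k < N.+1) ln (INR k).
Proof.
rewrite hyperbola_comm -sum_mangoldt_div; apply: eq_bigr => k _.
by rewrite rsum_const // subSS subn0 Rmult_comm.
Qed.

Lemma ln_INR_lt n : (0 < n)%N -> ln (INR n) + 1 <= INR n.
Proof. by move=> n0; have := ln_le_sub1 (INR_lt0 n0); lra. Qed.

(** Essentially the logarithm of a middle binomial coefficient. From [2 * M] to [2 * M + 2] the two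
    new factors are at most [2 * (M + 1)] each, so it grows by at most [2 * ln 2]. *)
Lemma lnfact_half_le N :
  \rsum_(1 <= k < N.+1) ln (INR k) - 2 * \rsum_(1 <= k < (N %/ 2).+1) ln (INR k) <= 2 * INR N.
Proof.
have ln21 : ln 2 <= 1 by have := @ln_le_sub1 2; lra.
have even M : \rsum_(1 <= k < (2 * M).+1) ln (INR k) - 2 * \rsum_(1 <= k < M.+1) ln (INR k)
    <= 2 * INR M.
  elim: M => [|M IH]; first by rewrite !big_geq //=; lra.
  rewrite mulnS add2n rsum_recr // rsum_recr // [X in _ - 2 * X]rsum_recr //.
  have M0 := INR_lt0 (ltn0Sn M); have M0' := pos_INR M.
  have : ln (INR (2 * M).+1) <= ln 2 + ln (INR M.+1).
    rewrite -ln_mult; try lra; apply: ln_le; rewrite !S_INR INR_muln /=; lra.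
  have : ln (INR (2 * M).+2) <= ln 2 + ln (INR M.+1).
    rewrite -ln_mult; try lra; apply: ln_le; rewrite !S_INR INR_muln /=; lra.
  have := S_INR M; lra.
rewrite {1 3}(divn_eq N 2) mulnC; have := ltn_pmod N (isT : (0 < 2)%N).
have := even (N %/ 2)%N; move: (N %/ 2)%N => M; case: (N %% 2)%N => [|[|//]] H _.
  by rewrite addn0 INR_muln /=; have := pos_INR M; lra.
rewrite addn1 rsum_recr // S_INR INR_muln /=.
have := @ln_INR_lt (2 * M).+1 isT; rewrite S_INR INR_muln /=; have := pos_INR M; lra.
Qed.

(** By [sum_mangoldt_div] the left side of [lnfact_half_le] is the sum of [mangoldt k] times
    [N %/ k - 2 * (N %/ 2 %/ k)]. This coefficient is nonnegative, and at least 1 for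
    [N / 2 < k <= N]. *)
Lemma psi_half N : psi N <= psi (N %/ 2) + 2 * INR N.
Proof.
have := lnfact_half_le N; rewrite -!sum_mangoldt_div.
have -> : \rsum_(1 <= k < (N %/ 2).+1) (mangoldt k * INR (N %/ 2 %/ k))
   = \rsum_(1 <= k < N.+1) (mangoldt k * INR (N %/ 2 %/ k)).
  rewrite [RHS](@rsum_cat 1 (N %/ 2).+1) //; last by rewrite ltnS leq_div.
  rewrite [X in _ + X](_ : _ = 0) ?Rplus_0_r // big_nat big1 // => k /andP[h _].
  by rewrite divn_small //= Rmult_0_r.
rewrite rsum_mull -rsumB => H; apply: Rle_trans (Rplus_le_compat_l _ _ _ H).
rewrite /psi (@rsum_cat 1 (N %/ 2).+1) //; last by rewrite ltnS leq_div.
apply: Rplus_le_compat_l; rewrite [X in _ <= X](@rsum_cat 1 (N %/ 2).+1) //; last by rewrite ltnS leq_div.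
rewrite -[X in X <= _]Rplus_0_l; apply: Rplus_le_compat.
  apply: rsum_ge0 => k /andP[k0 _] _.
  rewrite (_ : _ - _ = mangoldt k * (INR (N %/ k) - 2 * INR (N %/ 2 %/ k))); last ring.
  apply: Rmult_le_pos; first exact: mangoldt_ge0.
  have /INR_le : (2 * (N %/ 2 %/ k) <= N %/ k)%N.
    rewrite -divnMA [(2 * k)%N]mulnC divnMA mulnC; exact: leq_trunc_div.
  by rewrite INR_muln /=; lra.
apply: rsum_le => k /andP[k1 k2] _.
rewrite [(N %/ 2 %/ k)%N]divn_small //= Rmult_0_r Rmult_0_r Rminus_0_r.
rewrite -[X in X <= _]Rmult_1_r; apply: Rmult_le_compat_l; first exact: mangoldt_ge0.
apply: INR_ge1; rewrite divn_gt0 //; lia.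
Qed.

(** One halving costs [2 * n], and 4 solves [c / 2 + 2 = c]. *)
Lemma psi_le4 n : psi n <= 4 * INR n.
Proof.
elim: n {-2}n (leqnn n) => [|N IH] n nN.
  by move: nN; rewrite leqn0 => /eqP ->; rewrite psi0 /=; lra.
case: (posnP n) => [->|n0]; first by rewrite psi0 /=; lra.
apply: Rle_trans (psi_half n) _.
have h : (n %/ 2 <= N)%N by have := ltn_Pdiv (isT : (1 < 2)%N) n0; lia.
have := IH _ h; have := @INR_divn_le n 2 isT; rewrite /=; lra.
Qed.

(** Replacing [N %/ k] by [N / k] in [sum_mangoldt_div] changes the sum by at most [psi N], and its
    value [ln N!] is known from Stirling's bounds. *)
Lemma mertens N : (0 < N)%N ->
  ln (INR N) - 1 <= \rsum_(1 <= k < N.+1) (mangoldt k / INR k) <= ln (INR N) + 4.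
Proof.
move=> N0; have NR := INR_lt0 N0.
have h1 : \rsum_(1 <= k < N.+1) (mangoldt k * INR (N %/ k))
    <= INR N * \rsum_(1 <= k < N.+1) (mangoldt k / INR k).
  rewrite rsum_mull; apply: rsum_le => k /andP[k0 _] _.
  have := INR_divn_le N k0; have := mangoldt_ge0 k => L0 h.
  by rewrite (_ : _ * (_ / _) = mangoldt k * (INR N / INR k)); [apply: Rmult_le_compat_l|
    field; have := INR_lt0 k0; lra].
have h2 : INR N * \rsum_(1 <= k < N.+1) (mangoldt k / INR k)
    <= \rsum_(1 <= k < N.+1) (mangoldt k * INR (N %/ k)) + psi N.
  rewrite rsum_mull -rsumD; apply: rsum_le => k /andP[k0 _] _.
  have := INR_divn_gt N k0; have := mangoldt_ge0 k => L0 h.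
  rewrite (_ : _ * (_ / _) = mangoldt k * (INR N / INR k)); last by field; have := INR_lt0 k0; lra.
  have := @Rmult_le_compat_l (mangoldt k) (INR N / INR k) (INR (N %/ k) + 1) L0; lra.
rewrite sum_mangoldt_div in h1 h2.
have := sum_ln_ge N0; have := sum_ln_le N0; have := psi_le4 N.
have := ln_INR_lt N0; move: (\big[_/_]_(1 <= k < N.+1) ln _) h1 h2 => lf.
move: (\big[_/_]_(1 <= k < N.+1) _) => m h1 h2 h3 h4 h5 h6.
by split; apply: (Rmult_le_reg_l (INR N)) => //; lra.
Qed.

(** Put [x = t ^ 4] and use [ln t <= t]. *)
Lemma ln_sq_le x : 1 <= x -> (ln x) ^ 2 <= 16 * sqrt x.
Proof.
move=> x1; have s1 : 1 <= sqrt x by rewrite -sqrt_1; apply: sqrt_le_1_alt.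
have s2 : 1 <= sqrt (sqrt x) by rewrite -sqrt_1; apply: sqrt_le_1_alt.
have E1 : sqrt x * sqrt x = x by apply: sqrt_sqrt; lra.
have E2 : sqrt (sqrt x) * sqrt (sqrt x) = sqrt x by apply: sqrt_sqrt; lra.
rewrite -{1}E1 -E2; move: (sqrt (sqrt x)) s2 => t t1.
rewrite !ln_mult; try nra.
have := ln_ge0 t1; have := @ln_le_sub1 t; move: (ln t) => l h1 h0.
have {}h1 : l <= t by lra.
by nra.
Qed.

Lemma sum_inv_sqrt n : \rsum_(1 <= k < n.+1) / sqrt (INR k) <= 2 * sqrt (INR n).
Proof.
elim: n => [|n IH]; first by rewrite big_geq //= sqrt_0; lra.
rewrite rsum_recr // S_INR; have n0 := pos_INR n.
have a0 := sqrt_pos (INR n); have b0 : 0 < sqrt (INR n + 1) by apply: sqrt_lt_R0; lra.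
have Ea : sqrt (INR n) * sqrt (INR n) = INR n by apply: sqrt_sqrt; lra.
have Eb : sqrt (INR n + 1) * sqrt (INR n + 1) = INR n + 1 by apply: sqrt_sqrt; lra.
have : / sqrt (INR n + 1) <= 2 * (sqrt (INR n + 1) - sqrt (INR n)); last lra.
apply: (Rmult_le_reg_l (sqrt (INR n + 1))) => //; rewrite Rinv_r; last lra.
move: (sqrt _) (sqrt _) a0 b0 Ea Eb => b a a0 b0 Ea Eb; nra.
Qed.

(** With [l = ln (N / d)], [l * (l + 2) <= 2 * l ^ 2 + 1 <= 32 * sqrt (N / d) + 1], and these sum to
    at most [64 N + N]. *)
Lemma sum_ln_ratio_sq N : (0 < N)%N ->
  \rsum_(1 <= d < N.+1) ((ln (INR N) - ln (INR d)) * (ln (INR N) - ln (INR d) + 2)) <= 65 * INR N.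
Proof.
move=> N0; have NR := INR_lt0 N0.
apply: Rle_trans (_ : \rsum_(1 <= d < N.+1) (32 * sqrt (INR N) * / sqrt (INR d) + 1) <= _).
  apply: rsum_le => d /andP[d0 dN] _; have dR := INR_lt0 d0.
  rewrite -ln_div //.
  have x1 : 1 <= INR N / INR d.
    by apply/Rle_div_r => //; rewrite Rmult_1_l; apply: INR_le.
  have := ln_sq_le x1; rewrite sqrt_div_alt //; move: (ln _) => l h.
  have : l * l <= 16 * (sqrt (INR N) * / sqrt (INR d)) by move: h; rewrite /Rdiv /=; lra.
  rewrite Rmult_assoc; move: (_ * / _) => t ht; have := pow2_ge_0 (l - 1); rewrite /=; lra.
rewrite rsumD -rsum_mull rsum_const // subn1 /=.
have := sum_inv_sqrt N; have := sqrt_sqrt (INR N) (Rlt_le _ _ NR); have := sqrt_pos (INR N).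
by move: (sqrt _) (\big[_/_]_(_ <= _ < _) _) => s t h0 h1 h2; nra.
Qed.

(** * Selberg's formula *)

(** The coefficient of [F k] is the sum of [moebius d * (ln N - ln d)] over the divisors [d] of [k]:
    it is [mangoldt k], plus [ln N] when [k = 1]. *)
Lemma tatuzawa_iseki N (F : nat -> R) : (0 < N)%N ->
  \rsum_(1 <= d < N.+1) (moebius d * (ln (INR N) - ln (INR d))
     * \rsum_(1 <= m < (N %/ d).+1) (1 * F (d * m)%N))
  = F 1%N * ln (INR N) + \rsum_(1 <= k < N.+1) (mangoldt k * F k).
Proof.
move=> N0; rewrite (conv_sum N _ (fun _ => 1) F).
transitivity (\rsum_(1 <= k < N.+1) ((if k == 1%N then F k * ln (INR N) else 0) + mangoldt k * F k)).
  apply: eq_big_nat => k /andP[k0 _].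
  transitivity ((\rsum_(1 <= d < k.+1 | d %| k) (moebius d * ln (INR N) - moebius d * ln (INR d))) * F k).
    by congr (_ * _); apply: eq_bigr => d _; ring.
  by rewrite rsumB -rsum_mulr sum_moebius // sum_moebius_ln //; case: eqP => _; ring.
rewrite rsumD; congr (_ + _).
rewrite -big_mkcond /= (@Rbig_D1 _ _ 1%N) ?N0 //= big_pred0 ?Rplus_0_r // => k.
by rewrite andbN.
Qed.

Definition Rem n := psi n - INR n.

Lemma Rem_abs_le n : Rabs (Rem n) <= 3 * INR n.
Proof.
have := psi_le4 n; have := psi_ge0 n; have := pos_INR n.
by rewrite /Rem => *; apply: Rabs_le; lra.
Qed.

(** With [M = N %/ d], [sum_psi_div] turns the sum into [ln M! - (N / d) * harm M + M * (g + 1)];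
    the terms of order [M ln M] and [M] cancel and only a logarithm remains. *)
Lemma hyperbola_terms N d g : (0 < d <= N)%N -> 0 <= g <= 1 ->
  (forall n, (0 < n)%N -> 0 <= harm n - ln (INR n) - g <= / INR n) ->
  Rabs (\rsum_(1 <= m < (N %/ d).+1)
         (1 * (psi (N %/ (d * m)) - INR N / INR (d * m) + (g + 1))))
   <= ln (INR N) - ln (INR d) + 2.
Proof.
move=> /andP[d0 dN] g01 hg; set M := (N %/ d)%N.
have M0 : (0 < M)%N by rewrite divn_gt0.
have dR := INR_lt0 d0; have MR := INR_lt0 M0; have M1 := INR_ge1 M0.
have -> : \rsum_(1 <= m < M.+1) (1 * (psi (N %/ (d * m)) - INR N / INR (d * m) + (g + 1)))
  = \rsum_(1 <= m < M.+1) ln (INR m) - INR N / INR d * harm M + INR M * (g + 1).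
  rewrite -sum_psi_div /harm rsum_mull -rsumB.
  have -> : INR M * (g + 1) = \rsum_(1 <= m < M.+1) (g + 1).
    by rewrite rsum_const // subSS subn0.
  rewrite -rsumD; apply: eq_big_nat => m /andP[m0 _].
  rewrite divnMA INR_muln; have mR := INR_lt0 m0. rewrite -/M; field; lra.
have x1 := INR_divn_le N d0; have x2 := INR_divn_gt N d0; rewrite -/M in x1 x2.
have lnM : ln (INR M) <= ln (INR N) - ln (INR d).
  by rewrite -ln_div //; [apply: ln_le|apply: INR_lt0; apply: leq_trans dN].
have hH : 0 <= harm M by apply: rsum_ge0 => i /andP[i0 _] _; have := Rinv_0_lt_compat _ (INR_lt0 i0); lra.
(* The estimate for abstract reals: [x] is [N / d], [m] its integer part, [lf] is [ln m!], [l] is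
   [ln m] and [H] is [harm m]. *)
have key (lf x l m H L : R) : m <= x -> x < m + 1 -> 1 <= m -> 0 <= H -> l <= L ->
    0 <= H - l - g <= / m -> H <= l + 1 -> m * l - m <= lf -> lf <= m * l - m + l + 1 ->
    Rabs (lf - x * H + m * (g + 1)) <= L + 2.
  move=> h1 h2 h3 h4 h5 [h6 h7] h8 h9 h10.
  have xE : x = m + (x - m) by ring.
  have t01 : 0 <= x - m <= 1 by lra.
  have Hi : m * / m = 1 by apply: Rinv_r; lra.
  have A1 : 0 <= m * (H - l - g) <= 1.
    by split; [apply: Rmult_le_pos; lra|rewrite -Hi; apply: Rmult_le_compat_l; lra].
  have A2 : 0 <= (x - m) * H <= l + 1.
    split; first by apply: Rmult_le_pos; lra.
    by apply: Rle_trans (_ : 1 * H <= _); [apply: Rmult_le_compat_r|]; lra.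
  by apply: Rabs_le; lra.
by apply: (key _ _ (ln (INR M))) => //; [apply: hg|apply: harm_le|apply: sum_ln_ge|apply: sum_ln_le].
Qed.

Lemma selberg_Rem N : (0 < N)%N ->
  Rabs (Rem N * ln (INR N) + \rsum_(1 <= k < N.+1) (mangoldt k * Rem (N %/ k))) <= 75 * INR N.
Proof.
move=> N0; have [g [g01 hg]] := harm_gamma; have NR := INR_lt0 N0.
(* With the shift [g + 1], [g] being Euler's constant, the sum of [F] over the multiples of [d] is
   [O(1 + ln (N / d))]. *)
pose F k := psi (N %/ k) - INR N / INR k + (g + 1).
have lN := ln_INR_ge0 N0.
have H1 : Rabs (F 1%N * ln (INR N) + \rsum_(1 <= k < N.+1) (mangoldt k * F k)) <= 65 * INR N.
  rewrite -tatuzawa_iseki //; apply: Rle_trans (sum_ln_ratio_sq N0).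
  apply: Rle_trans (rsum_abs _ _ _ _) _; apply: rsum_le => d /andP[d0 dN] _.
  have L0 : 0 <= ln (INR N) - ln (INR d) by have := @ln_INR_le d N; rewrite d0 => /(_ dN); lra.
  rewrite !Rabs_mult (Rabs_pos_eq (_ - _)) //.
  apply: Rmult_le_compat; [|exact: Rabs_pos| |].
  - by apply: Rmult_le_pos => //; apply: Rabs_pos.
  - by rewrite -[X in _ <= X]Rmult_1_l; apply: Rmult_le_compat_r => //; apply: moebius_abs_le1.
  - by apply: hyperbola_terms => //; rewrite d0.
(* [F k] and [Rem (N %/ k)] differ by at most 2, which costs [2 * psi N <= 8 N] here and
   [2 * ln N <= 2 N] in [H3]; hence [75 = 65 + 8 + 2]. *)
have H2 : Rabs (\rsum_(1 <= k < N.+1) (mangoldt k * Rem (N %/ k))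
                - \rsum_(1 <= k < N.+1) (mangoldt k * F k)) <= 8 * INR N.
  rewrite -rsumB; apply: Rle_trans (rsum_abs _ _ _ _) _.
  apply: Rle_trans (_ : \rsum_(1 <= k < N.+1) (2 * mangoldt k) <= _).
    apply: rsum_le => k /andP[k0 _] _.
    rewrite -Rmult_minus_distr_l Rabs_mult (Rabs_pos_eq _ (mangoldt_ge0 k)) Rmult_comm.
    apply: Rmult_le_compat_r; first exact: mangoldt_ge0.
    have := INR_divn_le N k0; have := INR_divn_gt N k0.
    by rewrite /Rem /F => *; apply: Rabs_le; lra.
  by rewrite -rsum_mull; have := psi_le4 N; rewrite /psi; lra.
have H3 : Rabs (Rem N * ln (INR N) - F 1%N * ln (INR N)) <= 2 * INR N.
  rewrite -Rmult_minus_distr_r Rabs_mult (Rabs_pos_eq (ln _)) //.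
  apply: Rmult_le_compat => //; first exact: Rabs_pos.
  - by rewrite /Rem /F divn1 /=; apply: Rabs_le; lra.
  - by have := ln_INR_lt N0; lra.
move: (\big[_/_]_(_ <= _ < _) _) (\big[_/_]_(_ <= _ < _) _) H1 H2 => s1 s2.
by move: H3; split_Rabs; lra.
Qed.

Lemma selberg_psi N : (0 < N)%N ->
  Rabs (psi N * ln (INR N) + \rsum_(1 <= k < N.+1) (mangoldt k * psi (N %/ k))
        - 2 * INR N * ln (INR N)) <= 77 * INR N.
Proof.
move=> N0; have := selberg_Rem N0.
have -> : \rsum_(1 <= k < N.+1) (mangoldt k * Rem (N %/ k))
  = \rsum_(1 <= k < N.+1) (mangoldt k * psi (N %/ k)) - \rsum_(1 <= k < N.+1) ln (INR k).
  by rewrite -sum_mangoldt_div -rsumB; apply: eq_bigr => k _; rewrite /Rem; ring.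
have := sum_ln_le N0; have := sum_ln_ge N0; have := ln_INR_lt N0; have := INR_lt0 N0.
have := ln_INR_ge0 N0.
rewrite /Rem; move: (\big[_/_]_(_ <= _ < _) _) (\big[_/_]_(_ <= _ < _) _) => s1 s2.
by move=> *; split_Rabs; lra.
Qed.

(** * The iterated Selberg inequality *)

Lemma sum_mangoldt_ln n : (0 < n)%N ->
  Rabs (\rsum_(1 <= k < n.+1) (mangoldt k * ln (INR k)) - psi n * ln (INR n)) <= 4 * INR n.
Proof.
move=> n0; rewrite abel -/(psi n).
rewrite (_ : _ - _ = psi n * (ln (INR n.+1) - ln (INR n))
  - \rsum_(1 <= k < n.+1) (psi k * (ln (INR k.+1) - ln (INR k)))); last first.
  have -> : \rsum_(1 <= k < n.+1) (psi k * (ln (INR k) - ln (INR k.+1)))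
    = -1 * \rsum_(1 <= k < n.+1) (psi k * (ln (INR k.+1) - ln (INR k))).
    by rewrite rsum_mull; apply: eq_bigr => k _; ring.
  ring.
have T k : (0 < k)%N -> 0 <= psi k * (ln (INR k.+1) - ln (INR k)) <= 4.
  move=> k0; have p0 := psi_ge0 k; have p4 := psi_le4 k; have kR := INR_lt0 k0.
  have h1 := ln_succ_le k0; have h0 := @ln_INR_le k k.+1.
  rewrite k0 leqnSn in h0; have {}h0 := h0 isT.
  split; first by apply: Rmult_le_pos; lra.
  apply: Rle_trans (_ : 4 * INR k * / INR k <= _); last by rewrite Rmult_assoc Rinv_r; lra.
  by apply: Rmult_le_compat; lra.
have S1 : \rsum_(1 <= k < n.+1) (psi k * (ln (INR k.+1) - ln (INR k))) <= 4 * INR n.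
  apply: Rle_trans (_ : \rsum_(1 <= k < n.+1) 4 <= _); last by rewrite rsum_const // subSS subn0; lra.
  by apply: rsum_le => k /andP[k0 _] _; have := T k k0; lra.
have S0 : 0 <= \rsum_(1 <= k < n.+1) (psi k * (ln (INR k.+1) - ln (INR k))).
  by apply: rsum_ge0 => k /andP[k0 _] _; have := T k k0; lra.
by have := T n n0; have := INR_ge1 n0; move=> *; apply: Rabs_le; lra.
Qed.

(** Selberg's function, the Dirichlet convolution of [moebius] with the square of [ln]. On average
    it behaves like [2 * ln k]. *)
Definition selberg_weight k := mangoldt k * ln (INR k) + \rsum_(1 <= d < k.+1 | d %| k) (mangoldt d * mangoldt (k %/ d)%N).

Lemma sum_selberg_weight n : Rabs (\rsum_(1 <= k < n.+1) (selberg_weight k - 2 * ln (INR k))) <= 85 * INR n.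
Proof.
case: (posnP n) => [->|n0]; first by rewrite big_geq //= Rabs_R0; lra.
rewrite rsumB -rsum_mull /selberg_weight rsumD.
have -> : \rsum_(1 <= k < n.+1) \rsum_(1 <= d < k.+1 | d %| k) (mangoldt d * mangoldt (k %/ d)%N)
   = \rsum_(1 <= k < n.+1) (mangoldt k * psi (n %/ k)).
  transitivity (\rsum_(1 <= k < n.+1) ((\rsum_(1 <= d < k.+1 | d %| k) (mangoldt d * mangoldt (k %/ d)%N)) * 1)).
    by apply: eq_bigr => k _; rewrite Rmult_1_r.
  rewrite -(conv_sum n mangoldt mangoldt (fun _ => 1)); apply: eq_bigr => k _.
  by congr (_ * _); apply: eq_bigr => d _; rewrite Rmult_1_r.
have := sum_mangoldt_ln n0; have := selberg_psi n0; have := sum_ln_le n0; have := sum_ln_ge n0.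
have := ln_INR_lt n0; have := ln_INR_ge0 n0.
move: (\big[_/_]_(_ <= _ < _) _) (\big[_/_]_(_ <= _ < _) _) (\big[_/_]_(_ <= _ < _) _).
move=> s1 s2 s3 *; split_Rabs; lra.
Qed.

(** [selberg_Rem] at [M = N %/ k]. Writing [ln N - ln k] for [ln M] changes the logarithm by at most
    [1 / M], hence its product with [Rem M] by at most 3. *)
Lemma iterate_term N k : (0 < k <= N)%N ->
  Rabs ((ln (INR N) - ln (INR k)) * Rem (N %/ k)
        + \rsum_(1 <= m < (N %/ k).+1) (mangoldt m * Rem (N %/ (k * m)))) <= 75 * (INR N / INR k) + 3.
Proof.
move=> /andP[k0 kN]; set M := (N %/ k)%N.
have M0 : (0 < M)%N by rewrite divn_gt0.
have kR := INR_lt0 k0; have MR := INR_lt0 M0.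
have x1 := INR_divn_le N k0; have x2 := INR_divn_gt N k0; rewrite -/M in x1 x2.
have NR : 0 < INR N by apply: INR_lt0; apply: leq_trans kN.
have -> : \rsum_(1 <= m < M.+1) (mangoldt m * Rem (N %/ (k * m)))
   = \rsum_(1 <= m < M.+1) (mangoldt m * Rem (M %/ m)).
  by apply: eq_bigr => m _; rewrite divnMA.
have xR : 0 < INR N / INR k by apply: Rdiv_lt_0_compat.
have e1 : Rabs ((ln (INR N) - ln (INR k) - ln (INR M)) * Rem M) <= 3.
  have h0 : 0 <= ln (INR N) - ln (INR k) - ln (INR M) <= / INR M.
    rewrite -ln_div //; split; first by have := ln_le _ _ MR x1; lra.
    apply: Rle_trans (ln_diff_le MR xR) _.
    rewrite -[X in _ <= X]Rmult_1_l; apply: Rmult_le_compat_r; last lra.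
    by apply: Rlt_le; apply: Rinv_0_lt_compat.
  rewrite Rabs_mult Rabs_pos_eq; last lra.
  apply: Rle_trans (_ : / INR M * (3 * INR M) <= _); last by right; field; lra.
  by apply: Rmult_le_compat; [lra|apply: Rabs_pos|lra|apply: Rem_abs_le].
have := selberg_Rem M0; move: (\big[_/_]_(_ <= _ < _) _) => s; move: e1.
move=> h1 h2; rewrite (_ : _ + _ = (ln (INR N) - ln (INR k) - ln (INR M)) * Rem M
  + (Rem M * ln (INR M) + s)); last by ring.
by apply: Rle_trans (Rabs_triang _ _) _; lra.
Qed.

(** Multiply [selberg_Rem] by [ln N] and eliminate [Rem (N %/ k) * ln N] by [iterate_term], summed
    with weights [mangoldt k]. In what is left, [mangoldt k * ln k] and the convolution of
    [mangoldt] with itself occur with opposite signs; absolute values turn their difference into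
    [selberg_weight k]. *)
Lemma selberg_second_selberg_weight N : (0 < N)%N ->
  Rabs (Rem N) * (ln (INR N)) ^ 2
  <= \rsum_(1 <= k < N.+1) (selberg_weight k * Rabs (Rem (N %/ k))) + 312 * INR N * (ln (INR N) + 1).
Proof.
move=> N0; have lN := ln_INR_ge0 N0; have NR := INR_lt0 N0.
set l := ln (INR N) in lN *.
pose T k := \rsum_(1 <= m < (N %/ k).+1) (mangoldt m * Rem (N %/ (k * m))).
have H0 : Rabs (Rem N * l ^ 2 + \rsum_(1 <= k < N.+1) (mangoldt k * Rem (N %/ k)) * l) <= 75 * INR N * l.
  rewrite (_ : _ + _ = (Rem N * l + \rsum_(1 <= k < N.+1) (mangoldt k * Rem (N %/ k))) * l); last first.
    by rewrite -!rsum_mulr; ring.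
  rewrite Rabs_mult (Rabs_pos_eq l) //; apply: Rmult_le_compat_r => //; exact: selberg_Rem.
have H1 : Rabs (\rsum_(1 <= k < N.+1) (mangoldt k * ((l - ln (INR k)) * Rem (N %/ k) + T k)))
    <= 75 * INR N * (l + 4) + 12 * INR N.
  apply: Rle_trans (rsum_abs _ _ _ _) _.
  apply: Rle_trans (_ : \rsum_(1 <= k < N.+1) (75 * INR N * (mangoldt k / INR k) + 3 * mangoldt k) <= _).
    apply: rsum_le => k /andP[k0 kN] _; have kR := INR_lt0 k0.
    rewrite Rabs_mult (Rabs_pos_eq _ (mangoldt_ge0 k)).
    rewrite (_ : 75 * INR N * (mangoldt k / INR k) + 3 * mangoldt k = mangoldt k * (75 * (INR N / INR k) + 3)); last by field; lra.
    by apply: Rmult_le_compat_l; [apply: mangoldt_ge0|apply: iterate_term; rewrite k0].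
  rewrite rsumD -!rsum_mull -/(psi N); have := psi_le4 N; have [_ h] := mertens N0.
  have := Rmult_le_compat_l (75 * INR N) _ _ _ h; rewrite -/l; lra.
have H2 : \rsum_(1 <= k < N.+1) (mangoldt k * ((l - ln (INR k)) * Rem (N %/ k) + T k))
   = \rsum_(1 <= k < N.+1) (mangoldt k * Rem (N %/ k)) * l
     - \rsum_(1 <= k < N.+1) (mangoldt k * ln (INR k) * Rem (N %/ k))
     + \rsum_(1 <= k < N.+1) (\rsum_(1 <= d < k.+1 | d %| k) (mangoldt d * mangoldt (k %/ d)%N) * Rem (N %/ k)).
  have -> : \rsum_(1 <= k < N.+1) (\rsum_(1 <= d < k.+1 | d %| k) (mangoldt d * mangoldt (k %/ d)%N) * Rem (N %/ k))
    = \rsum_(1 <= k < N.+1) (mangoldt k * T k).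
    rewrite (conv_sum N mangoldt mangoldt (fun k => Rem (N %/ k))).
    by apply: eq_bigr => k _; rewrite rsum_mulr.
  by rewrite -rsumB -rsumD; apply: eq_bigr => k _; ring.
have H3 : Rabs (\rsum_(1 <= k < N.+1) (mangoldt k * ln (INR k) * Rem (N %/ k))
      - \rsum_(1 <= k < N.+1) (\rsum_(1 <= d < k.+1 | d %| k) (mangoldt d * mangoldt (k %/ d)%N) * Rem (N %/ k)))
   <= \rsum_(1 <= k < N.+1) (selberg_weight k * Rabs (Rem (N %/ k))).
  rewrite -rsumB; apply: Rle_trans (rsum_abs _ _ _ _) _.
  apply: rsum_le => k /andP[k0 kN] _.
  rewrite -rsum_mulr -Rmult_minus_distr_r Rabs_mult; apply: Rmult_le_compat_r; first exact: Rabs_pos.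
  have a0 : 0 <= mangoldt k * ln (INR k) by apply: Rmult_le_pos; [apply: mangoldt_ge0|apply: ln_INR_ge0].
  have b0 : 0 <= \rsum_(1 <= d < k.+1 | d %| k) (mangoldt d * mangoldt (k %/ d)%N).
    by apply: rsum_ge0 => d _ _; apply: Rmult_le_pos; apply: mangoldt_ge0.
  by rewrite /selberg_weight; apply: Rabs_le; lra.
rewrite H2 in H1; rewrite -{1}(Rabs_pos_eq (l ^ 2)); last exact: pow2_ge_0.
rewrite -Rabs_mult.
(* The three brackets are bounded by [H0], [H1] and [H3] in this order. *)
have E : Rem N * l ^ 2 = (Rem N * l ^ 2 + \rsum_(1 <= k < N.+1) (mangoldt k * Rem (N %/ k)) * l)
  - (\rsum_(1 <= k < N.+1) (mangoldt k * Rem (N %/ k)) * l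
     - \rsum_(1 <= k < N.+1) (mangoldt k * ln (INR k) * Rem (N %/ k))
     + \rsum_(1 <= k < N.+1) (\rsum_(1 <= d < k.+1 | d %| k) (mangoldt d * mangoldt (k %/ d)%N) * Rem (N %/ k)))
  - (\rsum_(1 <= k < N.+1) (mangoldt k * ln (INR k) * Rem (N %/ k))
     - \rsum_(1 <= k < N.+1) (\rsum_(1 <= d < k.+1 | d %| k) (mangoldt d * mangoldt (k %/ d)%N) * Rem (N %/ k))) by ring.
rewrite E; apply: Rle_trans (Rabs_triang _ _) _; rewrite Rabs_Ropp.
apply: Rle_trans (Rplus_le_compat_r _ _ _ (Rabs_triang _ _)) _; rewrite Rabs_Ropp.
have : 0 <= INR N * l by apply: Rmult_le_pos; lra.
lra.
Qed.

Lemma Rem_diff_abs_le m n : (m <= n)%N ->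
  Rabs (Rem n - Rem m) <= (psi n - psi m) + (INR n - INR m).
Proof.
move=> mn; have := psi_le mn; have := INR_le mn; rewrite /Rem => *.
by apply: Rabs_le; lra.
Qed.

Lemma Rem0 : Rem 0 = 0. Proof. by rewrite /Rem psi0 /=; ring. Qed.

(** Only the partial sums of [selberg_weight k - 2 * ln k] are small, so the weight is exchanged by
    partial summation. The variation of [|Rem (N %/ k)|] is at most that of the monotone [psi n + n]
    at [n = N %/ k], and partial summation in reverse evaluates the result. *)
Lemma selberg_second N : (0 < N)%N ->
  Rabs (Rem N) * (ln (INR N)) ^ 2
  <= 2 * \rsum_(1 <= k < N.+1) (ln (INR k) * Rabs (Rem (N %/ k))) + 800 * INR N * (ln (INR N) + 1).
Proof.
move=> N0; apply: Rle_trans (selberg_second_selberg_weight N0) _.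
have NR := INR_lt0 N0; have lN := ln_INR_ge0 N0.
pose g k := Rabs (Rem (N %/ k)); pose h k := psi (N %/ k) + INR (N %/ k).
have gN : g N.+1 = 0 by rewrite /g divn_small // Rem0 Rabs_R0.
have hN : h N.+1 = 0 by rewrite /h divn_small // psi0 /=; ring.
have : \rsum_(1 <= k < N.+1) ((selberg_weight k - 2 * ln (INR k)) * g k) <= 85 * \rsum_(1 <= k < N.+1) h k.
  have E : \rsum_(1 <= k < N.+1) h k = \rsum_(1 <= k < N.+1) (INR k * (h k - h k.+1)).
    transitivity (\rsum_(1 <= k < N.+1) (1 * h k)); first by apply: eq_bigr => k _; ring.
    rewrite abel hN Rmult_0_r Rplus_0_l; apply: eq_bigr => k _.
    by rewrite rsum_const // subSS subn0 Rmult_1_r.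
  rewrite E abel gN Rmult_0_r Rplus_0_l rsum_mull; apply: rsum_le => k /andP[k0 _] _.
  apply: Rle_trans (Rle_abs _) _; rewrite Rabs_mult -Rmult_assoc.
  apply: Rmult_le_compat; [exact: Rabs_pos|exact: Rabs_pos|exact: sum_selberg_weight|].
  apply: Rle_trans (Rabs_triang_inv2 _ _) _.
  have dd : (N %/ k.+1 <= N %/ k)%N by apply: leq_div2l.
  by apply: Rle_trans (Rem_diff_abs_le dd) _; rewrite /h; lra.
have : \rsum_(1 <= k < N.+1) h k <= 5 * INR N * (ln (INR N) + 1).
  apply: Rle_trans (_ : 5 * INR N * harm N <= _); last by apply: Rmult_le_compat_l; [lra|exact: harm_le].
  rewrite /harm rsum_mull; apply: rsum_le => k /andP[k0 _] _.
  by have := psi_le4 (N %/ k); have := INR_divn_le N k0; rewrite /h /Rdiv; lra.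
have -> : \rsum_(1 <= k < N.+1) ((selberg_weight k - 2 * ln (INR k)) * g k)
   = \rsum_(1 <= k < N.+1) (selberg_weight k * g k) - 2 * \rsum_(1 <= k < N.+1) (ln (INR k) * g k).
  by rewrite rsum_mull -rsumB; apply: eq_bigr => k _; ring.
have : 0 <= INR N * (ln (INR N) + 1) by apply: Rmult_le_pos; lra.
by rewrite /g; lra.
Qed.

(** * From quotients of [N] to a logarithmic average of [Rem] *)

Lemma rsum_pred_telescope n (g : nat -> R) :
  \rsum_(1 <= i < n.+1) (g i - g i.-1) = g n - g 0%N.
Proof.
elim: n => [|n IH]; first by rewrite big_geq //; ring.
by rewrite rsum_recr // IH /=; ring.
Qed.

(** Expand [g (N %/ k)] into its increments [g s - g s.-1] with [s <= N %/ k], and sum over [k]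
    first. *)
Lemma rsum_hyperbola_swap N (a g : nat -> R) : g 0%N = 0 ->
  \rsum_(1 <= k < N.+1) (a k * g (N %/ k)%N)
  = \rsum_(1 <= s < N.+1) ((g s - g s.-1) * \rsum_(1 <= k < (N %/ s).+1) a k).
Proof.
move=> g0; transitivity (\rsum_(1 <= k < N.+1) \rsum_(1 <= s < (N %/ k).+1) (a k * (g s - g s.-1))).
  by apply: eq_bigr => k _; rewrite -rsum_mull rsum_pred_telescope g0 Rminus_0_r.
rewrite hyperbola_comm; apply: eq_bigr => s _; rewrite rsum_mull.
by apply: eq_bigr => k _; ring.
Qed.

Lemma sum_ln_div_approx N s : (0 < s <= N)%N ->
  let x := INR N / INR s in
  Rabs (\rsum_(1 <= k < (N %/ s).+1) ln (INR k) - (x * ln x - x)) <= ln (INR N) - ln (INR s) + 2.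
Proof.
move=> /andP[s0 sN] x; set M := (N %/ s)%N.
have M0 : (0 < M)%N by rewrite divn_gt0.
have MR := INR_lt0 M0; have sR := INR_lt0 s0.
have NR : 0 < INR N by apply: INR_lt0; apply: leq_trans sN.
have x1 := INR_divn_le N s0; have x2 := INR_divn_gt N s0; rewrite -/M -/x in x1 x2.
rewrite -ln_div // -/x; have xR : 0 < x by lra.
have := sum_ln_le M0; have := sum_ln_ge M0; have := ln_diff_le MR xR.
have : ln (INR M) <= ln x by apply: ln_le.
have := ln_INR_ge0 M0.
move: (INR M) (\big[_/_]_(_ <= _ < _) _) (ln (INR M)) (ln x) MR x1 x2 => m lf l L m0 x1 x2 l0 lL h1 h2 h3.
have {}h1 : m * (L - l) <= x - m.
  apply: Rle_trans (_ : m * ((x - m) / m) <= _); first by apply: Rmult_le_compat_l; lra.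
  by right; field; lra.
have h4 : 0 <= m * (L - l) by apply: Rmult_le_pos; lra.
have h5 : 0 <= (x - m) * L <= L.
  split; first by apply: Rmult_le_pos; lra.
  by rewrite -[X in _ <= X]Rmult_1_l; apply: Rmult_le_compat_r; lra.
by apply: Rabs_le; lra.
Qed.

(** After the exchange the inner sums of logarithms are replaced by the smooth [x ln x - x],
    [x = N / s], and summation by parts returns from the increments of [|Rem|] to [|Rem|] itself.
    The derivative of [x ln x - x] is [ln x], so the decrements of [h] are at most
    [N / s ^ 2 * ln (N / s)]. *)
Lemma selberg_integral N : (0 < N)%N ->
  Rabs (Rem N) * (ln (INR N)) ^ 2
  <= 2 * INR N * \rsum_(1 <= s < N.+1) (Rabs (Rem s) / (INR s) ^ 2 * (ln (INR N) - ln (INR s)))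
     + 830 * INR N * (ln (INR N) + 1).
Proof.
move=> N0; have NR := INR_lt0 N0; have lN := ln_INR_ge0 N0.
apply: Rle_trans (selberg_second N0) _.
pose g s := Rabs (Rem s); have g0 : g 0%N = 0 by rewrite /g Rem0 Rabs_R0.
pose h s := INR N / INR s * ln (INR N / INR s) - INR N / INR s.
rewrite (@rsum_hyperbola_swap N (fun k => ln (INR k)) g) //.
have D s : (0 < s)%N -> Rabs (g s - g s.-1) <= mangoldt s + 1.
  case: s => // s _; apply: Rle_trans (Rabs_triang_inv2 _ _) _.
  by apply: Rle_trans (Rem_diff_abs_le (leqnSn s)) _; rewrite psiS S_INR; lra.
have H1 : \rsum_(1 <= s < N.+1) ((g s - g s.-1) * \rsum_(1 <= k < (N %/ s).+1) ln (INR k))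
   <= \rsum_(1 <= s < N.+1) ((g s - g s.-1) * h s) + 15 * INR N.
  suff : \rsum_(1 <= s < N.+1) ((g s - g s.-1) * (\rsum_(1 <= k < (N %/ s).+1) ln (INR k) - h s))
    <= 15 * INR N.
    rewrite (_ : \rsum_(1 <= s < N.+1) ((g s - g s.-1) * (\rsum_(1 <= k < (N %/ s).+1) ln (INR k) - h s))
      = \rsum_(1 <= s < N.+1) ((g s - g s.-1) * \rsum_(1 <= k < (N %/ s).+1) ln (INR k))
        - \rsum_(1 <= s < N.+1) ((g s - g s.-1) * h s)); first lra.
    by rewrite -rsumB; apply: eq_bigr => s _; ring.
  (* This sum is [O(N)] because [psi N * ln N] cancels against the sum of [mangoldt s * ln s], and
     [N ln N] against that of [ln s]. *)
  apply: Rle_trans (_ : \rsum_(1 <= s < N.+1) ((mangoldt s + 1) * (ln (INR N) - ln (INR s) + 2)) <= _).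
    apply: rsum_le => s /andP[s0 sN] _.
    apply: Rle_trans (Rle_abs _) _; rewrite Rabs_mult.
    apply: Rmult_le_compat; [exact: Rabs_pos|exact: Rabs_pos|exact: D|].
    by apply: sum_ln_div_approx; rewrite s0.
  rewrite (_ : \rsum_(1 <= s < N.+1) _ = psi N * ln (INR N)
     - \rsum_(1 <= s < N.+1) (mangoldt s * ln (INR s)) + 2 * psi N
     + (INR N * ln (INR N) - \rsum_(1 <= s < N.+1) ln (INR s)) + 2 * INR N); last first.
    have -> : INR N * ln (INR N) = \rsum_(1 <= s < N.+1) ln (INR N) by rewrite rsum_const // subSS subn0.
    have -> : 2 * INR N = \rsum_(1 <= s < N.+1) 2 by rewrite rsum_const // subSS subn0; ring.
    rewrite /psi rsum_mulr rsum_mull -!rsumB -!rsumD; apply: eq_bigr => s _; ring.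
  have := sum_mangoldt_ln N0; have := psi_le4 N; have := sum_ln_ge N0.
  move: (\big[_/_]_(_ <= _ < _) _) (\big[_/_]_(_ <= _ < _) _) => a b h1 h2.
  by split_Rabs; lra.
have H2 : \rsum_(1 <= s < N.+1) ((g s - g s.-1) * h s)
   <= INR N * \rsum_(1 <= s < N.+1) (Rabs (Rem s) / (INR s) ^ 2 * (ln (INR N) - ln (INR s))).
  rewrite abel rsum_pred_telescope g0 Rminus_0_r.
  (* Here [x = N / (N + 1) <= 1], where [x ln x - x] is not positive. *)
  have : g N * h N.+1 <= 0.
    have x0 : 0 < INR N / INR N.+1 by apply: Rdiv_lt_0_compat => //; apply: INR_lt0.
    have x1 : INR N / INR N.+1 <= 1.
      by apply/Rle_div_l; [apply: INR_lt0|rewrite Rmult_1_l; apply: INR_le].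
    have := ln_le_sub1 x0; rewrite /h; move: (ln _) => l hl.
    have : 0 <= g N by apply: Rabs_pos.
    move: (g N) (_ / _) x0 x1 hl => a x x0 x1 hl a0.
    suff : 0 <= a * (x - x * l) by lra.
    by apply: Rmult_le_pos => //; nra.
  suff : \rsum_(1 <= k < N.+1) ((\rsum_(1 <= i < k.+1) (g i - g i.-1)) * (h k - h k.+1))
    <= INR N * \rsum_(1 <= s < N.+1) (Rabs (Rem s) / (INR s) ^ 2 * (ln (INR N) - ln (INR s))) by lra.
  rewrite rsum_mull; apply: rsum_le => s /andP[s0 sN] _.
  rewrite rsum_pred_telescope g0 Rminus_0_r.
  have sR := INR_lt0 s0; have sR' := INR_lt0 (ltn0Sn s).
  rewrite (_ : INR N * _ = g s * (INR N / (INR s) ^ 2 * (ln (INR N) - ln (INR s)))); last first.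
    by rewrite /g; field; lra.
  apply: Rmult_le_compat_l; first exact: Rabs_pos.
  have L0 : 0 <= ln (INR N) - ln (INR s) by have := @ln_INR_le s N; rewrite s0 => /(_ sN); lra.
  rewrite -ln_div // in L0 *; rewrite /h.
  have x0 : 0 < INR N / INR s by apply: Rdiv_lt_0_compat.
  have y0 : 0 < INR N / INR s.+1 by apply: Rdiv_lt_0_compat.
  have := ln_diff_le y0 x0.
  have xy : INR N / INR s - INR N / INR s.+1 <= INR N / (INR s) ^ 2.
    rewrite S_INR (_ : _ - _ = INR N / (INR s * (INR s + 1))); last by field; lra.
    apply: Rmult_le_compat_l; first lra.
    by apply: Rinv_le_contravar; nra.
  have xy0 : 0 <= INR N / INR s - INR N / INR s.+1.
    rewrite S_INR (_ : _ - _ = INR N / (INR s * (INR s + 1))); last by field; lra.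
    by apply: Rlt_le; apply: Rdiv_lt_0_compat => //; nra.
  move: (ln (INR N / INR s)) (ln (INR N / INR s.+1)) L0 => L L' L0.
  move: (INR N / INR s) (INR N / INR s.+1) (INR N / (INR s) ^ 2) x0 y0 xy xy0 => x y z x0 y0 xy xy0 h1.
  have h2 : y * (L - L') <= x - y.
    apply: Rle_trans (_ : y * ((x - y) / y) <= _); first by apply: Rmult_le_compat_l; lra.
    by right; field; lra.
  apply: Rle_trans (_ : (x - y) * L <= _); first lra.
  by apply: Rmult_le_compat_r; lra.
have : 0 <= INR N * ln (INR N) by apply: Rmult_le_pos; lra.
lra.
Qed.

(** * The prime number theorem *)

Lemma INR_above (x : R) : exists n : nat, forall m, (n <= m)%N -> x <= INR m.
Proof.
have [n hn] := INR_unbounded x; exists n => m nm.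
by have := INR_le nm; lra.
Qed.

Lemma ln_INR_above (x : R) : exists n : nat, (0 < n)%N /\ forall m, (n <= m)%N -> x <= ln (INR m).
Proof.
have [n hn] := INR_above (exp x); exists n.+1; split=> // m nm.
rewrite -[x]ln_exp; apply: ln_le; first exact: exp_pos.
by apply: hn; lia.
Qed.

(** In the difference of [selberg_psi] at [y] and at [x], the sum over [mangoldt k * psi] increases
    from [x] to [y] and may be dropped. This bounds the growth of [psi] by twice the expected
    rate. *)
Lemma psi_diff_le x y : (0 < x <= y)%N ->
  (psi y - psi x) * ln (INR y) <= 2 * (INR y - INR x) * ln (INR y) + 156 * INR y.
Proof.
move=> /andP[x0 xy]; have y0 : (0 < y)%N by lia.
have := selberg_psi x0; have := selberg_psi y0.
have : \rsum_(1 <= k < x.+1) (mangoldt k * psi (x %/ k)) <= \rsum_(1 <= k < y.+1) (mangoldt k * psi (y %/ k)).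
  apply: Rle_trans (_ : \rsum_(1 <= k < x.+1) (mangoldt k * psi (y %/ k)) <= _).
    apply: rsum_le => k _ _; apply: Rmult_le_compat_l; first exact: mangoldt_ge0.
    by apply: psi_le; apply: leq_div2r.
  by apply: rsum_le_range; [lia|move=> i _; apply: Rmult_le_pos; [apply: mangoldt_ge0|apply: psi_ge0]].
move: (\big[_/_]_(_ <= _ < _) _) (\big[_/_]_(_ <= _ < _) _) => s1 s2 s12.
have xR := INR_lt0 x0; have yR := INR_lt0 y0; have := ln_diff_le xR yR.
have xyR := INR_le xy; have p0 := psi_ge0 x.
have := @ln_INR_le x y; rewrite x0 xy => /(_ isT).
move: (ln (INR x)) (ln (INR y)) => l L lL h1 h2 h3.
have {}h1 : INR x * (L - l) <= INR y - INR x.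
  apply: Rle_trans (_ : INR x * ((INR y - INR x) / INR x) <= _); first by apply: Rmult_le_compat_l; lra.
  by right; field; lra.
have h4 : 0 <= psi x * (L - l) by apply: Rmult_le_pos; lra.
move: h2 h3 => /Rabs_le_between[h2 h2'] /Rabs_le_between[h3 h3'].
lra.
Qed.

(** [psi] is monotone and grows at rate at most 2, so [psi n - n] has slope between -1 and 1, up to
    the error [e * y]. *)
Lemma Rem_lipschitz e : 0 < e -> exists n0, forall x y, (0 < x <= y)%N -> (n0 <= y)%N ->
  Rabs (Rem y - Rem x) <= INR y - INR x + e * INR y.
Proof.
move=> e0; have [n0 [n00 h]] := ln_INR_above (156 / e); exists n0 => x y /andP[x0 xy] ny.
have L := h y ny; have := @psi_diff_le x y; rewrite x0 xy => /(_ isT) H.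
have yR : 0 < INR y by apply: INR_lt0; lia.
have L0 : 0 < ln (INR y) by apply: Rlt_le_trans L; apply: Rdiv_lt_0_compat; lra.
have : psi y - psi x <= 2 * (INR y - INR x) + e * INR y.
  apply: (Rmult_le_reg_r (ln (INR y))) => //; apply: Rle_trans H _.
  rewrite Rmult_plus_distr_r; apply: Rplus_le_compat_l.
  rewrite Rmult_assoc (Rmult_comm (INR y)) -Rmult_assoc; apply: Rmult_le_compat_r; first lra.
  by move: L => /Rle_div_l => /(_ e0); lra.
have := psi_le xy; have := INR_le xy.
by rewrite /Rem => *; apply: Rabs_le; nra.
Qed.

(** * Sign changes and logarithmic blocks *)

Lemma sum_inv_succ n : \rsum_(1 <= k < n.+1) / (INR k * INR k.+1) <= 1.
Proof.
suff -> : \rsum_(1 <= k < n.+1) / (INR k * INR k.+1) = 1 - / INR n.+1.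
  by have := Rinv_0_lt_compat _ (INR_lt0 (ltn0Sn n)); lra.
elim: n => [|n IH]; first by rewrite big_geq //=; field.
rewrite rsum_recr // IH !S_INR; have := pos_INR n => ?; field; lra.
Qed.

(** A discrete form of the boundedness of the integral of [(psi(t) - t) / t ^ 2]: by parts,
    [mertens] gives the sum of [psi k / (k * (k + 1))] as [ln n + O(1)], and [harm n] cancels the
    logarithm. *)
Lemma sum_Rem_bounded n : Rabs (\rsum_(1 <= k < n.+1) (Rem k / (INR k) ^ 2)) <= 8.
Proof.
case: (posnP n) => [->|n0]; first by rewrite big_geq // Rabs_R0; lra.
have -> : \rsum_(1 <= k < n.+1) (Rem k / (INR k) ^ 2)
  = \rsum_(1 <= k < n.+1) (psi k * (/ INR k - / INR k.+1))
    + \rsum_(1 <= k < n.+1) (psi k / ((INR k) ^ 2 * INR k.+1)) - harm n.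
  rewrite -rsumD -rsumB; apply: eq_big_nat => k /andP[k0 _].
  by have := INR_lt0 k0 => ?; rewrite /Rem S_INR; field; lra.
have := abel n mangoldt (fun k => / INR k); rewrite -/(psi n) => E.
have [m1 m2] := mertens n0.
have e : \rsum_(1 <= k < n.+1) (mangoldt k / INR k) = \rsum_(1 <= k < n.+1) (mangoldt k * / INR k) by [].
rewrite e E in m1 m2; clear E e.
have : 0 <= psi n * / INR n.+1 <= 4.
  have nR := INR_lt0 (ltn0Sn n); split.
    by apply: Rmult_le_pos; [apply: psi_ge0|apply: Rlt_le; apply: Rinv_0_lt_compat].
  apply/Rle_div_l => //; apply: Rle_trans (psi_le4 n) _; rewrite S_INR; lra.
have : 0 <= \rsum_(1 <= k < n.+1) (psi k / ((INR k) ^ 2 * INR k.+1)) <= 4.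
  have T k : (0 < k)%N -> 0 <= psi k / ((INR k) ^ 2 * INR k.+1) <= 4 * / (INR k * INR k.+1).
    move=> k0; have kR := INR_lt0 k0; have kR' := INR_lt0 (ltn0Sn k).
    have i0 : 0 < / (INR k ^ 2 * INR k.+1) by apply: Rinv_0_lt_compat; apply: Rmult_lt_0_compat => //; apply: pow_lt.
    split; first by apply: Rmult_le_pos; [apply: psi_ge0|lra].
    apply: Rle_trans (_ : 4 * INR k * / (INR k ^ 2 * INR k.+1) <= _).
      by apply: Rmult_le_compat_r; [lra|apply: psi_le4].
    by right; field; lra.
  split; first by apply: rsum_ge0 => k /andP[k0 _] _; have := T k k0; lra.
  apply: Rle_trans (_ : 4 * \rsum_(1 <= k < n.+1) / (INR k * INR k.+1) <= _).
    by rewrite rsum_mull; apply: rsum_le => k /andP[k0 _] _; have := T k k0; lra.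
  by have := sum_inv_succ n; lra.
have := harm_le n0; have := harm_ge n; have := @ln_INR_le n n.+1; rewrite n0 leqnSn => /(_ isT).
move: m1 m2.
have -> : \rsum_(1 <= k < n.+1) (psi k * (/ INR k - / INR k.+1))
   = \rsum_(1 <= k < n.+1) ((\rsum_(1 <= i < k.+1) mangoldt i) * (/ INR k - / INR k.+1)) by [].
move: (\big[_/_]_(_ <= _ < _) _) (\big[_/_]_(_ <= _ < _) _) => a b *.
by apply: Rabs_le; lra.
Qed.

Lemma sum_inv_range_le x y : (0 < x <= y)%N ->
  \rsum_(x.+1 <= s < y.+1) / INR s <= ln (INR y) - ln (INR x).
Proof.
move=> /andP[x0 /subnKC <-]; elim: (y - x)%N => [|d IH].
  by rewrite addn0 big_geq //; lra.
rewrite addnS rsum_recr; last by rewrite ltnS leq_addr.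
by have := @ln_succ_ge (x + d)%N; rewrite addn_gt0 x0 => /(_ isT); lra.
Qed.

(** [|Rem s| / s], weighted by the logarithmic measure [1 / s]. *)
Definition wRem s := Rabs (Rem s) / (INR s) ^ 2.

Lemma wRem_ge0 s : (0 < s)%N -> 0 <= wRem s.
Proof.
move=> s0; apply: Rmult_le_pos; first exact: Rabs_pos.
by apply: Rlt_le; apply: Rinv_0_lt_compat; apply: pow_lt; apply: INR_lt0.
Qed.

Lemma wRem_le a s : (0 < s)%N -> Rabs (Rem s) <= a * INR s -> wRem s <= a * / INR s.
Proof.
move=> s0 h; have sR := INR_lt0 s0; have s2 := pow_lt _ 2 sR; rewrite /wRem.
apply/Rle_div_l => //; rewrite (_ : _ * _ = a * INR s) //; field; lra.
Qed.

Lemma sum_Rem_range x y : (x <= y)%N ->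
  Rabs (\rsum_(x.+1 <= s < y.+1) (Rem s / (INR s) ^ 2)) <= 16.
Proof.
move=> xy; have := sum_Rem_bounded y; have := sum_Rem_bounded x.
rewrite (@rsum_cat 1 x.+1 y.+1) //.
move: (\big[_/_]_(_ <= _ < _) _) (\big[_/_]_(_ <= _ < _) _) => u v *.
by split_Rabs; lra.
Qed.

(** If [Rem] keeps its sign, the sum of its absolute values is the absolute value of its sum. The
    hypothesis also excludes zeros, so [c = Rem x.+1] carries the common sign. *)
Lemma no_sign_change x y : (x.+1 < y)%N ->
  (forall s, (x < s < y)%N -> 0 < Rem s * Rem s.+1) ->
  \rsum_(x.+1 <= s < y.+1) wRem s <= 16.
Proof.
move=> xy h; set c := Rem x.+1.
have h0 : 0 < c * Rem x.+2 by apply: h; rewrite ltnSn.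
have c2 : 0 < c * c by have : c <> 0 by [move=> E; move: h0; rewrite E; lra]; move=> ?; nra.
have P i : (x.+1 + i <= y)%N -> 0 < c * Rem (x.+1 + i).
  elim: i => [|i IH] hi; first by rewrite addn0.
  rewrite addnS; have h1 := IH (ltac:(lia)); have h2 := @h (x.+1 + i)%N (ltac:(lia)).
  move: (Rem (x.+1 + i)) (Rem (x.+1 + i).+1) h1 h2 => r r' h1 h2.
  have : 0 < (c * r) * (r * r') by apply: Rmult_lt_0_compat.
  move=> h3; have r2 : 0 < r * r by have : r <> 0 by [move=> E; move: h1; rewrite E; lra]; move=> ?; nra.
  apply: (Rmult_lt_reg_l (r * r)) => //; lra.
have {}P s : (x < s <= y)%N -> 0 < c * Rem s.
  by move=> /andP[xs sy]; rewrite -(subnKC xs); apply: P; rewrite subnKC.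
have xy' : (x <= y)%N by lia.
apply: Rle_trans (_ : Rabs (\rsum_(x.+1 <= s < y.+1) (Rem s / (INR s) ^ 2)) <= _); last exact: sum_Rem_range.
case: (Rle_dec 0 c) => c0.
  apply: Rle_trans (Rle_abs _); right; apply: eq_big_nat => s hs.
  by rewrite /wRem Rabs_pos_eq //; have := P s hs; nra.
rewrite -Rabs_Ropp; apply: Rle_trans (Rle_abs _).
rewrite (_ : - _ = -1 * \rsum_(x.+1 <= s < y.+1) (Rem s / (INR s) ^ 2)); last ring.
rewrite rsum_mull; right; apply: eq_big_nat => s hs.
by rewrite /wRem Rabs_left1; [rewrite /Rdiv; ring|have := P s hs; nra].
Qed.

Lemma sum_wRem_range_le a x y : (0 < x <= y)%N ->
  (forall s, (x < s)%N -> Rabs (Rem s) <= a * INR s) ->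
  \rsum_(x.+1 <= s < y.+1) wRem s <= a * \rsum_(x.+1 <= s < y.+1) / INR s.
Proof.
move=> /andP[x0 xy] h; rewrite rsum_mull; apply: rsum_le => s /andP[xs _] _.
by apply: wRem_le; [lia|apply: h].
Qed.

(** At a sign change [|Rem s|] is at most the jump [|Rem s.+1 - Rem s|], and [Rem_lipschitz] keeps
    [Rem] small up to [s + s / K]. Four errors of at most [al / 8 * t] add up to [al / 2 * t]. *)
Lemma sign_change_gain al K : 0 < al -> (0 < K)%N -> 8 / al <= INR K ->
  exists n0, forall s, (n0 <= s)%N -> Rem s * Rem s.+1 <= 0 ->
  forall t, (s < t <= s + s %/ K)%N -> Rabs (Rem t) <= al / 2 * INR t.
Proof.
move=> al0 K0 hK; have e0 : 0 < al / 8 by lra.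
have [n0 hn] := Rem_lipschitz e0; have [n1 hn1] := INR_above (8 / al).
exists (n0 + n1).+1 => s hs sc t /andP[st ts].
have s0 : (0 < s)%N by lia.
have h1 := @hn s s.+1 (ltac:(lia)) (ltac:(lia)); have h2 := @hn s t (ltac:(lia)) (ltac:(lia)).
have h3 : Rabs (Rem s) <= Rabs (Rem s.+1 - Rem s).
  by move: (Rem s) (Rem s.+1) sc => r r' sc; split_Rabs; nra.
rewrite S_INR in h1.
have h4 : INR t - INR s <= al / 8 * INR s.
  have : INR t <= INR s + INR (s %/ K) by rewrite -INR_addn; apply: INR_le.
  have := INR_divn_le s K0; have sR := INR_lt0 s0.
  suff : INR s / INR K <= al / 8 * INR s by lra.
  have KR := INR_lt0 K0.
  apply/Rle_div_l => //; rewrite -[X in X <= _]Rmult_1_l (Rmult_comm (al / 8)) Rmult_assoc Rmult_comm.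
  apply: Rmult_le_compat_l; first lra.
  by move: hK => /Rle_div_l => /(_ al0); lra.
have h5 : 8 <= al * INR s.
  have := hn1 s (ltac:(lia)) => /Rle_div_l => /(_ al0); lra.
have h6 : INR s + 1 <= INR t by rewrite -S_INR; apply: INR_le.
have : Rabs (Rem t) <= Rabs (Rem t - Rem s) + Rabs (Rem s) by split_Rabs; lra.
have : al * INR s <= al * INR t by apply: Rmult_le_compat_l; lra.
have : al * (INR s + 1) <= al * INR t by apply: Rmult_le_compat_l; lra.
lra.
Qed.

Lemma sum_inv_short_ge s K : (0 < K)%N -> (2 * K <= s)%N ->
  / (4 * INR K) <= \rsum_(s.+1 <= t < (s + s %/ K).+1) / INR t.
Proof.
move=> K0 sK; have KR := INR_lt0 K0.
have s0 : (0 < s)%N by lia.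
have sR := INR_lt0 s0.
have d2 : (s %/ K <= s)%N by apply: leq_div.
apply: Rle_trans (_ : \rsum_(s.+1 <= t < (s + s %/ K).+1) / (2 * INR s) <= _); last first.
  apply: rsum_le => t /andP[st ts] _; apply: Rinv_le_contravar; first by apply: INR_lt0; lia.
  have -> : 2 * INR s = INR (s + s) by rewrite INR_addn; ring.
  by apply: INR_le; lia.
rewrite rsum_const; last by rewrite ltnS leq_addr.
rewrite subSS addKn.
have := INR_divn_gt s K0; have : 2 * INR K <= INR s by have := INR_le sK; rewrite INR_muln.
move=> h1 h2.
have h3 : INR s / (2 * INR K) <= INR (s %/ K).
  have : 1 <= INR s / (2 * INR K) by apply/Rle_div_r; lra.
  have : INR s / INR K = 2 * (INR s / (2 * INR K)) by field; lra.
  lra.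
apply: Rle_trans (_ : INR s / (2 * INR K) * / (2 * INR s) <= _); first by right; field; lra.
by apply: Rmult_le_compat_r => //; apply: Rlt_le; apply: Rinv_0_lt_compat; lra.
Qed.

(* Without a sign change on [(x, l x]] the sum is at most 16 by [sum_Rem_range]; otherwise [Rem] is
   small on a whole interval next to a sign change, by [Rem_lipschitz]. *)
Lemma block_gain al : 0 < al ->
  exists (L : nat) (d : R), [/\ (1 < L)%N, 0 < d &
    forall a, al <= a -> forall n0, (forall s, (n0 <= s)%N -> Rabs (Rem s) <= a * INR s) ->
    exists x0, forall x, (x0 <= x)%N ->
      \rsum_(x.+1 <= s < (L * x).+1) wRem s <= a * ln (INR L) - d].
Proof.
move=> al0; have [K [K0 hK]] : exists K, (0 < K)%N /\ 8 / al <= INR K.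
  by have [n hn] := INR_above (8 / al); exists n.+1; split=> //; apply: hn.
(* Chosen for the case without a sign change: there the sum over the block is at most [16 + a],
   while [a * ln l >= 17 + a], a gain of 1. *)
have [l0 [l00 hl]] := ln_INR_above (17 / al + 1).
have [n1 hn1] := sign_change_gain al0 K0 hK.
have KR := INR_lt0 K0.
(* [g] is the gain at a sign change: on an interval of logarithmic length at least [1 / (4 K)] the
   bound [a] improves to [al / 2], that is by at least [al / 2]. *)
pose l := l0.+2; pose g := al / 2 * / (4 * INR K).
have g0 : 0 < g by apply: Rmult_lt_0_compat; [lra|apply: Rinv_0_lt_compat; lra].
(* The factor 2 leaves room for the interval [(s, s + s / K]] when [s < l x] is close to [l x]. *)
exists (2 * l)%N, (Rmin 1 g); split=> //; first by apply: Rmin_pos; lra.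
move=> a aal n0 ha; exists (n0 + n1 + 2 * K).+3 => x hx.
have x0 : (0 < x)%N by lia.
have ha' y : (x <= y)%N -> forall s, (y < s)%N -> Rabs (Rem s) <= a * INR s by move=> xy s ys; apply: ha; lia.
have lE m : (0 < m)%N -> ln (INR (m * x)) - ln (INR x) = ln (INR m).
  by move=> m0; rewrite INR_muln ln_mult; [ring|apply: INR_lt0|apply: INR_lt0].
have lx1 : (x.+1 < l * x)%N by rewrite /l; nia.
have ll : (l * x <= 2 * l * x)%N by rewrite -mulnA leq_pmull.
case: (Classical_Prop.classic (exists s, (x < s < l * x)%N /\ Rem s * Rem s.+1 <= 0)) => [[s [/andP[xs sl] sc]]|nsc].
  have sK : (2 * K <= s)%N by lia.
  have G := sum_inv_short_ge K0 sK.
  have s'l : (s + s %/ K <= 2 * l * x)%N by have := leq_div s K; lia.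
  have s's : (s <= s + s %/ K)%N by apply: leq_addr.
  rewrite (@rsum_cat _ s.+1); [|by lia|by lia].
  rewrite (@rsum_cat s.+1 (s + s %/ K).+1) ?ltnS //.
  have A1 := @sum_wRem_range_le a x s (ltac:(lia)) (ha' x (leqnn x)).
  have A2 := @sum_wRem_range_le a (s + s %/ K)%N (2 * l * x)%N (ltac:(lia)) (ha' (s + s %/ K)%N (ltac:(lia))).
  have A3 : \rsum_(s.+1 <= t < (s + s %/ K).+1) wRem t
     <= al / 2 * \rsum_(s.+1 <= t < (s + s %/ K).+1) / INR t.
    rewrite rsum_mull; apply: rsum_le => t ht _; apply: wRem_le; first by lia.
    by apply: (hn1 s) => //; lia.
  have := @sum_inv_range_le x (2 * l * x)%N (ltac:(lia)); rewrite lE //.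
  rewrite (@rsum_cat _ s.+1); [|by lia|by lia].
  rewrite (@rsum_cat s.+1 (s + s %/ K).+1) ?ltnS //.
  move: G A1 A2 A3; move: (\big[_/_]_(x.+1 <= _ < _) wRem _) (\big[_/_]_(s.+1 <= _ < _) wRem _)
    (\big[_/_]_((s + s %/ K).+1 <= _ < _) wRem _) (\big[_/_]_(x.+1 <= _ < _) / _)
    (\big[_/_]_(s.+1 <= _ < _) / _) (\big[_/_]_((s + s %/ K).+1 <= _ < _) / _)
    => w1 w2 w3 i1 i2 i3 G A1 A2 A3 H.
  have := Rmin_r 1 g.
  have : a * (i1 + (i2 + i3)) <= a * ln (INR (2 * l)) by apply: Rmult_le_compat_l; lra.
  have : al / 2 * i2 <= (a - al / 2) * i2.
    apply: Rmult_le_compat_r; last lra.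
    by have := Rinv_0_lt_compat (4 * INR K); lra.
  have : g <= al / 2 * i2 by apply: Rmult_le_compat_l; lra.
  lra.
have {}nsc s : (x < s < l * x)%N -> 0 < Rem s * Rem s.+1.
  move=> hs; apply: Rnot_le_lt => hc; apply: nsc; by exists s.
have B1 := no_sign_change lx1 nsc.
have B2 := @sum_wRem_range_le a (l * x)%N (2 * l * x)%N (ltac:(lia)) (ha' (l * x)%N (ltac:(lia))).
have := @sum_inv_range_le (l * x)%N (2 * l * x)%N (ltac:(lia)).
rewrite (@rsum_cat x.+1 (l * x).+1); [|by lia|by lia].
rewrite -[(2 * l * x)%N]mulnA in B2 *.
rewrite (@INR_muln 2 (l * x)) ln_mult; [|by rewrite /=; lra|by apply: INR_lt0; lia].
rewrite (@INR_muln 2 l) ln_mult; [|by rewrite /=; lra|by apply: INR_lt0; lia].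
have ln2 : 0 <= ln (INR 2) <= 1 by split; [exact: ln_INR_ge0|have := @ln_le_sub1 (INR 2); rewrite [INR 2]/=; lra].
move: B1 B2; move: (\big[_/_]_(_ <= _ < _) wRem _) (\big[_/_]_(_ <= _ < _) wRem _) (\big[_/_]_(_ <= _ < _) / _).
move=> w1 w2 i B1 B2 B3.
have : a * i <= a * 1 by apply: Rmult_le_compat_l; lra.
have lnl : 17 / al + 1 <= ln (INR l) by apply: hl; rewrite /l; lia.
have : a * (17 / al + 1) <= a * ln (INR l) by apply: Rmult_le_compat_l; lra.
have : 17 <= a * (17 / al).
  apply: Rle_trans (_ : al * (17 / al) <= _); first by right; field; lra.
  by apply: Rmult_le_compat_r => //; apply: Rlt_le; apply: Rdiv_lt_0_compat; lra.
have := Rmin_l 1 g; have : 0 <= a * ln (INR 2) by apply: Rmult_le_pos; lra.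
lra.
Qed.

(** Summation by parts against [ln N - ln s], where the increments of [F] dominate the assumed
    average times those of [ln]. The factor [1 / 2] in [F] cancels the 2 of [selberg_integral], so
    the average [be] itself becomes the new bound. *)
Lemma Rem_of_average be C : 0 <= be -> 0 <= C ->
  (forall n, (0 < n)%N -> \rsum_(1 <= s < n.+1) wRem s <= be * ln (INR n) + C) ->
  forall N, (0 < N)%N ->
    Rabs (Rem N) * (ln (INR N)) ^ 2
    <= INR N * (be * (ln (INR N) + 1) ^ 2 + (2 * C + 830) * (ln (INR N) + 1)).
Proof.
move=> be0 C0 h N N0; apply: Rle_trans (selberg_integral N0) _.
have NR := INR_lt0 N0; have lN := ln_INR_ge0 N0.
have l1 : ln (INR N.+1) <= ln (INR N) + 1.
  by have := ln_succ_le N0; have := Rinv_le_contravar 1 (INR N) Rlt_0_1 (INR_ge1 N0); lra.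
have l0 : 0 <= ln (INR N.+1) by apply: ln_INR_ge0.
have : \rsum_(1 <= s < N.+1) (wRem s * (ln (INR N) - ln (INR s)))
    <= be / 2 * (ln (INR N.+1)) ^ 2 + C * ln (INR N.+1).
  rewrite abel.
  have B0 : 0 <= \rsum_(1 <= i < N.+1) wRem i.
    by apply: rsum_ge0 => i /andP[i0 _] _; apply: wRem_ge0.
  have := @ln_INR_le N N.+1; rewrite N0 leqnSn => /(_ isT) l2.
  have : 0 <= (\rsum_(1 <= i < N.+1) wRem i) * (ln (INR N.+1) - ln (INR N)).
    by apply: Rmult_le_pos; lra.
  pose F k := be / 2 * (ln (INR k)) ^ 2 + C * ln (INR k).
  have : \rsum_(1 <= k < N.+1) ((\rsum_(1 <= i < k.+1) wRem i)
      * (ln (INR N) - ln (INR k) - (ln (INR N) - ln (INR k.+1)))) <= F N.+1.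
    have -> : F N.+1 = F N.+1 - F 1%N by rewrite /F /= ln_1; ring.
    rewrite -(telescope F (isT : (1 <= N.+1)%N)); apply: rsum_le => k /andP[k0 _] _.
    rewrite (_ : _ - _ - _ = ln (INR k.+1) - ln (INR k)); last ring.
    have := @ln_INR_le k k.+1; rewrite k0 leqnSn => /(_ isT) l3.
    have lk := ln_INR_ge0 k0.
    apply: Rle_trans (_ : (be * ln (INR k) + C) * (ln (INR k.+1) - ln (INR k)) <= _).
      by apply: Rmult_le_compat_r; [lra|apply: h].
    rewrite /F; move: (ln (INR k)) (ln (INR k.+1)) l3 lk => u v uv u0.
    have : 0 <= be * (v - u) ^ 2 by apply: Rmult_le_pos => //; apply: pow2_ge_0.
    by rewrite /=; lra.
  rewrite /F; lra.
rewrite /wRem; move: (\big[_/_]_(_ <= _ < _) _) => s hs.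
have : INR N * s <= INR N * (be / 2 * (ln (INR N) + 1) ^ 2 + C * (ln (INR N) + 1)).
  apply: Rmult_le_compat_l; first lra.
  apply: Rle_trans hs _; apply: Rplus_le_compat; apply: Rmult_le_compat_l => //; first lra.
  by apply: pow_incr.
lra.
Qed.

Definition Rem_le_eventually a := exists n0, forall n, (n0 <= n)%N -> Rabs (Rem n) <= a * INR n.

Lemma wRem_sum_geometric L x0 b : (1 < L)%N -> (0 < x0)%N -> 0 <= b ->
  (forall x, (x0 <= x)%N -> \rsum_(x.+1 <= s < (L * x).+1) wRem s <= b) ->
  forall j, \rsum_(1 <= s < (L ^ j * x0).+1) wRem s
            <= \rsum_(1 <= s < x0.+1) wRem s + INR j * b.
Proof.
move=> L1 x00 b0 h; elim=> [|j IH]; first by rewrite expn0 mul1n /=; lra.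
have Lj : (0 < L ^ j)%N by rewrite expn_gt0; lia.
rewrite expnS -mulnA (@rsum_cat 1 (L ^ j * x0).+1); [|by []|by rewrite ltnS leq_pmull //; lia].
by have := h (L ^ j * x0)%N (leq_pmull _ Lj); rewrite S_INR; lra.
Qed.

(** The average of [wRem] per unit of [ln n] drops from [a] to [a - d / ln L], and half of this gain
    is spent on the terms of order [N ln N]. Since [de] depends on [al] alone, finitely many
    repetitions bring any bound below [al]. *)
Lemma Rem_contraction al : 0 < al ->
  exists de, 0 < de /\ forall a, al <= a -> Rem_le_eventually a -> Rem_le_eventually (a - de).
Proof.
move=> al0; have [L [d [L1 d0 hb]]] := block_gain al0.
have lL : 0 < ln (INR L) by rewrite -ln_1; apply: ln_increasing; [lra|exact: (@INR_lt 1)].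
pose de := d / ln (INR L); have de0 : 0 < de by apply: Rdiv_lt_0_compat.
exists (de / 2); split; first lra.
move=> a aal [n0 hn]; have [x1 hx] := hb a aal n0 hn.
set b := a * ln (INR L) - d in hx.
(* The blocks [(L ^ j * x0, L ^ j.+1 * x0]] need a positive start. *)
pose x0 := x1.+1.
have hx0 x : (x0 <= x)%N -> \rsum_(x.+1 <= s < (L * x).+1) wRem s <= b by move=> h; apply: hx; apply: ltnW.
have b0 : 0 <= b.
  apply: Rle_trans (hx0 x0 (leqnn _)); apply: rsum_ge0 => s hs _; apply: wRem_ge0; lia.
pose B0 := \rsum_(1 <= s < x0.+1) wRem s.
have B00 : 0 <= B0 by apply: rsum_ge0 => s /andP[s0 _] _; apply: wRem_ge0.
have bE : b / ln (INR L) = a - de by rewrite /b /de; field; lra.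
have be0 : 0 <= a - de by rewrite -bE; apply: Rmult_le_pos => //; apply: Rlt_le; apply: Rinv_0_lt_compat.
have avg n : (0 < n)%N -> \rsum_(1 <= s < n.+1) wRem s <= (a - de) * ln (INR n) + (B0 + b).
  move=> n0'; set j := trunc_log L n.
  have j1 : (L ^ j <= n)%N by apply: trunc_logP.
  have j2 : (n <= L ^ j.+1 * x0)%N.
    apply: leq_trans (leq_pmulr _ _) => //; exact: ltnW (trunc_log_ltn _ _).
  apply: Rle_trans (_ : \rsum_(1 <= s < (L ^ j.+1 * x0).+1) wRem s <= _).
    apply: rsum_le_range; first by rewrite ltnS.
    by move=> i hi; apply: wRem_ge0; lia.
  apply: Rle_trans (wRem_sum_geometric L1 (ltn0Sn _) b0 hx0 j.+1) _.
  rewrite S_INR -/B0.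
  have : INR j * ln (INR L) <= ln (INR n).
    have -> : INR j * ln (INR L) = ln (INR (L ^ j)).
      have LR : 0 < INR L by apply: INR_lt0; lia.
      elim: (j) => [|i IH]; first by rewrite expn0 /= ln_1; ring.
      rewrite expnS INR_muln ln_mult //; last by apply: INR_lt0; rewrite expn_gt0; lia.
      by rewrite S_INR -IH; ring.
    by apply: ln_INR_le; rewrite j1 expn_gt0; lia.
  move=> hj; have : INR j * b <= (a - de) * ln (INR n); last lra.
  rewrite -bE (_ : INR j * b = b / ln (INR L) * (INR j * ln (INR L))); last by field; lra.
  by apply: Rmult_le_compat_l => //; rewrite bE.
have C0 : 0 <= B0 + b by lra.
have H := Rem_of_average be0 C0 avg.
(* [D] collects everything of first order in [l = ln n], using [l >= 1]. *)
set D := 3 * (a - de) + 2 * (2 * (B0 + b) + 830).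
have D0 : 0 <= D by rewrite /D; lra.
have [n1 [n10 hn1]] := ln_INR_above (1 + D * 2 / de).
exists n1 => n hn1n; have n0' : (0 < n)%N by lia.
have l1 := hn1 n hn1n; have nR := INR_lt0 n0'.
have := H n n0'; move: l1; move: (ln (INR n)) => l l1.
have D2 : 0 <= D * 2 / de by apply: Rmult_le_pos; [lra|apply: Rlt_le; apply: Rinv_0_lt_compat].
have l2 : 0 < l ^ 2 by apply: pow_lt; lra.
move=> h; apply: (Rmult_le_reg_r (l ^ 2)) => //; apply: Rle_trans h _.
rewrite (Rmult_comm _ (INR n)) Rmult_assoc; apply: Rmult_le_compat_l; first lra.
have h1 : D * 2 / de * l <= l * l by apply: Rmult_le_compat_r; lra.
have h2 : D * l <= de / 2 * (l * l).
  rewrite (_ : D * l = de / 2 * (D * 2 / de * l)); last by field; lra.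
  by apply: Rmult_le_compat_l; lra.
have h3 : (a - de) * (l + 1) ^ 2 <= (a - de) * (l * l + 3 * l) by apply: Rmult_le_compat_l => //; nra.
have h4 : (2 * (B0 + b) + 830) * (l + 1) <= (2 * (B0 + b) + 830) * (2 * l) by apply: Rmult_le_compat_l; lra.
rewrite /D in h2; rewrite (_ : l ^ 2 = l * l); last ring.
lra.
Qed.

Lemma prime_number_theorem_psi e : 0 < e -> Rem_le_eventually e.
Proof.
move=> e0; have [de [de0 h]] := Rem_contraction e0.
have mono a b : a <= b -> Rem_le_eventually a -> Rem_le_eventually b.
  move=> ab [n0 hn]; exists n0 => n nn; apply: Rle_trans (hn n nn) _.
  by apply: Rmult_le_compat_r => //; apply: pos_INR.
(* The start is the bound 3 of [Rem_abs_le]; [h] applies as long as the current bound is at least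
   [e]. *)
have step k : Rem_le_eventually e \/ Rem_le_eventually (3 - INR k * de).
  elim: k => [|k [IH|IH]]; [right|by left|].
    by exists 0%N => n _; rewrite /= Rmult_0_l Rminus_0_r; apply: Rem_abs_le.
  case: (Rle_dec e (3 - INR k * de)) => he; last by left; apply: mono IH; lra.
  by right; rewrite S_INR; apply: mono (h _ he IH); lra.
have [k hk] := INR_above (3 / de).
case: (step k) => // hk'; apply: mono hk'.
have := hk k (leqnn k) => /Rle_div_l => /(_ de0); lra.
Qed.

(** * From [psi] to [theta] *)

Lemma sum_f_R0_rsum (f : nat -> R) n : f 0%N = 0 -> sum_f_R0 f n = \rsum_(1 <= i < n.+1) f i.
Proof.
move=> f0; elim: n => [|n IH]; first by rewrite big_geq.
by rewrite /= IH [RHS]rsum_recr.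
Qed.

Lemma thetaE n : theta n = \rsum_(1 <= q < n.+1 | prime q) ln (INR q).
Proof. by rewrite /theta sum_f_R0_rsum // [RHS]big_mkcond. Qed.

Lemma SsumE n : Ssum n = \rsum_(1 <= q < n.+1 | prime q) ln (INR q / (INR q - 1)).
Proof. by rewrite /Ssum sum_f_R0_rsum // [RHS]big_mkcond. Qed.

(** A value of [mangoldt] off the primes comes from some [q ^ j] with [j >= 2] and [q <= r];
    admitting all pairs [(q, j)], with [q] prime or not, can only enlarge the sum. *)
Lemma mangoldt_prime_power_pairs n r k : (forall q, q ^ 2 <= n -> q <= r)%N -> (k <= n)%N ->
  (if prime k then 0 else mangoldt k)
  <= \rsum_(1 <= q < r.+1) \rsum_(2 <= j < (trunc_log 2 n).+1) (if k == (q ^ j)%N then ln (INR q) else 0).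
Proof.
move=> hr kn.
have T0 q j : (0 < q)%N -> 0 <= if k == (q ^ j)%N then ln (INR q) else 0.
  by move=> q0; case: ifP => _; [apply: ln_INR_ge0|lra].
have S0 : 0 <= \rsum_(1 <= q < r.+1) \rsum_(2 <= j < (trunc_log 2 n).+1) (if k == (q ^ j)%N then ln (INR q) else 0).
  by apply: rsum_ge0 => q /andP[q0 _] _; apply: rsum_ge0 => j _ _; apply: T0.
case: (boolP (prime k)) => // nk.
case: (Req_dec (mangoldt k) 0) => [->|/mangoldt_neq0[q [j [pq j0 kE]]]] //.
have q0 := prime_gt0 pq; have q1 := prime_gt1 pq.
have j2 : (1 < j)%N.
  case: j j0 kE => [|[|j]] // _; rewrite expn1 => E; by rewrite E pq in nk.
have qj : (q ^ j <= n)%N by rewrite -kE.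
have qr : (q <= r)%N by apply: hr; apply: leq_trans qj; rewrite leq_exp2l.
have jl : (j <= trunc_log 2 n)%N.
  by apply: trunc_log_max => //; apply: leq_trans qj; rewrite leq_exp2r.
rewrite (@Rbig_D1 _ _ q); [|by rewrite q0 ltnS|by []].
rewrite (@Rbig_D1 _ _ j 2); [|by apply/andP; split|by []].
rewrite {1}kE mangoldt_prime_pow // kE eqxx /=.
have : 0 <= \rsum_(2 <= i < (trunc_log 2 n).+1 | (fun _ => true) i && (i != j)) (if (q ^ j)%N == (q ^ i)%N then ln (INR q) else 0).
  by apply: rsum_ge0 => i _ _; rewrite -kE; apply: T0.
have : 0 <= \rsum_(1 <= i < r.+1 | (fun _ => true) i && (i != q))
     \rsum_(2 <= j0 < (trunc_log 2 n).+1) (if (q ^ j)%N == (i ^ j0)%N then ln (INR i) else 0).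
  by apply: rsum_ge0 => i /andP[i0 _] _; apply: rsum_ge0 => ? _ _; rewrite -kE; apply: T0.
by rewrite /=; lra.
Qed.

(** At most [r] bases, at most [2 * ln n] exponents, and at most [ln n] for each pair. In the
    application [r] is the integer square root of [n]. *)
Lemma psi_theta_le n r : (0 < n)%N -> (forall q, q ^ 2 <= n -> q <= r)%N -> (r <= n)%N ->
  0 <= psi n - theta n <= INR r * (2 * (ln (INR n)) ^ 2).
Proof.
move=> n0 hr rn; have lN := ln_INR_ge0 n0.
have -> : psi n - theta n = \rsum_(1 <= k < n.+1) (if prime k then 0 else mangoldt k).
  rewrite thetaE [X in _ - X]big_mkcond /psi -rsumB; apply: eq_bigr => k _.
  by case: ifP => [pk|_]; [rewrite mangoldt_prime //|]; ring.
split; first by apply: rsum_ge0 => k _ _; case: ifP => _; [lra|apply: mangoldt_ge0].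
set J := trunc_log 2 n.
apply: Rle_trans (_ : \rsum_(1 <= k < n.+1) \rsum_(1 <= q < r.+1) \rsum_(2 <= j < J.+1)
   (if k == (q ^ j)%N then ln (INR q) else 0) <= _).
  by apply: rsum_le => k /andP[_ kn] _; apply: mangoldt_prime_power_pairs.
rewrite exchange_big_nat /=.
apply: Rle_trans (_ : \rsum_(1 <= q < r.+1) (2 * ln (INR n) ^ 2) <= _); last first.
  by rewrite rsum_const // subSS subn0; lra.
apply: rsum_le => q /andP[q0 qr] _; rewrite exchange_big_nat /=.
have qn : ln (INR q) <= ln (INR n) by apply: ln_INR_le; lia.
have lq := ln_INR_ge0 q0.
apply: Rle_trans (_ : \rsum_(2 <= j < J.+1) ln (INR n) <= _).
  apply: rsum_le => j _ _; rewrite -big_mkcond.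
  case: (boolP (1 <= q ^ j < n.+1)%N) => h.
    rewrite (@Rbig_D1 _ _ (q ^ j)%N) //= big_pred0 ?Rplus_0_r // => i; exact: andbN.
  rewrite big_nat_cond big_pred0; first lra.
  by move=> i; case: eqP => [->|_]; rewrite ?andbF // andbT (negbTE h).
have ln2 : 1 / 2 <= ln 2.
  have := @ln_diff_le 2 1; rewrite ln_1; lra.
have Jl : INR J * ln 2 <= ln (INR n).
  have -> : INR J * ln 2 = ln (INR (2 ^ J)).
    elim: (J) => [|i IH]; first by rewrite expn0 /= ln_1; ring.
    rewrite expnS INR_muln ln_mult //; [|by rewrite /=; lra|by apply: INR_lt0; rewrite expn_gt0].
    by rewrite (S_INR i) -IH (_ : INR 2 = 2) //; ring.
  by apply: ln_INR_le; rewrite expn_gt0 /=; apply: trunc_logP.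
have J2 : INR J <= 2 * ln (INR n) by have := pos_INR J; nra.
case: (ltnP 1 J) => J1.
  rewrite rsum_const; last by lia.
  have : INR (J.+1 - 2) <= INR J by apply: INR_le; lia.
  have := pos_INR (J.+1 - 2); nra.
by rewrite big_geq; [nra|lia].
Qed.

(** With [x = t ^ 8], the left side is at most [64 * t ^ 2], while [sqrt x = t ^ 4] and
    [t ^ 2 >= 64 / e] for large [x]. *)
Lemma ln_sq_little_o e : 0 < e -> exists n0, forall n, (n0 <= n)%N -> (ln (INR n)) ^ 2 <= e * sqrt (INR n).
Proof.
move=> e0; have [n0 hn] := INR_above ((64 / e) ^ 4 + 1); exists n0 => n nn.
have := hn n nn; move: (INR n) => x hx.
have e4 : 0 <= (64 / e) ^ 4.
  by apply: pow_le; apply: Rlt_le; apply: Rdiv_lt_0_compat; lra.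
have x1 : 1 <= x by lra.
have s1 : 1 <= sqrt x by rewrite -sqrt_1; apply: sqrt_le_1_alt.
have s2 : 1 <= sqrt (sqrt x) by rewrite -sqrt_1; apply: sqrt_le_1_alt.
have s3 : 1 <= sqrt (sqrt (sqrt x)) by rewrite -sqrt_1; apply: sqrt_le_1_alt.
have E1 : sqrt x * sqrt x = x by apply: sqrt_sqrt; lra.
have E2 : sqrt (sqrt x) * sqrt (sqrt x) = sqrt x by apply: sqrt_sqrt; lra.
have E3 : sqrt (sqrt (sqrt x)) * sqrt (sqrt (sqrt x)) = sqrt (sqrt x) by apply: sqrt_sqrt; lra.
have h : 64 / e <= sqrt (sqrt x).
  apply: Rnot_lt_le => hc; have : (sqrt (sqrt x)) ^ 4 < (64 / e) ^ 4.
    move: (sqrt (sqrt x)) s2 hc => t t1 hc.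
    have {}hc : t ^ 2 < (64 / e) ^ 2 by rewrite /=; nra.
    rewrite (_ : t ^ 4 = (t ^ 2) ^ 2); last ring.
    by rewrite (_ : (64 / e) ^ 4 = ((64 / e) ^ 2) ^ 2); [have := pow2_ge_0 t; nra|ring].
  rewrite (_ : sqrt (sqrt x) ^ 4 = (sqrt (sqrt x) * sqrt (sqrt x)) * (sqrt (sqrt x) * sqrt (sqrt x))); last ring.
  by rewrite E2 E1; lra.
have : ln x = 8 * ln (sqrt (sqrt (sqrt x))).
  have D y : 1 <= y -> ln (y * y) = 2 * ln y by move=> y1; rewrite ln_mult; lra.
  by rewrite -{1}E1 D // -{1}E2 D // -{1}E3 D //; ring.
move: h E2 E3 s3; move: (sqrt (sqrt (sqrt x))) => t h E2 E3 t1 ->.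
have lt0 := ln_ge0 t1; have := @ln_le_sub1 t; move: (ln t) lt0 => l l0 hl.
have {}hl : l <= t by lra.
rewrite -E2 -E3; rewrite -E3 in h.
have h2 : 64 <= e * (t * t) by move: h => /Rle_div_l => /(_ e0); lra.
have l2 : l * l <= t * t by apply: Rmult_le_compat.
have : 64 * (t * t) <= e * (t * t) * (t * t) by apply: Rmult_le_compat_r; nra.
by rewrite /=; lra.
Qed.

Lemma theta_asymp e : 0 < e ->
  exists n0, forall n, (n0 <= n)%N -> Rabs (theta n - INR n) <= e * INR n.
Proof.
move=> e0; have e2 : 0 < e / 2 by lra.
have [n0 hn0] := prime_number_theorem_psi e2.
have e4 : 0 < e / 4 by lra.
have [n1 hn1] := ln_sq_little_o e4.
exists (n0 + n1).+1 => n hn; have n0' : (0 < n)%N by lia.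
have h0 := hn0 n (ltac:(lia)); have h1 := hn1 n (ltac:(lia)).
have [r1 r2] := Nat.sqrt_spec n (Nat.le_0_l n).
have hr q : (q ^ 2 <= n -> q <= Nat.sqrt n)%N.
  move=> h; have : (q < (Nat.sqrt n).+1)%N; last by [].
  by rewrite ltnNge; apply/negP => hc; nia.
have rn : (Nat.sqrt n <= n)%N by nia.
have [t0 t1] := psi_theta_le n0' hr rn.
have rR : INR (Nat.sqrt n) <= sqrt (INR n).
  rewrite -[X in X <= _]sqrt_square; last exact: pos_INR.
  by apply: sqrt_le_1_alt; rewrite -INR_muln; apply: INR_le; apply/leP.
have ss : sqrt (INR n) * sqrt (INR n) = INR n by apply: sqrt_sqrt; apply: pos_INR.
have : INR (Nat.sqrt n) * (2 * ln (INR n) ^ 2) <= sqrt (INR n) * (2 * (e / 4 * sqrt (INR n))).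
  apply: Rmult_le_compat => //; first exact: pos_INR; have := pow2_ge_0 (ln (INR n)); lra.
rewrite (_ : sqrt _ * (2 * (e / 4 * sqrt _)) = e / 2 * (sqrt (INR n) * sqrt (INR n))); last by field.
rewrite ss => t2; move: h0; rewrite /Rem => h0.
have : Rabs (theta n - psi n) <= e / 2 * INR n by apply: Rabs_le; lra.
by split_Rabs; lra.
Qed.

(** * Tails of sums over primes *)

(** The tail with the factor [ln q] is treated first, since summation by parts with [theta] gives it
    directly; [prime_tail] follows on dividing by a logarithm. *)
Definition prime_log_tail y x := \rsum_(y.+1 <= q < x.+1 | prime q) (ln (INR q) / (INR q) ^ 2).
Definition prime_tail y x := \rsum_(y.+1 <= q < x.+1 | prime q) (/ (INR q) ^ 2).

Lemma abel_range y x (c g : nat -> R) : (y <= x)%N ->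
  \rsum_(y.+1 <= n < x.+1) ((c n - c n.-1) * g n)
  = c x * g x.+1 - c y * g y.+1 + \rsum_(y.+1 <= n < x.+1) (c n * (g n - g n.+1)).
Proof.
move=> /subnKC <-; elim: (x - y)%N => [|d IH]; first by rewrite addn0 !big_geq //; ring.
rewrite addnS rsum_recr ?ltnS ?leq_addr // IH [X in _ = _ + X]rsum_recr ?ltnS ?leq_addr //=.
ring.
Qed.

Lemma sum_inv_succ_range y x : (0 < y <= x)%N ->
  \rsum_(y.+1 <= n < x.+1) / (INR n * INR n.+1) = / INR y.+1 - / INR x.+1.
Proof.
move=> /andP[y0 /subnKC <-]; elim: (x - y)%N => [|d IH]; first by rewrite addn0 big_geq //; ring.
rewrite addnS rsum_recr ?ltnS ?leq_addr // IH (S_INR (y + d).+1).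
have := INR_lt0 (ltn0Sn (y + d)); have := INR_lt0 (ltn0Sn y) => ? ?; field; lra.
Qed.

Lemma sum_inv_sq_range y x : (0 < y <= x)%N ->
  / INR y - / INR x - / (INR y) ^ 2 <= \rsum_(y.+1 <= n < x.+1) / (INR n) ^ 2 <= / INR y - / INR x.
Proof.
move=> /andP[y0 yx]; have yR := INR_lt0 y0; have xR := INR_lt0 (leq_trans y0 yx).
split.
  apply: Rle_trans (_ : / INR y.+1 - / INR x.+1 <= _).
    have h : / INR y - / INR y.+1 <= / (INR y) ^ 2.
      rewrite S_INR (_ : _ - _ = / (INR y * (INR y + 1))); last by field; lra.
      by apply: Rinv_le_contravar; nra.
    have : / INR x.+1 <= / INR x by apply: Rinv_le_contravar => //; apply: INR_le.
    lra.
  rewrite -sum_inv_succ_range ?y0 //; apply: rsum_le => n /andP[yn _] _.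
  have nR : 0 < INR n by apply: INR_lt0; lia.
  by rewrite S_INR; apply: Rinv_le_contravar; nra.
move: yx => /subnKC <-; elim: (x - y)%N => [|d IH]; first by rewrite addn0 big_geq //; lra.
rewrite addnS rsum_recr ?ltnS ?leq_addr //.
have nR : 0 < INR (y + d) by apply: INR_lt0; rewrite addn_gt0 y0.
have h : / (INR (y + d).+1) ^ 2 <= / INR (y + d) - / INR (y + d).+1.
  rewrite S_INR (_ : _ - _ = / (INR (y + d) * (INR (y + d) + 1))); last by field; lra.
  by apply: Rinv_le_contravar; nra.
lra.
Qed.

Lemma prime_log_tail_asymp e : 0 < e -> exists n0, (0 < n0)%N /\
  forall y x, (n0 <= y)%N -> (y <= x)%N ->
    / INR y - / INR x - e / INR y <= prime_log_tail y x <= / INR y + e / INR y.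
Proof.
move=> e0; have e5 : 0 < e / 8 by lra.
have [n0 hn] := theta_asymp e5; have [n1 hn1] := INR_above (2 / e).
exists (n0 + n1).+1; split=> // y x hy yx; have y0 : (0 < y)%N by lia.
have yR := INR_lt0 y0; have xR := INR_lt0 (leq_trans y0 yx).
pose c n := theta n - INR n; pose g n := / (INR n) ^ 2.
have hc n : (y <= n)%N -> Rabs (c n) <= e / 8 * INR n by move=> yn; apply: hn; lia.
have E : prime_log_tail y x = \rsum_(y.+1 <= n < x.+1) ((c n - c n.-1) * g n) + \rsum_(y.+1 <= n < x.+1) g n.
  rewrite /prime_log_tail big_mkcond -rsumD; apply: eq_big_nat => -[|n] // _.
  rewrite /c succnK !thetaE rsum_recr_cond // !S_INR /g S_INR.
  have : 0 < INR n + 1 by have := pos_INR n; lra.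
  by move: (\big[_/_]_(_ <= _ < _ | _) _) => s nR; case: (prime _); field; lra.
have g0 n : (0 < n)%N -> 0 < g n by move=> n0'; apply: Rinv_0_lt_compat; apply: pow_lt; apply: INR_lt0.
have dg n : (0 < n)%N -> 0 <= INR n * (g n - g n.+1) <= 2 * / (INR n * INR n.+1).
  move=> n0'; have nR := INR_lt0 n0'; rewrite /g S_INR.
  have -> : INR n * (/ INR n ^ 2 - / (INR n + 1) ^ 2) = (2 * INR n + 1) / (INR n * (INR n + 1) ^ 2) by field; lra.
  have p : 0 < INR n * (INR n + 1) ^ 2 by apply: Rmult_lt_0_compat => //; apply: pow_lt; lra.
  split; first by apply: Rlt_le; apply: Rdiv_lt_0_compat; lra.
  apply/Rle_div_l => //; apply: Rle_trans (_ : 2 * (INR n + 1) <= _); [lra|right; field; lra].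
have G n : (y <= n)%N -> Rabs (c n * g n.+1) <= e / 8 / INR y.
  move=> yn; have nR : 0 < INR n by apply: INR_lt0; lia.
  rewrite Rabs_mult (Rabs_pos_eq (g _)); last by apply: Rlt_le; apply: g0.
  apply: Rle_trans (_ : e / 8 * INR n * / (INR n) ^ 2 <= _).
    apply: Rmult_le_compat; [exact: Rabs_pos|by apply: Rlt_le; apply: g0|exact: hc|].
    by apply: Rinv_le_contravar; [apply: pow_lt|apply: pow_incr; rewrite S_INR; lra].
  rewrite (_ : _ * _ * _ = e / 8 / INR n); last by field; lra.
  by apply: Rmult_le_compat_l; [lra|apply: Rinv_le_contravar => //; apply: INR_le].
have H : Rabs (\rsum_(y.+1 <= n < x.+1) ((c n - c n.-1) * g n)) <= e / 2 / INR y.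
  rewrite abel_range //.
  have S : Rabs (\rsum_(y.+1 <= n < x.+1) (c n * (g n - g n.+1))) <= e / 4 / INR y.
    apply: Rle_trans (rsum_abs _ _ _ _) _.
    apply: Rle_trans (_ : e / 4 * \rsum_(y.+1 <= n < x.+1) / (INR n * INR n.+1) <= _).
      rewrite rsum_mull; apply: rsum_le => n /andP[yn _] _; have n0' : (0 < n)%N by lia.
      have [d1 d2] := dg n n0'; have nR := INR_lt0 n0'.
      rewrite Rabs_mult (Rabs_pos_eq (_ - _)); last first.
        by apply: (Rmult_le_reg_l (INR n)) => //; rewrite Rmult_0_r.
      apply: Rle_trans (_ : e / 8 * INR n * (g n - g n.+1) <= _).
        apply: Rmult_le_compat_r; last by apply: hc; lia.
        by apply: (Rmult_le_reg_l (INR n)) => //; rewrite Rmult_0_r.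
      have := @Rmult_le_compat_l (e / 8) _ _ (Rlt_le _ _ e5) d2; lra.
    rewrite sum_inv_succ_range ?y0 //.
    apply: Rmult_le_compat_l; first lra.
    have := Rinv_0_lt_compat _ (INR_lt0 (ltn0Sn x)).
    have : / INR y.+1 <= / INR y by apply: Rinv_le_contravar => //; apply: INR_le.
    lra.
  have := G x yx; have := G y (leqnn y); move: S.
  have -> : e / 8 / INR y = e / 2 / INR y / 4 by field; lra.
  have -> : e / 4 / INR y = e / 2 / INR y / 2 by field; lra.
  move: (\big[_/_]_(_ <= _ < _) _) (c x * _) (c y * _) => s u v *.
  by split_Rabs; lra.
have := @sum_inv_sq_range y x; rewrite y0 yx => /(_ isT); rewrite -/g.
have : / (INR y) ^ 2 <= e / 2 / INR y.
  have h : 2 / e <= INR y by apply: hn1; lia.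
  have h' : 2 <= e * INR y by move: h => /Rle_div_l => /(_ e0); lra.
  rewrite (_ : / _ ^ 2 = 1 / INR y / INR y); last by field; lra.
  apply: Rmult_le_compat_r; first by apply: Rlt_le; apply: Rinv_0_lt_compat.
  apply/Rle_div_l => //; lra.
have -> : e / INR y = 2 * (e / 2 / INR y) by field; lra.
have := Rinv_0_lt_compat _ xR.
rewrite E; move: (\big[_/_]_(_ <= _ < _) _) (\big[_/_]_(_ <= _ < _) _) H => s u H *.
by split_Rabs; lra.
Qed.

Lemma prime_tail_le y x : (1 < y)%N -> prime_tail y x <= prime_log_tail y x / ln (INR y).
Proof.
move=> y1; have ly : 0 < ln (INR y) by rewrite -ln_1; apply: ln_increasing; [lra|exact: (@INR_lt 1)].
apply/Rle_div_r => //; rewrite rsum_mulr; apply: rsum_le => q /andP[yq _] _.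
have qR : 0 < INR q by apply: INR_lt0; lia.
rewrite Rmult_comm; apply: Rmult_le_compat_r; last by apply: ln_INR_le; lia.
by apply: Rlt_le; apply: Rinv_0_lt_compat; apply: pow_lt.
Qed.

(** Dividing by [ln q] from below needs an upper bound for [q], hence the truncation at [z]. *)
Lemma prime_tail_ge y z x : (1 < y)%N -> (y <= z <= x)%N ->
  prime_log_tail y z / ln (INR z) <= prime_tail y x.
Proof.
move=> y1 /andP[yz zx].
have lz : 0 < ln (INR z) by rewrite -ln_1; apply: ln_increasing; [lra|apply: (@INR_lt 1); lia].
have T0 q : (y < q)%N -> 0 < / (INR q) ^ 2 by move=> yq; apply: Rinv_0_lt_compat; apply: pow_lt; apply: INR_lt0; lia.
apply: Rle_trans (_ : prime_tail y z <= _); last first.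
  rewrite /prime_tail big_mkcond [X in _ <= X]big_mkcond; apply: rsum_le_range; first by lia.
  by move=> q hq; case: ifP => _; [apply: Rlt_le; apply: T0; lia|lra].
apply/Rle_div_l => //; rewrite rsum_mulr; apply: rsum_le => q /andP[yq qz] _.
rewrite /Rdiv Rmult_comm; apply: Rmult_le_compat_l; first by apply: Rlt_le; apply: T0.
by apply: ln_INR_le; lia.
Qed.

(** The lower bound is taken with [z = K * y]: a constant [K >= 4 / e] makes the primes beyond [z]
    negligible, and still [ln (K * y) / ln y] tends to 1. *)
Lemma prime_tail_asymp e : 0 < e -> exists n0 K, forall y x, (n0 <= y)%N -> (K * y <= x)%N ->
  Rabs (INR y * ln (INR y) * prime_tail y x - 1) <= e.
Proof.
move=> e0; have e4 : 0 < e / 4 by lra.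
have [n0 [n00 hn]] := prime_log_tail_asymp e4.
have [K' hK] := INR_above (4 / e); pose K := K'.+1.
have [n1 [n10 hn1]] := ln_INR_above (4 * ln (INR K) / e + 1).
exists (n0 + n1).+1, K => y x hy yx.
have yK : (y <= K * y)%N by rewrite leq_pmull.
have y1 : (1 < y)%N by lia.
have yR : 0 < INR y by apply: INR_lt0; lia.
have KR := INR_lt0 (isT : (0 < K)%N).
have lK : 0 <= ln (INR K) by apply: ln_INR_ge0.
have ly := hn1 y (ltac:(lia)).
have ly0 : 0 < ln (INR y) by rewrite -ln_1; apply: ln_increasing; [lra|exact: (@INR_lt 1)].
have yl0 : 0 < INR y * ln (INR y) by apply: Rmult_lt_0_compat.
have [_ h2] := hn y x (ltac:(lia)) (ltac:(lia)).
have [h1 _] := hn y (K * y)%N (ltac:(lia)) yK.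
have U := prime_tail_le x y1; have L := @prime_tail_ge y (K * y) x y1; rewrite yK yx in L; have {}L := L isT.
have iK : / INR K <= e / 4.
  have : 4 / e <= INR K by apply: hK; lia.
  move=> /Rle_div_l => /(_ e0) h; rewrite -[/ _]Rmult_1_l; apply/Rle_div_l => //; lra.
apply: Rabs_le; split.
  have lyK : ln (INR (K * y)) = ln (INR K) + ln (INR y) by rewrite INR_muln ln_mult.
  have : INR y * ln (INR y) * (prime_log_tail y (K * y) / ln (INR (K * y))) <= INR y * ln (INR y) * prime_tail y x.
    by apply: Rmult_le_compat_l; lra.
  have : 1 - e / 2 <= INR y * prime_log_tail y (K * y).
    have := Rmult_le_compat_l (INR y) _ _ (Rlt_le _ _ yR) h1; rewrite INR_muln.
    have -> : INR y * (/ INR y - / (INR K * INR y) - e / 4 / INR y) = 1 - / INR K - e / 4 by field; lra.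
    lra.
  have -> : INR y * ln (INR y) * (prime_log_tail y (K * y) / ln (INR (K * y)))
    = (INR y * prime_log_tail y (K * y)) * (ln (INR y) / ln (INR (K * y))).
    by field; rewrite lyK; lra.
  have r1 : 1 - e / 4 <= ln (INR y) / ln (INR (K * y)).
    apply/Rle_div_r; rewrite lyK; first lra.
    have : 4 * ln (INR K) / e <= ln (INR y) by lra.
    move=> /Rle_div_l => /(_ e0) h; nra.
  have r2 : 0 <= ln (INR y) / ln (INR (K * y)) <= 1.
    split; first by apply: Rmult_le_pos; [lra|apply: Rlt_le; apply: Rinv_0_lt_compat; lra].
    apply/Rle_div_l; lra.
  move: (ln (INR y) / _) r1 r2 => r r1 r2; move: (INR y * prime_log_tail _ _) => P hP hT.
  (* For [e >= 2] the lower bound is trivial; otherwise the factors multiplied below are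
     nonnegative. *)
  case: (Rle_dec (1 - e / 2) 0) => he.
    have : 0 <= INR y * ln (INR y) * prime_tail y x; last by lra.
    apply: Rmult_le_pos; first lra; apply: rsum_ge0 => q /andP[yq _] _.
    by apply: Rlt_le; apply: Rinv_0_lt_compat; apply: pow_lt; apply: INR_lt0; lia.
  have : (1 - e / 2) * (1 - e / 4) <= P * r by apply: Rmult_le_compat; lra.
  nra.
have : INR y * ln (INR y) * prime_tail y x <= INR y * ln (INR y) * ((/ INR y + e / 4 / INR y) / ln (INR y)).
  apply: Rmult_le_compat_l; first lra; apply: Rle_trans U _.
  by apply: Rmult_le_compat_r => //; apply: Rlt_le; apply: Rinv_0_lt_compat.
have -> : INR y * ln (INR y) * ((/ INR y + e / 4 / INR y) / ln (INR y)) = 1 + e / 4 by field; lra.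
lra.
Qed.

(** * The sum of divisors *)

Lemma sigmaE N : (0 < N)%N -> INR (Defs.sigma N) = \rsum_(1 <= d < N.+1 | d %| N) INR d.
Proof.
move=> N0; have -> : Defs.sigma N = (\sum_(1 <= d < N.+1 | d %| N) d)%N.
  rewrite /Defs.sigma -[RHS]big_filter; apply: perm_big; apply: uniq_perm.
  - exact: divisors_uniq.
  - by rewrite filter_uniq // iota_uniq.
  move=> d; rewrite -dvdn_divisors // mem_filter mem_index_iota.
  case: (boolP (d %| N)) => //= dN; by rewrite ltnS (dvdn_leq N0 dN) (dvdn_gt0 N0 dN).
exact: (big_morph INR INR_addn).
Qed.

(** Induction on [a] by [sigma (p ^ a.+1 * m) = sigma m + p * sigma (p ^ a * m)]. *)
Lemma sigma_prime_pow_mul p a m : prime p -> (0 < m)%N -> ~~ (p %| m) ->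
  INR (Defs.sigma (p ^ a * m)) * (INR p - 1) = INR (Defs.sigma m) * (INR p ^ a.+1 - 1).
Proof.
move=> pp m0 pm; have p0 := prime_gt0 pp.
elim: a => [|a IH]; first by rewrite mul1n /=; ring.
have pa0 : (0 < p ^ a * m)%N by rewrite muln_gt0 expn_gt0 p0.
have -> : INR (Defs.sigma (p ^ a.+1 * m)) = INR (Defs.sigma m) + INR p * INR (Defs.sigma (p ^ a * m)).
  rewrite expnS -mulnA !sigmaE //; last by rewrite muln_gt0 p0.
  rewrite divisor_rsum_split // rsum_mull; congr (_ + _); last first.
    by apply: eq_bigr => d _; rewrite INR_muln.
  rewrite (@Rbig_widen 0 Rplus 1 m.+1); last first.
  - move=> i /andP[mi _]; apply/negP => /andP[dm pi].
    have : i %| m by move: dm; rewrite Gauss_dvdr // coprime_sym coprimeXl // prime_coprime.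
    by move=> /(dvdn_leq m0); lia.
  - by rewrite /= ltnS leq_pmull // expn_gt0 p0.
  apply: eq_bigl => d; case: (boolP (p %| d)) => pd; rewrite ?andbF ?andbT //=.
    by apply/esym/negbTE; apply: contra pm => /(dvdn_trans pd).
  by rewrite Gauss_dvdr // coprime_sym coprimeXl // prime_coprime.
rewrite Rmult_plus_distr_r Rmult_assoc IH /=; ring.
Qed.

(** For additive arithmetic functions, here [ln (sigma N / N)] and [ln N]. [B] is fixed before the
    induction on [N], so that removing a prime power leaves the range of the sum unchanged. *)
Lemma sum_over_prime_factorization (F : nat -> R) (f : nat -> nat -> R) :
  F 1%N = 0 -> (forall q, prime q -> f q 0%N = 0) ->
  (forall q a m, prime q -> (0 < m)%N -> ~~ (q %| m) -> F (q ^ a * m)%N = f q a + F m) ->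
  forall B N, (0 < N)%N -> (forall q, prime q -> q %| N -> q <= B)%N ->
    F N = \rsum_(1 <= q < B.+1 | prime q) f q (logn q N).
Proof.
move=> F1 f0 Fm B; elim/ltn_ind => N IH N0 hB.
case: (ltnP 1 N) => N1; last first.
  have -> : N = 1%N by lia.
  by rewrite F1 big1 // => q pq; rewrite logn1 f0.
have [p pp pN] : exists2 p, prime p & p %| N by exists (pdiv N); [apply: pdiv_prime|apply: pdiv_dvd].
have [m cpm NE] := pfactor_coprime pp N0.
move: (logn_gt0 p N) NE; rewrite mem_primes pp N0 pN; move: (logn p N) => a a0 NE.
have m0 : (0 < m)%N by move: N0; rewrite NE muln_gt0 => /andP[].
have pm : ~~ (p %| m) by rewrite -prime_coprime.
have mN : (m < N)%N.
  by rewrite NE -{1}[m]muln1 ltn_pmul2l // -{1}(expn0 p) ltn_exp2l // prime_gt1.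
have mdN : m %| N by rewrite NE dvdn_mulr.
have pB : (0 < p < B.+1)%N by rewrite prime_gt0 // ltnS hB.
rewrite NE mulnC Fm // (IH m mN m0); last by move=> q pq qm; apply: hB => //; apply: dvdn_trans mdN.
rewrite (@Rbig_D1 _ _ p) //= [X in _ = X](@Rbig_D1 _ _ p) //=.
have lm : logn p m = 0%N by apply/eqP; rewrite -leqn0 leqNgt logn_gt0 mem_primes (negbTE pm) !andbF.
have pa0 : (0 < p ^ a)%N by rewrite expn_gt0 prime_gt0.
rewrite lm f0 // Rplus_0_l (lognM _ pa0 m0) lm addn0 pfactorK //; congr (_ + _).
apply: eq_bigr => q /andP[pq qp].
by rewrite (lognM _ pa0 m0) lognX (logn_prime _ pp) (negbTE qp) muln0.
Qed.

Lemma prime_INR_ge2 q : prime q -> 2 <= INR q.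
Proof. by move=> /prime_gt1; apply: (@INR_le 2). Qed.

(** The term at exponent [a] is the logarithm of [(1 - q ^ -(a + 1)) / (1 - 1 / q)], which is 0 at
    [a = 0], so primes not dividing [N] may be included. *)
Lemma ln_sigma_formula B N : (0 < N)%N -> (forall q, prime q -> q %| N -> q <= B)%N ->
  ln (INR (Defs.sigma N) / INR N)
  = \rsum_(1 <= q < B.+1 | prime q)
      (ln (INR q / (INR q - 1)) + ln (1 - / INR q ^ (logn q N).+1)).
Proof.
move: B N; apply: (sum_over_prime_factorization (F := fun N => ln (INR (Defs.sigma N) / INR N))
   (f := fun q a => ln (INR q / (INR q - 1)) + ln (1 - / INR q ^ a.+1))).
- by rewrite sigmaE // big_mkcond big_nat1 /= Rdiv_1_r ln_1.
- move=> q /prime_INR_ge2 q2; rewrite -ln_mult.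
  + by rewrite (_ : _ * _ = 1) ?ln_1 //= ; field; lra.
  + by apply: Rdiv_lt_0_compat; lra.
  + by rewrite /= Rmult_1_r; have : / INR q <= / 2; [apply: Rinv_le_contravar; lra|lra].
move=> q a m pq m0 qm; have q2 := prime_INR_ge2 pq.
have mR := INR_lt0 m0.
have s0 : 0 < INR (Defs.sigma m).
  rewrite sigmaE // (@Rbig_D1 _ _ m) ?dvdnn ?m0 //=.
  by apply: Rplus_lt_le_0_compat => //; apply: rsum_ge0 => d _ _; apply: pos_INR.
have qa : 1 < INR q ^ a.+1 by apply: Rlt_pow_R1; [lra|apply/ltP].
have u0 : 0 < 1 - / INR q ^ a.+1.
  by have := Rinv_lt_contravar 1 (INR q ^ a.+1); rewrite Rinv_1 Rmult_1_l; move=> /(_ _ qa); lra.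
have v0 : 0 < INR q / (INR q - 1) by apply: Rdiv_lt_0_compat; lra.
have w0 : 0 < INR (Defs.sigma m) / INR m by apply: Rdiv_lt_0_compat.
rewrite -ln_mult // -ln_mult //; last by apply: Rmult_lt_0_compat.
congr ln.
have := sigma_prime_pow_mul a pq m0 qm => E.
have qa' : INR q ^ a <> 0 by apply: pow_nonzero; lra.
have -> : INR (Defs.sigma (q ^ a * m)) = INR (Defs.sigma m) * (INR q ^ a.+1 - 1) / (INR q - 1).
  by rewrite -E; field; lra.
have -> : INR (q ^ a * m) = INR q ^ a * INR m.
  rewrite INR_muln; congr (_ * _); elim: (a) => [|i IH] //.
  by rewrite expnS INR_muln IH.
by rewrite /=; field; repeat split; lra.
Qed.

Lemma ln_formula B N : (0 < N)%N -> (forall q, prime q -> q %| N -> q <= B)%N ->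
  ln (INR N) = \rsum_(1 <= q < B.+1 | prime q) (INR (logn q N) * ln (INR q)).
Proof.
move: B N; apply: (sum_over_prime_factorization (F := fun N => ln (INR N))
   (f := fun q a => INR a * ln (INR q))); first by rewrite /= ln_1.
- by move=> q _; rewrite /=; ring.
move=> q a m pq m0 _; have q0 := INR_lt0 (prime_gt0 pq).
rewrite INR_muln ln_mult; [|by apply: INR_lt0; rewrite expn_gt0 prime_gt0|exact: INR_lt0].
congr (_ + _); elim: a => [|a IH]; first by rewrite /= ln_1; ring.
rewrite expnS INR_muln ln_mult //; last by apply: INR_lt0; rewrite expn_gt0 prime_gt0.
by rewrite IH S_INR; ring.
Qed.

(** * The optimal cut *)

Lemma is_lim_seq_eps (u : nat -> R) (l : R) :
  (forall e, 0 < e -> exists n0, forall n, (n0 <= n)%N -> Rabs (u n - l) <= e) -> is_lim_seq u l.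
Proof.
move=> h; apply/is_lim_seq_spec => e; have e2 : 0 < e / 2 by have := cond_pos e; lra.
have [n0 hn] := h _ e2; exists n0 => n /leP nn; have := hn n nn; have := cond_pos e; lra.
Qed.

Lemma is_lim_seq_eps_ge (u : nat -> R) (l : R) : is_lim_seq u l ->
  forall e, 0 < e -> exists n0, forall n, (n0 <= n)%N -> Rabs (u n - l) < e.
Proof.
move=> /is_lim_seq_spec h e e0; have [n0 hn] := h (mkposreal e e0).
by exists n0 => n /leP nn; apply: hn.
Qed.

Lemma filterlim_eventually (f : nat -> nat) :
  (forall m, exists n0, forall n, (n0 <= n)%N -> (m <= f n)%N) -> filterlim f eventually eventually.
Proof.
move=> h P [m hm]; have [n0 hn] := h m; exists n0 => n /leP nn; apply: hm; apply/leP; exact: hn.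
Qed.

Lemma is_lim_ratio_theta : is_lim_seq (fun n => theta n / INR n) 1.
Proof.
apply: is_lim_seq_eps => e e0; have [n0 hn] := theta_asymp e0; exists n0.+1 => n nn.
have nR : 0 < INR n by apply: INR_lt0; lia.
rewrite (_ : theta n / INR n - 1 = (theta n - INR n) / INR n); last by field; lra.
rewrite /Rdiv Rabs_mult (Rabs_pos_eq (/ _)); last by apply: Rlt_le; apply: Rinv_0_lt_compat.
by apply/Rle_div_l => //; apply: hn; lia.
Qed.

Lemma is_lim_ln_INR : is_lim_seq (fun n => ln (INR n)) p_infty.
Proof.
apply/is_lim_seq_spec => M; have [n0 [_ hn]] := ln_INR_above (M + 1).
by exists n0 => n /leP nn; have := hn n nn; lra.
Qed.

Lemma is_lim_inv_pinfty (u : nat -> R) : is_lim_seq u p_infty -> is_lim_seq (fun n => / u n) 0.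
Proof. by move=> h; have := is_lim_seq_inv _ _ h; apply. Qed.

Lemma is_lim_sqrt_INR : is_lim_seq (fun n => sqrt (INR n)) p_infty.
Proof.
apply/is_lim_seq_spec => M; have [n0 hn] := INR_above ((Rabs M + 1) ^ 2).
exists n0 => n /leP nn; have h := hn n nn; have M0 := Rabs_pos M.
apply: Rlt_le_trans (_ : Rabs M + 1 <= _); first by have := Rle_abs M; lra.
rewrite -[X in X <= _]sqrt_pow2; last lra.
exact: sqrt_le_1_alt.
Qed.

(** [ln u = ln (u / v) + ln v], where the first term converges and the second tends to infinity. *)
Lemma is_lim_ln_ratio (u v : nat -> R) (c : R) : 0 < c ->
  is_lim_seq (fun n => u n / v n) c -> (exists n0, forall n, (n0 <= n)%N -> 0 < v n) ->
  is_lim_seq (fun n => ln (v n)) p_infty -> is_lim_seq (fun n => ln (u n) / ln (v n)) 1.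
Proof.
move=> c0 huv [n0 hv] hlv.
have c2 : 0 < c / 2 by lra.
have [n1 hn1] := is_lim_seq_eps_ge huv c2.
have := proj2 (is_lim_seq_spec _ _) hlv => /(_ 1) [n2 hn2].
apply: (is_lim_seq_ext_loc (fun n => ln (u n / v n) * / ln (v n) + 1)).
  exists (n0 + n1 + n2)%N => n /leP nn.
  have v0 := hv n (ltac:(lia)); have := hn1 n (ltac:(lia)).
  have l0 : 1 < ln (v n) by apply: hn2; lia.
  move=> /Rabs_lt_between h.
  have r0 : 0 < u n / v n by lra.
  have u0 : 0 < u n by have := Rmult_lt_0_compat _ _ r0 v0; rewrite (_ : _ * _ = u n) //; field; lra.
  by rewrite ln_div //; field; lra.
have -> : Rbar.Finite 1 = Rbar.Finite (ln c * 0 + 1) by congr Rbar.Finite; ring.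
apply: is_lim_seq_plus'; last exact: is_lim_seq_const.
apply: is_lim_seq_mult'; last exact: is_lim_inv_pinfty.
apply: is_lim_seq_continuous huv.
by apply: derivable_continuous_pt; exists (/ c); apply: derivable_pt_lim_ln.
Qed.

Lemma INR_eventually_gt0 : exists n0, forall n, (n0 <= n)%N -> 0 < INR n.
Proof. by exists 1%N => n /INR_lt0. Qed.

(** The [y] of the overview, rounded to an integer. *)
Definition cut n := Nat.sqrt (2 * n)%N.

Lemma cut_bounds n : sqrt 2 * sqrt (INR n) - 1 <= INR (cut n) <= sqrt 2 * sqrt (INR n).
Proof.
rewrite -sqrt_mult_alt; last lra.
have [r1 r2] := Nat.sqrt_spec (2 * n) (Nat.le_0_l _); rewrite -/(cut n) in r1 r2.
have E : 2 * INR n = INR (2 * n)%N by rewrite INR_muln.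
rewrite E; split.
  have : sqrt (INR (2 * n)) <= INR (cut n).+1; last by rewrite S_INR; lra.
  rewrite -[X in _ <= X]sqrt_square; last exact: pos_INR.
  by apply: sqrt_le_1_alt; rewrite -INR_muln; apply: INR_le; lia.
rewrite -[X in X <= _]sqrt_square; last exact: pos_INR.
by apply: sqrt_le_1_alt; rewrite -INR_muln; apply: INR_le; lia.
Qed.

Lemma sqrt2_bounds : 1 < sqrt 2 < 3 / 2.
Proof.
have s2 := sqrt_sqrt 2 (ltac:(lra)); have := sqrt_pos 2; nra.
Qed.

Lemma sqrt_INR_ge1 n : (0 < n)%N -> 1 <= sqrt (INR n).
Proof. by move=> n0; rewrite -sqrt_1; apply: sqrt_le_1_alt; apply: INR_ge1. Qed.

Lemma is_lim_cut : is_lim_seq (fun n => INR (cut n) / sqrt (INR n)) (sqrt 2).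
Proof.
apply: is_lim_seq_eps => e e0.
have [n0 hn] := is_lim_seq_eps_ge (is_lim_inv_pinfty is_lim_sqrt_INR) e0.
exists n0.+1 => n nn; have := hn n (ltac:(lia)); have [b1 b2] := cut_bounds n.
have s1 : 1 <= sqrt (INR n) by apply: sqrt_INR_ge1; lia.
rewrite Rminus_0_r => /Rabs_lt_between [_ h].
apply: Rabs_le; split.
  suff : sqrt 2 - / sqrt (INR n) <= INR (cut n) / sqrt (INR n) by lra.
  apply/Rle_div_r; first lra.
  by rewrite Rmult_minus_distr_r Rinv_l; lra.
have : INR (cut n) / sqrt (INR n) <= sqrt 2 by apply/Rle_div_l; lra.
lra.
Qed.

Lemma cut_eventually_ge m : exists n0, forall n, (n0 <= n)%N -> (m <= cut n)%N.
Proof.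
exists (m * m)%N => n hn; have [r1 r2] := Nat.sqrt_spec (2 * n) (Nat.le_0_l _).
by rewrite -/(cut n) in r1 r2; rewrite leqNgt; apply/negP => hc; nia.
Qed.

Lemma cut_eventually_mul_le K : exists n0, forall n, (n0 <= n)%N -> (K * cut n <= n)%N.
Proof.
exists (2 * K * K)%N => n hn; have [r1 r2] := Nat.sqrt_spec (2 * n) (Nat.le_0_l _).
rewrite -/(cut n) in r1 r2; rewrite leqNgt; apply/negP => hc.
have h1 : (n * n < (K * cut n) * (K * cut n))%N by nia.
have h2 : ((K * cut n) * (K * cut n) <= K * K * (2 * n))%N.
  by rewrite mulnACA leq_mul2l; apply/orP; right; lia.
nia.
Qed.

Lemma is_lim_ln_cut : is_lim_seq (fun n => ln (INR (cut n)) / ln (INR n)) (1 / 2).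
Proof.
have h : is_lim_seq (fun n => ln (INR (cut n)) / ln (sqrt (INR n))) 1.
  apply: (is_lim_ln_ratio (c := sqrt 2)); first by have := sqrt2_bounds; lra.
  - exact: is_lim_cut.
  - by exists 1%N => n n0; have := sqrt_INR_ge1 n0; lra.
  apply: (is_lim_comp_seq ln _ p_infty); [exact: is_lim_ln_p|by exists 0%N|exact: is_lim_sqrt_INR].
have := is_lim_seq_scal_r _ (1 / 2) _ h; rewrite /= Rmult_1_l.
apply: is_lim_seq_ext_loc; exists 2%N => n /leP n2.
have l0 : 0 < ln (INR n) by rewrite -ln_1; apply: ln_increasing; [lra|exact: (@INR_lt 1)].
by rewrite -Rpower_sqrt ?ln_exp; [field; lra|apply: INR_lt0; lia].
Qed.

Lemma is_lim_theta_cut : is_lim_seq (fun n => theta (cut n) / sqrt (INR n)) (sqrt 2).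
Proof.
have h := is_lim_seq_subseq _ _ cut (filterlim_eventually cut_eventually_ge) is_lim_ratio_theta.
have := is_lim_seq_mult' _ _ _ _ h is_lim_cut; rewrite Rmult_1_l.
have [n0 hn] := cut_eventually_ge 1.
apply: is_lim_seq_ext_loc; exists n0.+1 => n /leP nn.
have c0 : 0 < INR (cut n) by apply: INR_lt0; apply: hn; lia.
have s1 : 1 <= sqrt (INR n) by apply: sqrt_INR_ge1; lia.
by field; lra.
Qed.

Lemma ln_INR_gt0 n : (1 < n)%N -> 0 < ln (INR n).
Proof. by move=> n1; rewrite -ln_1; apply: ln_increasing; [lra|exact: (@INR_lt 1)]. Qed.

(** The tail is about [1 / (y ln y)] at [y = cut n], where [y ~ sqrt 2 * sqrt n] and
    [ln y ~ ln n / 2]. *)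
Lemma is_lim_prime_tail_cut :
  is_lim_seq (fun n => sqrt (INR n) * ln (INR n) * prime_tail (cut n) n) (sqrt 2).
Proof.
have h : is_lim_seq (fun n => INR (cut n) * ln (INR (cut n)) * prime_tail (cut n) n) 1.
  apply: is_lim_seq_eps => e e0; have [n0 [K hn]] := prime_tail_asymp e0.
  have [n1 h1] := cut_eventually_ge n0; have [n2 h2] := cut_eventually_mul_le K.
  by exists (n1 + n2)%N => n nn; apply: hn; [apply: h1|apply: h2]; lia.
have s2 := sqrt2_bounds; have ss := sqrt_sqrt 2 (ltac:(lra)).
have := is_lim_seq_div' _ _ _ _ h (is_lim_seq_mult' _ _ _ _ is_lim_cut is_lim_ln_cut).
rewrite (_ : 1 / (sqrt 2 * (1 / 2)) = sqrt 2); last first.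
  by apply: (Rmult_eq_reg_r (sqrt 2)); [rewrite ss; field|]; lra.
move=> /(_ (ltac:(lra))); have [n0 hn] := cut_eventually_ge 2.
apply: is_lim_seq_ext_loc; exists n0.+2 => n /leP nn.
have c2 := hn n (ltac:(lia)).
have c0 : 0 < INR (cut n) by apply: INR_lt0; lia.
have lc := ln_INR_gt0 c2; have ln0 : 0 < ln (INR n) by apply: ln_INR_gt0; lia.
have s1 : 1 <= sqrt (INR n) by apply: sqrt_INR_ge1; lia.
by field; lra.
Qed.

Lemma is_lim_near_theta_ln (w : nat -> R) : is_lim_seq (fun n => w n / INR n) 1 ->
  is_lim_seq (fun n => INR n * ln (INR n) / (w n * ln (w n))) 1.
Proof.
move=> hw.
have hl := is_lim_ln_ratio Rlt_0_1 hw INR_eventually_gt0 is_lim_ln_INR.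
have := is_lim_seq_mult' _ _ _ _ hw hl; rewrite Rmult_1_l => h.
have := is_lim_seq_inv _ _ h; rewrite /= Rinv_1 => /(_ _).
move=> H; have {}H := H (ltac:(by case; lra)); move: H.
have e2 : 0 < 1 / 2 by lra.
have [n1 h1] := is_lim_seq_eps_ge h e2.
apply: is_lim_seq_ext_loc; exists (n1 + 2)%N => n /leP nn.
have nR : 0 < INR n by apply: INR_lt0; lia.
have ln0 : 0 < ln (INR n) by apply: ln_INR_gt0; lia.
have := h1 n (ltac:(lia)) => /Rabs_lt_between [hh _].
have : w n * ln (w n) <> 0.
  move=> E; have : w n / INR n * (ln (w n) / ln (INR n)) = 0; last by lra.
  by rewrite (_ : _ * _ = w n * ln (w n) / (INR n * ln (INR n))); [rewrite E; field; lra|field; lra].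
move=> E; have [E1 E2] : w n <> 0 /\ ln (w n) <> 0 by split=> E'; apply: E; rewrite E'; ring.
by field; lra.
Qed.

Definition excess x (a : nat -> nat) := \rsum_(1 <= q < x.+1 | prime q) ((INR (a q) - 1) * ln (INR q)).
Definition defect x (a : nat -> nat) := \rsum_(1 <= q < x.+1 | prime q) (- ln (1 - / INR q ^ (a q).+1)).
(* For [N] with support [{q <= x}] and exponents [a], [ln G(N) = S(x) - ln ln theta(x) - loss x a]. *)
Definition loss x a := ln (ln (theta x + excess x a)) - ln (ln (theta x)) + defect x a.

Lemma inv_pow_le_half q a : 2 <= q -> (0 < a)%N -> 0 < / q ^ a <= / 2.
Proof.
move=> q2; case: a => // a _.
have h : 2 <= q ^ a.+1 by have := @pow_R1_Rle q a (ltac:(lra)); rewrite /=; nra.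
by split; [apply: Rinv_0_lt_compat; lra|apply: Rinv_le_contravar; lra].
Qed.

Lemma neg_ln_ge u : u < 1 -> u <= - ln (1 - u).
Proof. by move=> u1; have := @ln_le_sub1 (1 - u); lra. Qed.

Lemma neg_ln_le u : u < 1 -> - ln (1 - u) <= u / (1 - u).
Proof.
move=> u1; rewrite -ln_Rinv; last lra.
have := @ln_le_sub1 (/ (1 - u)) (ltac:(apply: Rinv_0_lt_compat; lra)).
by rewrite (_ : u / (1 - u) = / (1 - u) - 1) //; field; lra.
Qed.

Lemma excess_ge0 x a : (forall q, prime q -> q <= x -> 0 < a q)%N -> 0 <= excess x a.
Proof.
move=> ha; apply: rsum_ge0 => q /andP[q0 qx] pq; apply: Rmult_le_pos; last exact: ln_INR_ge0.
by have := INR_ge1 (ha q pq qx); lra.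
Qed.

Lemma defect_ge0 x a : (forall q, prime q -> q <= x -> 0 < a q)%N -> 0 <= defect x a.
Proof.
move=> ha; apply: rsum_ge0 => q /andP[q0 qx] pq.
have := inv_pow_le_half (prime_INR_ge2 pq) (ltn0Sn (a q)) => -[h0 h1].
by have := @neg_ln_ge (/ INR q ^ (a q).+1) (ltac:(lra)); lra.
Qed.

(** For [A <= A0] concavity bounds the growth of [ln ln] from below by [A] times the slope at
    [th + A0], the same for all such [A]; beyond [A0] monotonicity gives at least the value at
    [A0]. *)
Lemma lnln_diff_ge th A A0 : 1 < th -> 0 <= A -> 0 <= A0 ->
  Rmin A A0 / ((th + A0) * ln (th + A0)) <= ln (ln (th + A)) - ln (ln th).
Proof.
move=> th1 A00 A01.
have key B : 0 <= B -> B <= A0 -> B / ((th + A0) * ln (th + A0)) <= ln (ln (th + B)) - ln (ln th).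
  move=> B0 BA.
  have l0 : 0 < ln th by rewrite -ln_1; apply: ln_increasing; lra.
  have l1 : ln th <= ln (th + B) by apply: ln_le; lra.
  have l2 : ln (th + B) <= ln (th + A0) by apply: ln_le; lra.
  have h1 := @ln_diff_le (ln (th + B)) (ln th) (ltac:(lra)) l0.
  have h2 := @ln_diff_le (th + B) th (ltac:(lra)) (ltac:(lra)).
  have h3 : B / (th + B) <= ln (th + B) - ln th.
    by rewrite (_ : B / (th + B) = - ((th - (th + B)) / (th + B))); [lra|field; lra].
  have h4 : (ln (th + B) - ln th) / ln (th + B) <= ln (ln (th + B)) - ln (ln th).
    rewrite (_ : (_ - _) / _ = - ((ln th - ln (th + B)) / ln (th + B))); [lra|field; lra].
  apply: Rle_trans h4.
  apply: Rle_trans (_ : B / (th + B) / ln (th + B) <= _); last first.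
    by apply: Rmult_le_compat_r => //; apply: Rlt_le; apply: Rinv_0_lt_compat; lra.
  rewrite (_ : B / (th + B) / ln (th + B) = B / ((th + B) * ln (th + B))); last by field; lra.
  apply: Rmult_le_compat_l => //; apply: Rinv_le_contravar.
    by apply: Rmult_lt_0_compat; lra.
  by apply: Rmult_le_compat; lra.
rewrite /Rmin; case: Rle_dec => h; first exact: key.
apply: Rle_trans (key A0 A01 (Rle_refl _)) _.
have l0 : 0 < ln (th + A0) by rewrite -ln_1; apply: ln_increasing; lra.
have : ln (ln (th + A0)) <= ln (ln (th + A)); last lra.
by apply: ln_le => //; apply: ln_le; lra.
Qed.

Lemma lnln_diff_le th A : 1 < th -> 0 <= A ->
  ln (ln (th + A)) - ln (ln th) <= A / (th * ln th).
Proof.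
move=> th1 A0; have l0 : 0 < ln th by rewrite -ln_1; apply: ln_increasing; lra.
have l1 : ln th <= ln (th + A) by apply: ln_le; lra.
apply: Rle_trans (@ln_diff_le (ln th) (ln (th + A)) l0 (ltac:(lra))) _.
have := @ln_diff_le th (th + A) (ltac:(lra)) (ltac:(lra)).
rewrite (_ : th + A - th = A); last ring.
move=> h; rewrite (_ : A / (th * ln th) = A / th / ln th); last by field; lra.
by apply: Rmult_le_compat_r => //; apply: Rlt_le; apply: Rinv_0_lt_compat.
Qed.

Lemma prime_sum_split x y (F : nat -> R) : (y <= x)%N ->
  \rsum_(1 <= q < x.+1 | prime q) F q
  = \rsum_(1 <= q < y.+1 | prime q) F q + \rsum_(y.+1 <= q < x.+1 | prime q) F q.
Proof. by move=> yx; rewrite (@big_cat_nat _ _ _ y.+1). Qed.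

(* Each prime pays either [lam * ln q] (a further factor [q]) or [1 / q^2]; the two prices are
   equal, up to the factor [1 - |t - 1/t|], at [q = y], whence the optimal cut. *)
Lemma loss_terms_ge x y a lam : (1 < y <= x)%N -> 0 < lam ->
  (forall q, prime q -> q <= x -> 0 < a q)%N ->
  let t := lam * ((INR y) ^ 2 * ln (INR y)) in
  (1 - Rabs (t - / t)) * (lam * theta y + prime_tail y x) <= lam * excess x a + defect x a.
Proof.
move=> /andP[y1 yx] lam0 ha t.
have yR : 0 < INR y by apply: INR_lt0; lia.
have ly := ln_INR_gt0 y1.
have t0 : 0 < t.
  by apply: Rmult_lt_0_compat => //; apply: Rmult_lt_0_compat => //; apply: pow_lt.
set ka := 1 - Rabs (t - / t).
have it0 := Rinv_0_lt_compat _ t0.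
have tt : t * / t = 1 by apply: Rinv_r; lra.
(* [ka] is at most each of 1, [t] and [1 / t]. *)
have [k1 [k2 k3]] : ka <= 1 /\ ka <= t /\ ka * t <= 1.
  rewrite /ka; split; first by have := Rabs_pos (t - / t); lra.
  case: (Rle_dec t 1) => ht.
    have : 1 <= / t by rewrite -Rinv_1; apply: Rinv_le_contravar.
    by move=> h; rewrite Rabs_left1; [split; nra|lra].
  have : / t <= 1 by rewrite -Rinv_1; apply: Rinv_le_contravar; lra.
  by move=> h; rewrite Rabs_pos_eq; [split; nra|lra].
have -> : lam * excess x a + defect x a
  = \rsum_(1 <= q < x.+1 | prime q) (lam * ((INR (a q) - 1) * ln (INR q)) + - ln (1 - / INR q ^ (a q).+1)).
  by rewrite rsumD -rsum_mull.
rewrite (prime_sum_split _ yx) Rmult_plus_distr_l thetaE !rsum_mull.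
(* Exponent 1 pays at least [1 / q ^ 2] through the defect, a larger one at least [lam * ln q]
   through the excess. *)
have T q : prime q -> (q <= x)%N -> lam * ln (INR q) <= lam * ((INR (a q) - 1) * ln (INR q)) + - ln (1 - / INR q ^ (a q).+1)
   \/ / INR q ^ 2 <= lam * ((INR (a q) - 1) * ln (INR q)) + - ln (1 - / INR q ^ (a q).+1).
  move=> pq qx; have lq : 0 <= ln (INR q) by apply: ln_INR_ge0; apply: prime_gt0.
  have [h0 h1] := inv_pow_le_half (prime_INR_ge2 pq) (ltn0Sn (a q)).
  have h2 := @neg_ln_ge (/ INR q ^ (a q).+1) (ltac:(lra)).
  have := ha q pq qx; case: (a q) h0 h2 => [|[|b]] // h0 h2 _.
    by right; move: h2; rewrite (_ : INR 1 - 1 = 0); [rewrite /=; lra|rewrite /=; ring].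
  left; have : lam * (1 * ln (INR q)) <= lam * ((INR b.+2 - 1) * ln (INR q)); last lra.
  apply: Rmult_le_compat_l; first lra; apply: Rmult_le_compat_r => //.
  by rewrite !S_INR; have := pos_INR b; lra.
apply: Rplus_le_compat; apply: rsum_le => q /andP[q1 q2] pq.
  have qR := INR_lt0 (prime_gt0 pq); have qx : (q <= x)%N by lia.
  have lq : 0 <= ln (INR q) by apply: ln_INR_ge0; apply: prime_gt0.
  have l0 : 0 <= lam * ln (INR q) by apply: Rmult_le_pos; lra.
  case: (T q pq qx) => h; first by nra.
  (* For [q <= y], monotonicity of [q ^ 2 * ln q] gives [lam * ln q <= t / q ^ 2], and
     [ka * t <= 1]. *)
  apply: Rle_trans h; case: (Rle_dec ka 0) => k0.
    apply: Rle_trans (_ : 0 <= _); first by nra.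
    by apply: Rlt_le; apply: Rinv_0_lt_compat; apply: pow_lt.
  have q20 : 0 < INR q ^ 2 by apply: pow_lt.
  rewrite -[/ _]Rmult_1_l; apply: (proj1 (Rle_div_r _ 1 _ q20)).
  apply: Rle_trans k3; rewrite Rmult_assoc; apply: Rmult_le_compat_l; first lra.
  rewrite /t Rmult_assoc; apply: Rmult_le_compat_l; first lra.
  rewrite Rmult_comm; apply: Rmult_le_compat => //; first lra.
    by apply: pow_incr; split; [lra|apply: INR_le].
  by apply: ln_INR_le; rewrite prime_gt0.
have qx : (q <= x)%N by lia.
have qR := INR_lt0 (prime_gt0 pq); have q20 : 0 < INR q ^ 2 by apply: pow_lt.
have i0 := Rinv_0_lt_compat _ q20.
case: (T q pq qx) => h; last by nra.
(* For [q > y] the comparison reverses: [lam * ln q >= t / q ^ 2], and [ka <= t]. *)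
apply: Rle_trans h; apply/Rle_div_l => //; apply: Rle_trans k2 _.
rewrite /t Rmult_assoc; apply: Rmult_le_compat_l; first lra.
rewrite Rmult_comm; apply: Rmult_le_compat; [lra|exact: pow_le (Rlt_le _ _ yR)| |].
  by apply: ln_INR_le; lia.
by apply: pow_incr; split; [lra|apply: INR_le; lia].
Qed.

(** An excess above [4 * sqrt n] is too expensive by itself, so a uniform slope of [ln ln] is wanted
    only up to [theta_wide n]; [price n] is the slope at that point. *)
Definition theta_wide n := theta n + 4 * sqrt (INR n).
Definition price n := / (theta_wide n * ln (theta_wide n)).

Lemma is_lim_theta_wide : is_lim_seq (fun n => theta_wide n / INR n) 1.
Proof.
have -> : Rbar.Finite 1 = Rbar.Finite (1 + 4 * 0) by congr Rbar.Finite; ring.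
apply: (is_lim_seq_ext_loc (fun n => theta n / INR n + 4 * / sqrt (INR n))).
  exists 1%N => n /leP n1; have s1 := sqrt_INR_ge1 n1; have nR := INR_lt0 n1.
  rewrite /theta_wide; have ss := sqrt_sqrt (INR n) (Rlt_le _ _ nR).
  rewrite (_ : 4 * / sqrt (INR n) = 4 * sqrt (INR n) / (sqrt (INR n) * sqrt (INR n))); last by field; lra.
  by rewrite ss; field; lra.
apply: is_lim_seq_plus'; first exact: is_lim_ratio_theta.
apply: is_lim_seq_mult'; first exact: is_lim_seq_const.
exact: is_lim_inv_pinfty is_lim_sqrt_INR.
Qed.

Lemma is_lim_price : is_lim_seq (fun n => INR n * ln (INR n) * price n) 1.
Proof. exact: is_lim_near_theta_ln is_lim_theta_wide. Qed.

(** This is the [t] of [loss_terms_ge]; its limit 1 says that the two prices agree at the cut. *)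
Lemma is_lim_cut_price : is_lim_seq (fun n => price n * (INR (cut n) ^ 2 * ln (INR (cut n)))) 1.
Proof.
have h := is_lim_seq_mult' _ _ _ _ is_lim_price
  (is_lim_seq_mult' _ _ _ _ (is_lim_seq_mult' _ _ _ _ is_lim_cut is_lim_cut) is_lim_ln_cut).
move: h; rewrite sqrt_sqrt; last lra.
rewrite (_ : 1 * (2 * (1 / 2)) = 1); last field.
apply: is_lim_seq_ext_loc; exists 2%N => n /leP n2.
have nR : 0 < INR n by apply: INR_lt0; lia.
have s1 : 1 <= sqrt (INR n) by apply: sqrt_INR_ge1; lia.
have l0 : 0 < ln (INR n) by apply: ln_INR_gt0; lia.
have ss := sqrt_sqrt (INR n) (Rlt_le _ _ nR).
rewrite (_ : INR (cut n) / sqrt (INR n) * (INR (cut n) / sqrt (INR n)) = INR (cut n) ^ 2 / (sqrt (INR n) * sqrt (INR n))); last by field; lra.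
by rewrite ss; field; lra.
Qed.

Lemma theta_eventually_ge M : exists n0, forall n, (n0 <= n)%N -> M <= theta n.
Proof.
have e2 : 0 < 1 / 2 by lra.
have [n0 hn] := theta_asymp e2; have [n1 h1] := INR_above (2 * M).
exists (n0 + n1)%N => n nn; have := hn n (ltac:(lia)); have := h1 n (ltac:(lia)).
by move=> h /Rabs_le_between; lra.
Qed.

Lemma loss_lower e : 0 < e -> exists n0, forall x, (n0 <= x)%N ->
  forall a, (forall q, prime q -> q <= x -> 0 < a q)%N ->
    (2 * sqrt 2 - e) / (sqrt (INR x) * ln (INR x)) <= loss x a.
Proof.
move=> e0; have s2 := sqrt2_bounds.
pose t n := price n * (INR (cut n) ^ 2 * ln (INR (cut n))).
(* The bound of [loss_terms_ge] in units of [1 / (sqrt n * ln n)]; its two halves tend to [sqrt 2]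
   each. *)
pose m n := (1 - Rabs (t n - / t n)) * (sqrt (INR n) * ln (INR n) * (price n * theta (cut n) + prime_tail (cut n) n)).
have hm : is_lim_seq m (2 * sqrt 2).
  have -> : Rbar.Finite (2 * sqrt 2) = Rbar.Finite ((1 - Rabs (1 - / 1)) * (1 * sqrt 2 + sqrt 2)).
    by congr Rbar.Finite; rewrite Rinv_1 Rminus_diag Rabs_R0; ring.
  have ht : is_lim_seq t 1 := is_lim_cut_price.
  apply: is_lim_seq_mult'.
    apply: is_lim_seq_minus'; first exact: is_lim_seq_const.
    apply: (is_lim_seq_abs _ (Rbar.Finite (1 - / 1))).
    apply: is_lim_seq_minus' => //.
    by apply: (is_lim_seq_inv _ _ ht); case; lra.
  have := is_lim_seq_plus' _ _ _ _ (is_lim_seq_mult' _ _ _ _ is_lim_price is_lim_theta_cut) is_lim_prime_tail_cut.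
  apply: is_lim_seq_ext_loc; exists 1%N => n /leP n1.
  have nR := INR_lt0 n1; have s1 := sqrt_INR_ge1 n1; have ss := sqrt_sqrt (INR n) (Rlt_le _ _ nR).
  rewrite (_ : INR n * ln (INR n) * price n * (theta (cut n) / sqrt (INR n))
     = sqrt (INR n) * sqrt (INR n) * ln (INR n) * price n * (theta (cut n) / sqrt (INR n))); last by rewrite ss.
  by field; lra.
have [n0 h0] := is_lim_seq_eps_ge hm e0.
(* For a large excess it is enough to know the price up to the factor [3 / 4], since
   [4 * (3 / 4) = 3 > 2 * sqrt 2]. *)
have q4 : 0 < 1 / 4 by lra.
have [n1 h1] := is_lim_seq_eps_ge is_lim_price q4.
have [n2 h2] := theta_eventually_ge 2.
have [n3 h3] := cut_eventually_ge 2; have [n4 h4] := cut_eventually_mul_le 1.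
exists (n0 + n1 + n2 + n3 + n4).+2 => x hx a ha.
have {}h0 := h0 x (ltac:(lia)); have {}h1 := h1 x (ltac:(lia)); have {}h2 := h2 x (ltac:(lia)).
have {}h3 := h3 x (ltac:(lia)); have := h4 x (ltac:(lia)); rewrite mul1n => {}h4.
have s1 : 1 <= sqrt (INR x) by apply: sqrt_INR_ge1; lia.
have l0 : 0 < ln (INR x) by apply: ln_INR_gt0; lia.
have nR : 0 < INR x by apply: INR_lt0; lia.
have A0 := excess_ge0 ha; have D0 := defect_ge0 ha.
have L := @lnln_diff_ge (theta x) (excess x a) (4 * sqrt (INR x)) (ltac:(lra)) A0 (ltac:(lra)).
rewrite -/(theta_wide x) /Rdiv -/(price x) in L.
have w2 : 2 <= theta_wide x by rewrite /theta_wide; lra.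
have p0 : 0 < price x.
  apply: Rinv_0_lt_compat; apply: Rmult_lt_0_compat; first lra.
  by rewrite -ln_1; apply: ln_increasing; lra.
apply/Rle_div_l; first by apply: Rmult_lt_0_compat; lra.
have sl0 : 0 < sqrt (INR x) * ln (INR x) by apply: Rmult_lt_0_compat; lra.
case: (Rle_dec (excess x a) (4 * sqrt (INR x))) => hA.
  rewrite Rmin_left // in L.
  have := @loss_terms_ge x (cut x) a (price x); rewrite h3 h4 => /(_ isT p0 ha) /= T.
  have : (1 - Rabs (t x - / t x)) * (price x * theta (cut x) + prime_tail (cut x) x) <= loss x a.
    by rewrite /loss; apply: Rle_trans T _; lra.
  move=> /(Rmult_le_compat_r _ _ _ (Rlt_le _ _ sl0)).
  move: h0 => /Rabs_lt_between; rewrite /m; lra.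
rewrite Rmin_right in L; last lra.
have : 4 * sqrt (INR x) * price x <= loss x a by rewrite /loss; lra.
move=> /(Rmult_le_compat_r _ _ _ (Rlt_le _ _ sl0)).
have ss := sqrt_sqrt (INR x) (Rlt_le _ _ nR).
rewrite (_ : 4 * sqrt (INR x) * price x * (sqrt (INR x) * ln (INR x)) = 4 * (sqrt (INR x) * sqrt (INR x) * ln (INR x) * price x)); last ring.
rewrite ss; move: h1 => /Rabs_lt_between; lra.
Qed.

(* Primes up to [y] get exponent 2; those up to [z] get enough more to make [1 / q ^ (a + 1)] negligible. *)
Definition cut_exponent y z q := if (q <= y)%N then maxn 2 (trunc_log q (z ^ 3)) else 1%N.

Lemma cut_exponent_gt0 y z q : (0 < cut_exponent y z q)%N.
Proof. by rewrite /cut_exponent; case: ifP => // _; rewrite leq_max. Qed.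

Lemma ln_INR_pow q n : (0 < q)%N -> ln (INR (q ^ n)) = INR n * ln (INR q).
Proof.
move=> q0; have qR := INR_lt0 q0; elim: n => [|n IH]; first by rewrite expn0 /= ln_1; ring.
rewrite expnS INR_muln ln_mult //; last by apply: INR_lt0; rewrite expn_gt0 q0.
by rewrite IH S_INR; ring.
Qed.

Lemma INR_expn q n : INR (q ^ n) = INR q ^ n.
Proof. by elim: n => // n IH; rewrite expnS INR_muln IH. Qed.

(** For [z < q <= y] the exponent is exactly 2, because [q ^ 3 > z ^ 3]. For [q <= z] either it is 2
    or [q ^ a <= z ^ 3], an additional cost of at most [3 * ln z] each. *)
Lemma excess_cut_le x y z : (0 < z <= y)%N -> (y <= x)%N ->
  excess x (cut_exponent y z) <= theta y + 3 * INR z * ln (INR z).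
Proof.
move=> /andP[z0 zy] yx; rewrite /excess (prime_sum_split _ yx) [X in _ + X]big_nat_cond.
rewrite [X in _ + X]big1 => [|q /andP[/andP[yq _] _]]; last first.
  by rewrite /cut_exponent leqNgt yq /=; ring.
rewrite Rplus_0_r thetaE !(prime_sum_split _ zy) Rplus_assoc.
have H1 : \rsum_(z.+1 <= q < y.+1 | prime q) ((INR (cut_exponent y z q) - 1) * ln (INR q))
   <= \rsum_(z.+1 <= q < y.+1 | prime q) ln (INR q).
  apply: rsum_le => q /andP[zq qy] pq; rewrite /cut_exponent -ltnS qy.
  have lt3 : (trunc_log q (z ^ 3) < 3)%N.
    rewrite ltnNge; apply/negP => h3.
    have h : (q ^ 3 <= z ^ 3)%N.
      apply: leq_trans (trunc_logP (prime_gt1 pq) _); first by rewrite leq_exp2l // prime_gt1.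
      by rewrite expn_gt0 z0.
    by move: h; rewrite leq_exp2r // leqNgt zq.
  have /maxn_idPl -> : (trunc_log q (z ^ 3) <= 2)%N by [].
  by rewrite /=; lra.
have lz := ln_INR_ge0 z0.
have H2 : \rsum_(1 <= q < z.+1 | prime q) ((INR (cut_exponent y z q) - 1) * ln (INR q))
   <= \rsum_(1 <= q < z.+1 | prime q) ln (INR q) + 3 * INR z * ln (INR z).
  have -> : 3 * INR z * ln (INR z) = \rsum_(1 <= q < z.+1) (3 * ln (INR z)).
    by rewrite rsum_const // subSS subn0; ring.
  rewrite big_mkcond [X in _ <= X + _]big_mkcond -rsumD; apply: rsum_le => q /andP[q0 qz] _.
  case: ifP => pq; last lra.
  have lq : 0 <= ln (INR q) by apply: ln_INR_ge0.
  have qlz : ln (INR q) <= ln (INR z) by apply: ln_INR_le; rewrite q0.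
  rewrite /cut_exponent (leq_trans _ zy) //.
  have h : INR (trunc_log q (z ^ 3)) * ln (INR q) <= 3 * ln (INR z).
    rewrite -ln_INR_pow // (_ : 3 = INR 3); last by rewrite /=; ring.
    rewrite -ln_INR_pow //; apply: ln_INR_le; rewrite expn_gt0 q0 /=.
    by apply: trunc_logP; [exact: prime_gt1|rewrite expn_gt0 z0].
  case: (leqP 2 (trunc_log q (z ^ 3))) => h2; first lra.
  by rewrite /=; lra.
lra.
Qed.

(** For [q <= z] the power [q ^ a.+1] exceeds [z ^ 3], which gives [2 / z ^ 2] in total; for
    [z < q <= y] the terms are at most [2 / q ^ 3], again [2 / z ^ 2] in total; beyond [y] the
    exponent is 1 and the tail is the main term. *)
Lemma defect_cut_le x y z : (0 < z <= y)%N -> (1 < y <= x)%N ->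
  defect x (cut_exponent y z) <= 4 / INR z ^ 2 + prime_tail y x / (1 - / INR y ^ 2).
Proof.
move=> /andP[z0 zy] /andP[y1 yx]; rewrite /defect (prime_sum_split _ yx).
have zR := INR_lt0 z0; have yR : 0 < INR y by apply: INR_lt0; lia.
have z2 : 0 < INR z ^ 2 by apply: pow_lt.
have y2 := inv_pow_le_half (@INR_le 2 y y1) (isT : (0 < 2)%N).
have U q b : prime q -> (0 < b)%N -> - ln (1 - / INR q ^ b) <= 2 * / INR q ^ b.
  move=> pq b0; have [h0 h1] := inv_pow_le_half (prime_INR_ge2 pq) b0.
  apply: Rle_trans (@neg_ln_le (/ INR q ^ b) (ltac:(lra))) _.
  apply/Rle_div_l; [lra|nra].
apply: Rplus_le_compat; last first.
  apply/Rle_div_r; first lra; rewrite rsum_mulr; apply: rsum_le => q /andP[yq qx] pq.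
  rewrite /cut_exponent leqNgt yq /=.
  have qR := INR_lt0 (prime_gt0 pq); have q2 : 0 < INR q ^ 2 by apply: pow_lt.
  have [h0 h1] := inv_pow_le_half (prime_INR_ge2 pq) (isT : (0 < 2)%N).
  have h2 : / INR q ^ 2 <= / INR y ^ 2.
    by apply: Rinv_le_contravar; [apply: pow_lt|apply: pow_incr; split; [lra|apply: INR_le; lia]].
  have := @neg_ln_le (/ INR q ^ 2) (ltac:(lra)); rewrite /= in h0 h1 h2 y2 * => h3.
  apply: Rle_trans (Rmult_le_compat_r _ _ _ _ h3) _; first lra.
  rewrite /Rdiv Rmult_assoc -[X in _ <= X]Rmult_1_r; apply: Rmult_le_compat_l; first lra.
  by rewrite Rmult_comm; apply/Rle_div_l; lra.
rewrite (prime_sum_split _ zy).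
have -> : 4 / INR z ^ 2 = 2 / INR z ^ 2 + 2 / INR z ^ 2 by field; lra.
apply: Rplus_le_compat.
  have -> : 2 / INR z ^ 2 = \rsum_(1 <= q < z.+1) (2 / INR z ^ 3).
    by rewrite rsum_const // subSS subn0; field; lra.
  rewrite big_mkcond; apply: rsum_le => q /andP[q0 qz] _.
  have z3 : 0 < 2 / INR z ^ 3 by apply: Rdiv_lt_0_compat; [lra|apply: pow_lt].
  case: ifP => pq; last lra.
  apply: Rle_trans (U q _ pq (ltn0Sn _)) _.
  apply: Rmult_le_compat_l; first lra.
  apply: Rinv_le_contravar; first exact: pow_lt.
  rewrite -!INR_expn; apply: INR_le; rewrite /cut_exponent (leq_trans _ zy) //.
  apply: leq_trans (ltnW (trunc_log_ltn (z ^ 3) (prime_gt1 pq))) _.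
  by rewrite leq_exp2l ?prime_gt1 // ltnS leq_maxr.
apply: Rle_trans (_ : 2 / INR z * \rsum_(z.+1 <= q < y.+1) / INR q ^ 2 <= _).
  rewrite rsum_mull big_mkcond; apply: rsum_le => q /andP[zq qy] _.
  have qR : 0 < INR q by apply: INR_lt0; lia.
  have zq' : INR z <= INR q by apply: INR_le; lia.
  have q2 : 0 < INR q ^ 2 by apply: pow_lt.
  case: ifP => pq; last first.
    by apply: Rlt_le; apply: Rmult_lt_0_compat; [apply: Rdiv_lt_0_compat; lra|apply: Rinv_0_lt_compat].
  apply: Rle_trans (U q _ pq (ltn0Sn _)) _.
  apply: Rle_trans (_ : 2 * / INR q ^ 3 <= _).
    apply: Rmult_le_compat_l; first lra.
    apply: Rinv_le_contravar; first exact: pow_lt.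
    apply: Rle_pow; first by have := prime_INR_ge2 pq; lra.
    by apply/leP; rewrite /cut_exponent (_ : (q <= y)%N) // ltnS leq_maxl.
  rewrite (_ : 2 * / INR q ^ 3 = 2 / INR q * / INR q ^ 2); last by field; lra.
  apply: Rmult_le_compat_r; first by apply: Rlt_le; apply: Rinv_0_lt_compat.
  by apply: Rmult_le_compat_l; [lra|apply: Rinv_le_contravar].
rewrite (_ : 2 / INR z ^ 2 = 2 / INR z * / INR z); last by field; lra.
apply: Rmult_le_compat_l; first by apply: Rlt_le; apply: Rdiv_lt_0_compat; lra.
have := @sum_inv_sq_range z y; rewrite z0 zy => /(_ isT).
have : 0 < / INR y by apply: Rinv_0_lt_compat.
lra.
Qed.

(* [z ~ x ^ (3/8)]: any exponent strictly between 1/4 and 1/2 would do. *)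
Definition small_cut n : nat := proj1_sig (nfloor_ex (exp (3 / 8 * ln (INR n))) (Rlt_le _ _ (exp_pos _))).

(** [t] is [n ^ (1/16)], so that [sqrt n], [small_cut n] and [ln n] are all compared with integral
    powers of [t]. *)
Lemma small_cut_bounds n : (0 < n)%N -> exists t, [/\ ln (INR n) <= 16 * t, 1 <= t,
  sqrt (INR n) = t ^ 8 & INR (small_cut n) <= t ^ 6 < INR (small_cut n) + 1].
Proof.
move=> n0; have nR := INR_lt0 n0; pose u := ln (INR n) / 16; exists (exp u).
have E k : exp u ^ k = exp (INR k * u).
  elim: k => [|k IH]; first by rewrite /= Rmult_0_l exp_0.
  by rewrite S_INR Rmult_plus_distr_r exp_plus -IH Rmult_1_l /=; ring.
have u0 : 0 <= u by have := ln_INR_ge0 n0; rewrite /u; lra.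
split.
- by have := exp_ineq1_le u; rewrite /u; lra.
- by have := exp_ineq1_le u; lra.
- rewrite E -Rpower_sqrt // /Rpower; congr exp; rewrite /u /=; field.
- rewrite E /small_cut; case: nfloor_ex => m /=.
  by rewrite (_ : (1 + 1 + 1 + 1 + 1 + 1) * u = 3 / 8 * ln (INR n)) //; rewrite /u; field.
Qed.

(** The two errors of the construction in units of [1 / (sqrt n * ln n)], up to constants: the price
    of the higher powers of primes up to [z], and the defect [4 / z ^ 2]. *)
Lemma small_cut_eventually : exists n0, forall n, (n0 <= n)%N ->
  [/\ (0 < small_cut n <= cut n)%N,
      INR (small_cut n) * ln (INR (small_cut n)) / sqrt (INR n) <= 256 / ln (INR n) &
      sqrt (INR n) * ln (INR n) / INR (small_cut n) ^ 2 <= 1024 / ln (INR n)].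
Proof.
(* [32 <= ln n <= 16 * t] gives [t >= 2]. *)
have [n0 [n00 h0]] := ln_INR_above 32; exists n0 => n nn.
have n1 : (0 < n)%N by lia.
have l32 := h0 n nn; have [t [lt t1 st [z1 z2]]] := small_cut_bounds n1.
have t2 : 2 <= t by lra.
have t4 : 4 <= t ^ 2 by rewrite (_ : t ^ 2 = t * t); [nra|ring].
have t6 : 64 <= t ^ 6 by rewrite (_ : t ^ 6 = t ^ 2 * (t ^ 2 * t ^ 2)); [have : 16 <= t ^ 2 * t ^ 2; nra|ring].
have z0 : (0 < small_cut n)%N.
  by rewrite lt0n; apply/negP => /eqP E; rewrite E /= in z2; lra.
have zR := INR_lt0 z0; have [c1 _] := cut_bounds n; have s2 := sqrt2_bounds.
have t8 : t ^ 8 = t ^ 6 * t ^ 2 by ring.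
have t80 : 0 < t ^ 8 by rewrite t8; nra.
split.
- rewrite z0 leqNgt; apply/negP => /INR_lt hc.
  have : t ^ 8 <= sqrt 2 * t ^ 8 by rewrite -[X in X <= _]Rmult_1_l; apply: Rmult_le_compat_r; lra.
  by rewrite st in c1; rewrite t8 in c1 *; nra.
- have zl : ln (INR (small_cut n)) <= ln (INR n).
    apply: ln_le => //; apply: Rle_trans z1 _.
    rewrite -(sqrt_sqrt (INR n)); last exact: pos_INR.
    rewrite st t8; move: (t ^ 6) (t ^ 2) t6 t4 => a b a64 b4.
    have ab : 256 <= a * b by nra.
    by nra.
  have lz := ln_INR_ge0 z0.
  rewrite st; apply/Rle_div_l => //.
  apply: Rle_trans (_ : t ^ 6 * (16 * t) <= _); first by apply: Rmult_le_compat; lra.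
  rewrite (_ : 256 / ln (INR n) * t ^ 8 = t ^ 6 * (256 * (t * t) / ln (INR n))); last by rewrite t8; field; lra.
  apply: Rmult_le_compat_l; first lra.
  have l0 : ln (INR n) > 0 by lra.
  apply: (proj1 (Rle_div_r _ _ _ l0)).
  by have : t * ln (INR n) <= t * (16 * t); [apply: Rmult_le_compat_l|]; lra.
have zh : t ^ 6 / 2 <= INR (small_cut n) by lra.
have zz : t ^ 6 / 2 * (t ^ 6 / 2) <= INR (small_cut n) ^ 2.
  by rewrite (_ : INR _ ^ 2 = INR (small_cut n) * INR (small_cut n)); [apply: Rmult_le_compat; lra|ring].
apply/Rle_div_l; first exact: pow_lt.
apply: Rle_trans (_ : 1024 / ln (INR n) * (t ^ 6 / 2 * (t ^ 6 / 2)) <= _); last first.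
  by apply: Rmult_le_compat_l => //; apply: Rlt_le; apply: Rdiv_lt_0_compat; lra.
rewrite st (_ : 1024 / ln (INR n) * (t ^ 6 / 2 * (t ^ 6 / 2)) = t ^ 8 * (256 * t ^ 4 / ln (INR n))); last by field; lra.
apply: Rmult_le_compat_l; first lra.
apply/Rle_div_r; first lra.
apply: Rle_trans (_ : (16 * t) * (16 * t) <= _); first by apply: Rmult_le_compat; lra.
by rewrite (_ : t ^ 4 = t ^ 2 * t ^ 2); [rewrite /=; nra|ring].
Qed.

Lemma loss_upper e : 0 < e -> exists n0, forall x, (n0 <= x)%N ->
  loss x (cut_exponent (cut x) (small_cut x)) <= (2 * sqrt 2 + e) / (sqrt (INR x) * ln (INR x)).
Proof.
move=> e0; have s2 := sqrt2_bounds.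
(* The excess times the slope of [ln ln] at [theta n], plus the defect, both multiplied by
   [sqrt n * ln n]. *)
pose m n := (theta (cut n) / sqrt (INR n) + 3 * (256 * / ln (INR n)))
    * (INR n * ln (INR n) / (theta n * ln (theta n)))
  + (4 * (1024 * / ln (INR n))
     + sqrt (INR n) * ln (INR n) * prime_tail (cut n) n / (1 - / INR (cut n) * / INR (cut n))).
have il := is_lim_inv_pinfty is_lim_ln_INR.
have hc : is_lim_seq (fun n => INR (cut n)) p_infty.
  exact: is_lim_seq_subseq _ _ cut (filterlim_eventually cut_eventually_ge) is_lim_seq_INR.
have ic := is_lim_inv_pinfty hc.
have hm : is_lim_seq m (2 * sqrt 2).
  have -> : Rbar.Finite (2 * sqrt 2) = Rbar.Finite ((sqrt 2 + 3 * (256 * 0)) * 1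
     + (4 * (1024 * 0) + sqrt 2 / (1 - 0 * 0))).
    by congr Rbar.Finite; field; lra.
  apply: is_lim_seq_plus'.
    apply: is_lim_seq_mult'; last exact: is_lim_near_theta_ln is_lim_ratio_theta.
    apply: is_lim_seq_plus'; first exact: is_lim_theta_cut.
    by do 2!(apply: is_lim_seq_mult'; first exact: is_lim_seq_const).
  apply: is_lim_seq_plus'.
    by do 2!(apply: is_lim_seq_mult'; first exact: is_lim_seq_const).
  apply: is_lim_seq_div'; [exact: is_lim_prime_tail_cut| |lra].
  apply: is_lim_seq_minus'; first exact: is_lim_seq_const.
  exact: is_lim_seq_mult'.
have [n0 h0] := is_lim_seq_eps_ge hm e0.
have [n1 h1] := small_cut_eventually.
have [n2 h2] := theta_eventually_ge 2.
have [n3 h3] := cut_eventually_ge 2; have [n4 h4] := cut_eventually_mul_le 1.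
exists (n0 + n1 + n2 + n3 + n4).+2 => x hx.
have {}h0 := h0 x (ltac:(lia)); have {}[zc hz1 hz2] := h1 x (ltac:(lia)); have {}h2 := h2 x (ltac:(lia)).
have {}h3 := h3 x (ltac:(lia)); have := h4 x (ltac:(lia)); rewrite mul1n => {}h4.
have s1 : 1 <= sqrt (INR x) by apply: sqrt_INR_ge1; lia.
have l0 : 0 < ln (INR x) by apply: ln_INR_gt0; lia.
have nR : 0 < INR x by apply: INR_lt0; lia.
have sl0 : 0 < sqrt (INR x) * ln (INR x) by apply: Rmult_lt_0_compat; lra.
have cx : (1 < cut x <= x)%N by rewrite h3 h4.
have A0 := @excess_ge0 x (cut_exponent (cut x) (small_cut x)) (fun q _ _ => cut_exponent_gt0 _ _ q).
have A1 := excess_cut_le zc h4; have A2 := defect_cut_le zc cx.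
have L := @lnln_diff_le (theta x) (excess x (cut_exponent (cut x) (small_cut x))) (ltac:(lra)) A0.
have lth : 0 < ln (theta x) by rewrite -ln_1; apply: ln_increasing; lra.
have tl0 : 0 < theta x * ln (theta x) by apply: Rmult_lt_0_compat; lra.
apply/Rle_div_r => //.
suff : loss x (cut_exponent (cut x) (small_cut x)) * (sqrt (INR x) * ln (INR x)) <= m x.
  by move: h0 => /Rabs_lt_between; lra.
rewrite /loss Rmult_plus_distr_r; apply: Rplus_le_compat.
  apply: Rle_trans (_ : (theta (cut x) + 3 * INR (small_cut x) * ln (INR (small_cut x)))
      / (theta x * ln (theta x)) * (sqrt (INR x) * ln (INR x)) <= _).
    apply: Rmult_le_compat_r; first lra; apply: Rle_trans L _.
    by apply: Rmult_le_compat_r => //; apply: Rlt_le; apply: Rinv_0_lt_compat.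
  have ss := sqrt_sqrt (INR x) (Rlt_le _ _ nR).
  rewrite -[X in _ <= _ * (X * _ / _)]ss.
  rewrite (_ : _ / _ * _ = (theta (cut x) / sqrt (INR x) + 3 * (INR (small_cut x) * ln (INR (small_cut x)) / sqrt (INR x)))
    * (sqrt (INR x) * sqrt (INR x) * ln (INR x) / (theta x * ln (theta x)))); last by field; lra.
  apply: Rmult_le_compat_r; last by move: hz1; rewrite /Rdiv; lra.
  by rewrite ss; apply: Rmult_le_pos; [nra|apply: Rlt_le; apply: Rinv_0_lt_compat].
apply: Rle_trans (Rmult_le_compat_r _ _ _ (Rlt_le _ _ sl0) A2) _.
have cR : 2 <= INR (cut x) by apply: (@INR_le 2).
have zR : 0 < INR (small_cut x) by apply: INR_lt0; case/andP: zc.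
have c4 : 0 < INR (cut x) ^ 2 - 1 by rewrite /=; nra.
rewrite Rmult_plus_distr_r; apply: Rplus_le_compat.
  rewrite (_ : 4 / _ * _ = 4 * (sqrt (INR x) * ln (INR x) / INR (small_cut x) ^ 2)); last by field; lra.
  by move: hz2; rewrite /Rdiv; lra.
by right; field; split; [nra|lra].
Qed.

(** * The extremal values *)

Lemma next_primeP m : [/\ (m < next_prime m)%N, prime (next_prime m) &
  forall q, (m < q)%N -> prime q -> (next_prime m <= q)%N].
Proof.
rewrite /next_prime; case: ex_minnP => q /andP[mq pq] h; split=> // r mr pr.
by apply: h; rewrite mr.
Qed.

Lemma pr0_prime k : prime (pr0 k).
Proof. by case: k => [//|k] /=; have [] := next_primeP (pr0 k). Qed.

Lemma pr0_ltn k : (k < pr0 k)%N.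
Proof.
elim: k => [//|k IH] /=; have [h _ _] := next_primeP (pr0 k); exact: leq_ltn_trans IH h.
Qed.

Lemma pr0_leq j k : (j <= k)%N -> (pr0 j <= pr0 k)%N.
Proof.
move=> /subnKC <-; elim: (k - j)%N => [|d IH]; rewrite ?addn0 ?addnS //=.
by have [h _ _] := next_primeP (pr0 (j + d)); apply: leq_trans IH (ltnW h).
Qed.

Lemma pr0_surj k q : prime q -> (q <= pr0 k)%N -> exists2 j, (j <= k)%N & q = pr0 j.
Proof.
move=> pq; elim: k => [|k IH] /= hq.
  by exists 0%N => //; apply/eqP; rewrite eqn_leq hq prime_gt1.
case: (leqP q (pr0 k)) => h.
  by have [j jk ->] := IH h; exists j => //; apply: leqW.
have [_ _ m] := next_primeP (pr0 k).
by exists k.+1 => //=; apply/eqP; rewrite eqn_leq hq m.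
Qed.

Lemma p_prime k : prime (p k). Proof. exact: pr0_prime. Qed.

Lemma p_geq k : (k <= p k)%N.
Proof. by case: k => // k; apply: pr0_ltn. Qed.

Lemma inWt_dvd k N : (0 < k)%N -> inWt k N ->
  (0 < N)%N /\ forall q, prime q -> (q %| N) = (q <= p k)%N.
Proof.
move=> k0 [N1 [h1 h2]]; split=> [|q pq]; first exact: ltnW.
apply/idP/idP; first exact: h1.
move=> qk; have [j jk ->] := pr0_surj pq qk.
(* [p] counts from 1 and [pr0] from 0. *)
have := h2 j.+1; rewrite /p /=; apply => //; by move: jk k0; case: (k).
Qed.

Definition prime_prod B (a : nat -> nat) : nat := (\prod_(1 <= q < B.+1 | prime q) q ^ a q)%N.

Lemma logn_prime_prod B a : (0 < prime_prod B a)%N /\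
  forall q, prime q -> logn q (prime_prod B a) = if (q <= B)%N then a q else 0%N.
Proof.
elim: B => [|B [IH0 IH]].
  by rewrite /prime_prod big_geq //; split=> // q pq; rewrite logn1 leqNgt prime_gt0.
have -> : prime_prod B.+1 a = (prime_prod B a * (if prime B.+1 then B.+1 ^ a B.+1 else 1))%N.
  by rewrite /prime_prod big_mkcond big_nat_recr //= -big_mkcond.
case: (boolP (prime B.+1)) => pB; last first.
  rewrite muln1; split=> // q pq; rewrite IH // [(q <= B.+1)%N]leq_eqVlt ltnS.
  by case: (eqVneq q B.+1) => // E; move: pB; rewrite -E pq.
have e0 : (0 < B.+1 ^ a B.+1)%N by rewrite expn_gt0.
split=> [|q pq]; first by rewrite muln_gt0 IH0.
rewrite (lognM _ IH0 e0) IH // lognX (logn_prime _ pB).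
case: (eqVneq q B.+1) => [->|qB]; first by rewrite ltnn leqnn muln1.
by rewrite muln0 addn0 [(q <= B.+1)%N]leq_eqVlt (negbTE qB).
Qed.

Lemma inWt_prime_prod k a : (0 < k)%N -> (forall q, 0 < a q)%N -> inWt k (prime_prod (p k) a).
Proof.
move=> k0 ha; have [P0 hl] := logn_prime_prod (p k) a.
have dv q : prime q -> (q %| prime_prod (p k) a) = (q <= p k)%N.
  move=> pq; have : (0 < logn q (prime_prod (p k) a))%N = (q %| prime_prod (p k) a).
    by rewrite logn_gt0 mem_primes pq P0.
  by move=> <-; rewrite hl //; case: ifP => // _; apply: ha.
split; last split.
- have := dv (p k) (p_prime k); rewrite leqnn => /(dvdn_leq P0).
  exact: leq_trans (prime_gt1 (p_prime k)).
- by move=> q pq; rewrite dv.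
move=> j j1 jk; rewrite dv; last exact: p_prime.
by apply: pr0_leq; lia.
Qed.

(** [theta > 1] forces [ln N > 1], so [ln (ln N)] and [G N] are positive and the logarithm of the
    quotient splits. *)
Lemma ln_G_loss k N : (0 < k)%N -> 1 < theta (p k) -> inWt k N ->
  0 < G N /\ ln (G N) = Ssum (p k) - ln (ln (theta (p k))) - loss (p k) (fun q => logn q N).
Proof.
move=> k0 th1 hN; have [N0 hd] := inWt_dvd k0 hN.
have hB q : prime q -> q %| N -> (q <= p k)%N by move=> pq; rewrite hd.
have ha q : prime q -> (q <= p k -> 0 < logn q N)%N.
  by move=> pq qk; rewrite logn_gt0 mem_primes pq N0 hd.
have E1 := ln_sigma_formula N0 hB; have E2 := ln_formula N0 hB.
have A0 := excess_ge0 ha.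
have lN : ln (INR N) = theta (p k) + excess (p k) (fun q => logn q N).
  by rewrite E2 thetaE /excess -rsumD; apply: eq_bigr => q _; ring.
have llN : 0 < ln (ln (INR N)) by rewrite -ln_1; apply: ln_increasing; lra.
have NR := INR_lt0 N0.
have s0 : 0 < INR (Defs.sigma N).
  rewrite sigmaE // (@Rbig_D1 _ _ N) ?dvdnn ?N0 //=.
  by apply: Rplus_lt_le_0_compat => //; apply: rsum_ge0 => d _ _; apply: pos_INR.
have sN : 0 < INR (Defs.sigma N) / INR N by apply: Rdiv_lt_0_compat.
have GE : G N = INR (Defs.sigma N) / INR N / ln (ln (INR N)) by rewrite /G; field; lra.
split; first by rewrite GE; apply: Rdiv_lt_0_compat.
rewrite GE ln_div // E1 lN /loss SsumE rsumD.
have -> : defect (p k) (fun q => logn q N)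
   = - \rsum_(1 <= q < (p k).+1 | prime q) ln (1 - / INR q ^ (logn q N).+1).
  rewrite /defect (_ : forall x, - x = -1 * x); last by move=> ?; ring.
  by rewrite rsum_mull; apply: eq_bigr => q _; ring.
ring.
Qed.

Lemma loss_ext x a b : (forall q, prime q -> q <= x -> a q = b q)%N -> loss x a = loss x b.
Proof.
move=> h; rewrite /loss /excess /defect.
congr (ln (ln (_ + _)) - _ + _); rewrite big_nat_cond [RHS]big_nat_cond;
  by apply: eq_bigr => q /andP[/andP[_ qx] pq]; rewrite h.
Qed.

Definition witness k := prime_prod (p k) (cut_exponent (cut (p k)) (small_cut (p k))).

Lemma inWt_witness k : (0 < k)%N -> inWt k (witness k).
Proof. by move=> k0; apply: inWt_prime_prod => // q; apply: cut_exponent_gt0. Qed.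

(** [real] sends an infinite supremum to 0, so finiteness has to be shown: [U] bounds the supremum
    above, and the witness keeps it at or above a positive value of [G]. *)
Lemma gt_bounds k U : (0 < k)%N -> 1 < theta (p k) ->
  (forall N, inWt k N -> ln (G N) <= U) ->
  (forall N, inWt k N -> ln (G N) <= gt k) /\ gt k <= U.
Proof.
move=> k0 th1 hU; set E := fun y : R => exists N, inWt k N /\ y = G N.
have [ub lub] : is_lub_Rbar E (Lub_Rbar E) := Lub_Rbar_correct E.
have G0 N : inWt k N -> 0 < G N by move=> hN; have [] := ln_G_loss k0 th1 hN.
have hM := inWt_witness k0.
have le1 : Rbar_le (Lub_Rbar E) (exp U).
  apply: lub => _ [N [hN ->]] /=; rewrite -[G N]exp_ln; last exact: G0.
  by case: (hU N hN) => [h|->]; [apply: Rlt_le; apply: exp_increasing|lra].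
have le2 N : inWt k N -> Rbar_le (G N) (Lub_Rbar E) by move=> hN; apply: ub; exists N.
have le3 := le2 _ hM; rewrite /gt /Gt -/E; move: le3 le1 le2; case: (Lub_Rbar E) => [r| |] //= h1 h2 h3.
have r0 : 0 < r := Rlt_le_trans _ _ _ (G0 _ hM) h1.
split; first by move=> N hN; apply: ln_le; [apply: G0|apply: h3].
by rewrite -[U]ln_exp; apply: ln_le.
Qed.

(** The bounds are not strict; the theorem gets strict ones by applying this to [e / 2]. *)
Lemma gt_asymp e : 0 < e -> exists K, forall k, (K <= k)%N ->
  let c := sqrt (INR (p k)) * ln (INR (p k)) in
  let s := Ssum (p k) - ln (ln (theta (p k))) in
  [/\ 0 < c, forall N, inWt k N -> ln (G N) <= gt k,
      s - (2 * sqrt 2 + e) / c <= ln (G (witness k)) & gt k <= s - (2 * sqrt 2 - e) / c].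
Proof.
move=> e0; have [n0 h0] := loss_lower e0; have [n1 h1] := loss_upper e0.
have [n2 h2] := theta_eventually_ge 2.
exists (n0 + n1 + n2).+2 => k hk c s.
have pk := p_geq k; have k0 : (0 < k)%N by lia.
have {}h0 := h0 (p k) (ltac:(lia)); have {}h1 := h1 (p k) (ltac:(lia)).
have th1 : 1 < theta (p k) by have := h2 (p k) (ltac:(lia)); lra.
have c0 : 0 < c.
  apply: Rmult_lt_0_compat; last by apply: ln_INR_gt0; lia.
  by have := @sqrt_INR_ge1 (p k) (ltac:(lia)); lra.
have hU N : inWt k N -> ln (G N) <= s - (2 * sqrt 2 - e) / c.
  move=> hN; have [_ ->] := ln_G_loss k0 th1 hN.
  have [N0 hd] := inWt_dvd k0 hN.
  have := h0 (fun q => logn q N); rewrite -/c -/s => H.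
  have := H _; suff hl : forall q, prime q -> (q <= p k -> 0 < logn q N)%N by move=> /(_ hl); lra.
  by move=> q pq qk; rewrite logn_gt0 mem_primes pq N0 hd.
have [g1 g2] := gt_bounds k0 th1 hU.
split=> //; have [_ ->] := ln_G_loss k0 th1 (inWt_witness k0).
rewrite (@loss_ext _ _ (cut_exponent (cut (p k)) (small_cut (p k)))); first by rewrite -/s; move: h1; rewrite -/c; lra.
by move=> q pq qk; have [_ ->] := logn_prime_prod (p k) (cut_exponent (cut (p k)) (small_cut (p k))); rewrite ?qk.
Qed.

(* Up to here [Finite] and the order in [%nat] are mathcomp's; the theorem is about [Rbar] and the
   propositional order. *)
Import Coquelicot.Rbar.
Delimit Scope coq_nat_scope with nat.

Theorem theorem1 :
  LimInf_seq (fun k => (gt k - euler_gamma - Q_k k) * sqrt (INR (p k)) * ln (INR (p k)))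
    = Finite (- (2 * sqrt 2))
  /\
  (exists M : nat -> nat,
     (forall k : nat, (1 <= k)%nat -> inWt k (M k)) /\
     (forall eps : R, 0 < eps -> exists K : nat, forall k : nat, (K < k)%nat ->
        ln (G (M k)) <= gt k /\
        S_k k - ln (ln (theta_k k)) - (2 * sqrt 2 + eps) / (sqrt (INR (p k)) * ln (INR (p k)))
          < ln (G (M k))))
  /\
  (exists E : nat -> Prop,
     (forall n : nat, exists k : nat, (n < k)%nat /\ E k) /\
     (forall eps : R, 0 < eps -> exists K : nat, forall k : nat, E k -> (K < k)%nat ->
        forall N : nat, inWt k N ->
        ln (G N) <= gt k /\
        gt k < S_k k - ln (ln (theta_k k)) - (2 * sqrt 2 - eps) / (sqrt (INR (p k)) * ln (INR (p k))))).
Proof.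
have shrink a b c : 0 < c -> a < b -> a / c < b / c.
  by move=> c0 ab; apply: Rmult_lt_compat_r => //; apply: Rinv_0_lt_compat.
split; [|split].
- apply: is_LimInf_seq_unique; apply: is_lim_LimInf_seq; apply: is_lim_seq_eps => e e0.
  have [K hK] := gt_asymp e0; exists K.+1 => k hk.
  have [c0 h1 h2 h3] := hK k (ltnW hk); have {}h1 := h1 _ (@inWt_witness k (ltac:(lia))).
  rewrite /Q_k /Q Rmult_assoc; move: c0 h1 h2 h3; set c := sqrt _ * _ => c0 h1 h2 h3.
  move: h2 h3; set s := _ - ln (ln _) => h2 h3.
  have -> : gt k - euler_gamma - (s - euler_gamma) = gt k - s by ring.
  have g1 : - (2 * sqrt 2 + e) / c <= gt k - s by rewrite Ropp_div; lra.
  have g2 : gt k - s <= - (2 * sqrt 2 - e) / c by rewrite Ropp_div; lra.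
  have {}g1 := proj1 (Rle_div_l _ _ _ c0) g1; have {}g2 := proj2 (Rle_div_r _ _ _ c0) g2.
  by apply: Rabs_le; lra.
- exists witness; split=> [k /leP|e e0]; first exact: inWt_witness.
  have e2 : 0 < e / 2 by lra.
  have [K hK] := gt_asymp e2; exists K => k /ltP hk.
  have [c0 h1 h2 _] := hK k (ltnW hk).
  split; first by apply: h1; apply: inWt_witness; lia.
  apply: Rlt_le_trans h2; rewrite /S_k /theta_k.
  have := @shrink (2 * sqrt 2 + e / 2) (2 * sqrt 2 + e) _ c0; lra.
exists (fun _ => True); split=> [n|e e0]; first by exists n.+1; split=> //; apply/ltP.
have e2 : 0 < e / 2 by lra.
have [K hK] := gt_asymp e2; exists K => k _ /ltP hk N hN.
have [c0 h1 _ h3] := hK k (ltnW hk).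
split; first exact: h1.
apply: Rle_lt_trans h3 _; rewrite /S_k /theta_k.
have := @shrink (2 * sqrt 2 - e) (2 * sqrt 2 - e / 2) _ c0; lra.
Qed.
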